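(* Let $V,W$ be Banach spaces, let $A$ be the generator of a $C_0$-semigroup $(S_t)_{t\ge 0}$ on $W$, and let $T\in\mathbb R_+$. Let $\mathbf X=(X,\mathbb X)\in\mathscr C^{\beta}([0,T],V)$ be a rough path for some index $\beta\in(\frac13,\frac12]$, and let $f_0\in\mathrm{Lip}([0,T]\times W,D(A))$ and $f\in C_b^{2\beta,3}([0,T]\times W,L(V,D(A^2)))$ be mappings such that $$f_0|_{[0,T]\times D(A)}\in\mathrm{Lip}([0,T]\times D(A),D(A^2)),\qquad f|_{[0,T]\times D(A)}\in C_b^{2\beta,3}([0,T]\times D(A),L(V,D(A^3))).$$ Then for every $\xi\in D(A^2)$ there exists a unique mild solution $(Y,Y')\in\mathscr D_X^{2\beta}([0,T],W)$ to the rough partial differential equation $$dY_t=(AY_t+f_0(t,Y_t))\,dt+f(t,Y_t)\,d\mathbf X_t,\qquad Y_0=\xi,$$ and this solution is also a strong solution.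
   Context: Norms on Banach spaces are written $|\cdot|$; $L(V,W)$ is the Banach space of continuous linear operators $V\to W$; $X_{s,t}:=X_t-X_s$ for a path $X$. For $\gamma\in(0,1]$, $\mathcal C^\gamma([0,T],V)$ is the space of $X:[0,T]\to V$ with $\|X\|_\gamma:=\sup_{s\neq t}|X_{s,t}|/|t-s|^\gamma<\infty$. $V\otimes V$ denotes a Banach tensor product such that $L(V,L(V,W))\hookrightarrow L(V\otimes V,W)$. Rough paths: for $\beta\in(\frac13,\frac12]$, $\mathscr C^\beta([0,T],V)$ is the set of pairs $\mathbf X=(X,\mathbb X)$, $X:[0,T]\to V$, $\mathbb X:[0,T]^2\to V\otimes V$, with $\|X\|_\beta<\infty$, $\|\mathbb X\|_{2\beta}:=\sup_{s\ne t}|\mathbb X_{s,t}|/|t-s|^{2\beta}<\infty$ and Chen's relation $\mathbb X_{s,t}-\mathbb X_{s,u}-\mathbb X_{u,t}=X_{s,u}\otimes X_{u,t}$ for all $s,u,t\in[0,T]$. Controlled rough paths: $(Y,Y')\in\mathscr D_X^{2\beta}([0,T],W)$ means $Y\in\mathcal C^\beta([0,T],W)$, $Y'\in\mathcal C^\beta([0,T],L(V,W))$ and $\sup_{s\ne t}|R^Y_{s,t}|/|t-s|^{2\beta}<\infty$, where $R^Y_{s,t}:=Y_{s,t}-Y'_sX_{s,t}$. Rough (Gubinelli) integral: for $(Z,Z')\in\mathscr D_X^{2\beta}([0,t],L(V,W))$, $\int_0^tZ_s\,d\mathbf X_s:=\lim_{|\Pi|\to0}\sum_{[u,v]\in\Pi}(Z_uX_{u,v}+Z'_u\mathbb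 X_{u,v})$, the limit over partitions $\Pi$ of $[0,t]$. Domains: $D(A^n):=\{y\in D(A^{n-1}):A^{n-1}y\in D(A)\}$ carries the graph norm $|y|_{D(A^n)}=|y|+\sum_{j=1}^n|A^jy|$ and is a Banach space. Function spaces, for Banach spaces $E,F$: $\mathrm{Lip}([0,T]\times E,F)$ is the set of continuous $f_0:[0,T]\times E\to F$ for which there is $L>0$ with $|f_0(t,y)-f_0(t,z)|\le L|y-z|$ for all $t,y,z$. $C_b^n(E,F)$ is the set of $n$-times continuously Fréchet differentiable maps $g$ with $\|g\|_{C_b^n}:=\sum_{k=0}^n\|D^kg\|_\infty<\infty$. For $\gamma\in(0,1]$, $C_b^{\gamma,n}([0,T]\times E,F)$ is the set of $f:[0,T]\times E\to F$ such that $f(t,\cdot)\in C_b^n(E,F)$ for all $t$, the maps $t\mapsto D_y^kf(t,y)$, $k=0,\dots,n-1$, are $\gamma$-Hölder continuous for each $y$, and $\|f\|_{C_b^{\gamma,n}}:=\sup_t\|f(t,\cdot)\|_{C_b^n}+\sum_{k=0}^{n-1}\sup_y\|D_y^kf(\cdot,y)\|_\gamma<\infty$. For a controlled path put $f(Y)_t:=f(t,Y_t)$ and $f(Y)'_t:=D_yf(t,Y_t)Y'_t$; then $(f(Y),f(Y)')$ is again a controlled rough path, and so is $s\mapsto S_{t-s}f(s,Y_s)$ on $[0,t]$ with Gubinelli derivative $s\mapsto S_{t-s}f(Y)'_s$; rough integrals are taken with these derivatives. Mild solution (on $[0,T]$, with $Y_0=\xi$): $(Y,Y')\in\mathscr D_X^{2\beta}([0,T],W)$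 with $Y'=f(Y)$ and $$Y_t=S_t\xi+\int_0^tS_{t-s}f_0(s,Y_s)\,ds+\int_0^tS_{t-s}f(s,Y_s)\,d\mathbf X_s,\quad t\in[0,T].$$ Strong solution (on $[0,T]$, with $Y_0=\xi$): $(Y,Y')\in\mathscr D_X^{2\beta}([0,T],W)$ such that $Y$ is $D(A)$-valued, $AY:[0,T]\to W$ is bounded, $Y'=f(Y)$ and $$Y_t=\xi+\int_0^t(AY_s+f_0(s,Y_s))\,ds+\int_0^tf(s,Y_s)\,d\mathbf X_s,\quad t\in[0,T].$$ *)

(* Defs.v *)
From HB Require Import structures.
From mathcomp Require Import all_boot all_order all_algebra.
From mathcomp Require Import all_classical all_reals all_analysis.

Set Implicit Arguments.
Unset Strict Implicit.
Unset Printing Implicit Defensive.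

Import Order.TTheory GRing.Theory Num.Theory.
Import numFieldNormedType.Exports.

Local Open Scope classical_set_scope.
Local Open Scope ring_scope.

(* The normed space L(V, W) of continuous linear operators, with the operator
   norm. *)
Section bounded_operators.
Context {R : realType} {V W : normedModType R}.

Definition lin_cont : {pred V -> W} :=
  mem [set f : V -> W | linear f /\ continuous f].

Record blin := Blin { blin_val :> V -> W ; blin_valP : blin_val \in lin_cont }.

HB.instance Definition _ := [isSub for blin_val].
HB.instance Definition _ := [Choice of blin by <:].

Lemma lin_cont_submod_closed : submod_closed lin_cont.
Proof.
split.
  rewrite inE; split; first by move=> a x y /=; rewrite scaler0 addr0.
  by move=> x; exact: cvg_cst.
move=> a f g; rewrite !inE => -[lf cf] [lg cg]; split.
  move=> b x y.
  have E z : (a *: f + g) z = a *: f z + g z by [].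
  by rewrite !E lf lg !scalerDr !scalerA mulrC addrACA.
by move=> x; apply: cvgD; [apply: cvgZ; [exact: cvg_cst|exact: (cf x)]|exact: (cg x)].
Qed.

HB.instance Definition _ :=
  GRing.isSubmodClosed.Build _ _ lin_cont lin_cont_submod_closed.
HB.instance Definition _ := [SubChoice_isSubLmodule of blin by <:].

Lemma blin_linear (f : blin) : linear f.
Proof. by have := blin_valP f; rewrite inE => -[]. Qed.

Lemma blin_continuous (f : blin) : continuous f.
Proof. by have := blin_valP f; rewrite inE => -[]. Qed.

HB.instance Definition _ (f : blin) :=
  GRing.isLinear.Build _ _ _ _ (blin_val f) (blin_linear f).

Lemma blinD (f g : blin) x : (f + g) x = f x + g x.
Proof. by []. Qed.

Lemma blinZ a (f : blin) x : (a *: f) x = a *: f x.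
Proof. by []. Qed.

Lemma blin_eqP (f g : blin) : f =1 g -> f = g.
Proof. by move=> fg; apply/val_inj/funext. Qed.

Definition opnorm (f : blin) : R := sup [set `|f x| | x in [set x | `|x| <= 1]].

Lemma opnorm_has_sup (f : blin) : has_sup [set `|f x| | x in [set x | `|x| <= 1]].
Proof.
split; first by exists `|f 0|, 0 => //=; rewrite normr0.
have /linear_bounded_continuous/linear_boundedP := @blin_continuous f.
move=> /pinfty_ex_gt0[r r0 fr]; exists r => _ [x /= x1 <-].
by rewrite (le_trans (fr x))// ler_piMr// ltW.
Qed.

Lemma opnorm_ub (f : blin) x : `|f x| <= opnorm f * `|x|.
Proof.
have [->|x0] := eqVneq x 0; first by rewrite linear0 !normr0 mulr0.
have nx : 0 < `|x| by rewrite normr_gt0.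
rewrite -ler_pdivrMr//.
apply: ub_le_sup; first exact: (opnorm_has_sup f).2.
exists (`|x|^-1 *: x) => /=.
  by rewrite normrZ normfV normr_id mulVf// gt_eqF.
by rewrite linearZ/= normrZ normfV normr_id mulrC.
Qed.

Lemma opnorm_lub (f : blin) (c : R) :
  0 <= c -> (forall x, `|f x| <= c * `|x|) -> opnorm f <= c.
Proof.
move=> c0 fc; apply: ge_sup; first exact: (opnorm_has_sup f).1.
move=> _ [x /= x1 <-]; rewrite (le_trans (fc x))//.
by rewrite ler_piMr.
Qed.

Lemma opnorm_ge0 (f : blin) : 0 <= opnorm f.
Proof.
apply: (@le_trans _ _ `|f 0|) => //.
apply: ub_le_sup; first exact: (opnorm_has_sup f).2.
by exists 0 => //=; rewrite normr0.
Qed.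

Lemma ler_opnormD (f g : blin) : opnorm (f + g) <= opnorm f + opnorm g.
Proof.
apply: opnorm_lub => [|x]; first by rewrite addr_ge0// opnorm_ge0.
by rewrite blinD (le_trans (ler_normD _ _))// mulrDl lerD// opnorm_ub.
Qed.

Let opnormZ_le a (f : blin) : opnorm (a *: f) <= `|a| * opnorm f.
Proof.
apply: opnorm_lub => [|x]; first by rewrite mulr_ge0// opnorm_ge0.
by rewrite blinZ normrZ -mulrA ler_wpM2l// opnorm_ub.
Qed.

Lemma opnormZ a (f : blin) : opnorm (a *: f) = `|a| * opnorm f.
Proof.
apply/eqP; rewrite eq_le opnormZ_le/=.
have [->|a0] := eqVneq a 0; first by rewrite normr0 mul0r opnorm_ge0.
have := opnormZ_le a^-1 (a *: f).
by rewrite scalerA mulVf// scale1r normfV ler_pdivlMl// normr_gt0.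
Qed.

Lemma opnorm_eq0 (f : blin) : opnorm f = 0 -> f = 0.
Proof.
move=> f0; apply: blin_eqP => x; apply/eqP.
by rewrite -normr_le0 (le_trans (opnorm_ub f x))// f0 mul0r.
Qed.

HB.instance Definition _ :=
  Lmodule_isNormed.Build R blin ler_opnormD opnormZ opnorm_eq0.

End bounded_operators.
Arguments blin {R} V W.
Arguments lin_cont {R} V W.

Section composition.
Context {R : realType}.

Lemma blin_comp_subproof (U V W : normedModType R) (g : blin V W) (f : blin U V) :
  (fun x => g (f x)) \in lin_cont U W.
Proof.
rewrite inE; split; first by move=> a x y /=; rewrite !linearP.
move=> x; apply: (@continuous_comp _ _ _ f g); exact: blin_continuous.
Qed.

Definition blin_comp (U V W : normedModType R) (g : blin V W) (f : blin U V) :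
  blin U W := Blin (blin_comp_subproof g f).

Lemma postcomp_subproof (U V W : normedModType R) (g : blin V W) :
  (fun f : blin U V => blin_comp g f) \in lin_cont (blin U V) (blin U W).
Proof.
have lg : linear (fun f : blin U V => blin_comp g f).
  by move=> a f h; apply: blin_eqP => x /=; rewrite linearP.
rewrite inE; split => //.
pose G : {linear blin U V -> blin U W} := HB.pack (fun f : blin U V => blin_comp g f)
  (GRing.isLinear.Build _ _ _ _ _ lg).
apply: (@bounded_linear_continuous _ _ _ G); apply/linear_boundedP.
near=> r => f; apply: opnorm_lub => [|x].
  by rewrite mulr_ge0.
apply: (@le_trans _ _ (opnorm g * `|f x|)); first exact: (opnorm_ub g (f x)).
by rewrite -mulrA ler_pM ?opnorm_ge0//; exact: opnorm_ub.
Unshelve. all: by end_near. Qed.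

(* f |-> g o f as an operator L(U, V) -> L(U, W) *)
Definition postcomp (U V W : normedModType R) (g : blin V W) :
  blin (blin U V) (blin U W) := Blin (@postcomp_subproof U V W g).

End composition.

Section frechet.
Context {R : realType}.

(* Frechet derivative as an element of L(E, F); it is meaningful only at points
   where f is differentiable, see FderivE. *)
Definition Fderiv (E F : normedModType R) (f : E -> F) (x : E) : blin E F :=
  insubd (0 : blin E F) ('d f x : E -> F).

Lemma FderivE (E F : normedModType R) (f : E -> F) (x : E) :
  differentiable f x -> Fderiv f x = 'd f x :> (E -> F).
Proof.
move=> df; have H : ('d f x : E -> F) \in lin_cont E F.
  rewrite inE; split; last exact: diff_continuous.
  by move=> a y z; rewrite linearP.
exact: (insubdK (0 : blin E F) H).
Qed.

(* k-linear maps in curried form, L(E, L(E, ... L(E, F))) *)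
Fixpoint mlin (E F : normedModType R) (k : nat) : normedModType R :=
  if k is k'.+1 then blin E (mlin E F k') else F.

Fixpoint Dn (E F : normedModType R) (g : E -> F) (k : nat) : E -> mlin E F k :=
  match k with
  | 0 => g
  | k'.+1 => Fderiv (Dn g k')
  end.

End frechet.

Section function_spaces.
Context {R : realType}.

(* Functions on [0, T] are total functions on R; every condition below is
   restricted to times in [0, T]. *)

Definition holder2 (E : normedModType R) (T gamma : R) (Xi : R -> R -> E) :=
  exists C : R, forall s t : R, 0 <= s <= T -> 0 <= t <= T -> s != t ->
    `|Xi s t| <= C * `|t - s| `^ gamma.

Definition holder (E : normedModType R) (T gamma : R) (X : R -> E) :=
  holder2 T gamma (fun s t => X t - X s).

Definition Lip (E F : normedModType R) (T : R) (f0 : R -> E -> F) :=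
  {within [set p : R * E | 0 <= p.1 <= T], continuous (fun p => f0 p.1 p.2)} /\
  exists2 L : R, 0 < L & forall (t : R) y z, 0 <= t <= T ->
    `|f0 t y - f0 t z| <= L * `|y - z|.

Definition Cb (E F : normedModType R) (n : nat) (g : E -> F) :=
  [/\ forall k x, (k < n)%N -> differentiable (Dn g k) x,
      forall k, (k <= n)%N -> continuous (Dn g k) &
      forall k, (k <= n)%N -> exists C : R, forall x, `|Dn g k x| <= C].

Definition Cb_holder (E F : normedModType R) (T gamma : R) (n : nat)
    (f : R -> E -> F) :=
  [/\ forall t : R, 0 <= t <= T -> Cb n (f t),
      exists C : R, forall k (t : R) y, (k <= n)%N -> 0 <= t <= T ->
        `|Dn (f t) k y| <= C &
      exists C : R, forall k (s t : R) y, (k < n)%N ->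
        0 <= s <= T -> 0 <= t <= T -> s != t ->
        `|Dn (f t) k y - Dn (f s) k y| <= C * `|t - s| `^ gamma].

End function_spaces.

Section semigroup.
Context {R : realType} {W : normedModType R}.

Definition C0_semigroup (S : R -> blin W W) :=
  [/\ forall x, S 0 x = x,
      forall (s t : R) x, 0 <= s -> 0 <= t -> S (s + t) x = S s (S t x) &
      forall x, S t x @[t --> 0^'+] --> x].

Variable S : R -> blin W W.

Definition gendom : set W := [set y | cvg (h^-1 *: (S h y - y) @[h --> 0^'+])].

Definition generator (y : W) : W := lim (h^-1 *: (S h y - y) @[h --> 0^'+]).

Fixpoint domn (n : nat) : set W :=
  if n is n'.+1 then domn n' `&` [set y | gendom (iter n' generator y)]
  else setT.

Lemma gendomP a x y : gendom x -> gendom y -> gendom (a *: x + y) /\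
  generator (a *: x + y) = a *: generator x + generator y.
Proof.
move=> cx cy.
have E : (fun h => h^-1 *: (S h (a *: x + y) - (a *: x + y))) =
   (fun h => a *: (h^-1 *: (S h x - x)) + h^-1 *: (S h y - y)).
  apply/funext => h; rewrite linearP opprD addrACA -scalerBr scalerDr.
  by rewrite !scalerA mulrC.
have H : (h^-1 *: (S h (a *: x + y) - (a *: x + y)) @[h --> 0^'+])
    --> a *: generator x + generator y.
  by rewrite E; apply: cvgD => //; apply: cvgZ => //; exact: cvg_cst.
split; first by apply/cvg_ex; eexists; exact: H.
by apply/cvg_lim => //; exact: norm_hausdorff.
Qed.

Lemma domnP n a x y : domn n x -> domn n y -> domn n (a *: x + y) /\
  forall j, (j <= n)%N -> iter j generator (a *: x + y) =
    a *: iter j generator x + iter j generator y.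
Proof.
elim: n => [_ _|n IH [/= xn gx] [yn gy]]; first by split => // -[].
have [Dn En] := IH xn yn.
have [D1 E1] := gendomP a gx gy.
split; first by split => //=; rewrite En.
move=> j; rewrite leq_eqVlt => /predU1P[->|/En//].
by rewrite !iterS En.
Qed.

Lemma domn_submod_closed n : submod_closed (mem (domn n) : {pred W}).
Proof.
split; last first.
  by move=> a x y; rewrite !inE => xn yn; exact: (domnP a xn yn).1.
rewrite inE; elim: n => // n IH; split => //=.
have -> : iter n generator 0 = 0.
  have := (domnP (-1) IH IH).2 n (leqnn n).
  by rewrite scaler0 addr0 scaleN1r addNr.
rewrite /gendom /=.
have -> : (fun h => h^-1 *: (S h 0 - 0)) = cst 0.
  by apply/funext => h; rewrite linear0 subrr scaler0.
exact: is_cvg_cst.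
Qed.

(* D(A^n) with the graph norm *)
Record dom (n : nat) := Dom { dom_val :> W ; dom_valP : dom_val \in domn n }.

Section dom_structure.
Variable n : nat.

HB.instance Definition _ := [isSub for @dom_val n].
HB.instance Definition _ := [Choice of dom n by <:].
HB.instance Definition _ :=
  GRing.isSubmodClosed.Build _ _ _ (@domn_submod_closed n).
HB.instance Definition _ := [SubChoice_isSubLmodule of dom n by <:].


Lemma dom_val_linear (a : R) (x y : dom n) :
  dom_val (a *: x + y) = a *: dom_val x + dom_val y.
Proof. by []. Qed.

Lemma iter_generator_linear (j : nat) (a : R) (x y : dom n) : (j <= n)%N ->
  iter j generator (dom_val (a *: x + y)) =
  a *: iter j generator (dom_val x) + iter j generator (dom_val y).
Proof.
have := dom_valP x; have := dom_valP y; rewrite !inE => yn xn.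
by move=> jn; rewrite dom_val_linear (domnP a xn yn).2.
Qed.

Definition graph_norm (y : dom n) : R :=
  `|dom_val y| + \sum_(1 <= j < n.+1) `|iter j generator (dom_val y)|.

Lemma ler_graph_normD (x y : dom n) :
  graph_norm (x + y) <= graph_norm x + graph_norm y.
Proof.
rewrite /graph_norm addrACA lerD ?ler_normD// -big_split/= !big_nat.
apply: ler_sum => j /andP[_ jn]; rewrite -[x]scale1r iter_generator_linear//.
by rewrite !scale1r ler_normD.
Qed.

Lemma graph_normZ (a : R) (x : dom n) : graph_norm (a *: x) = `|a| * graph_norm x.
Proof.
rewrite /graph_norm mulrDr -normrZ mulr_sumr; congr (_ + _).
rewrite !big_nat; apply: eq_bigr => j /andP[_ jn].
rewrite -normrZ; congr (`|_|).
have jn' : (j <= n)%N by [].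
have E0 : iter j generator (dom_val (0 : dom n)) = 0.
  have := iter_generator_linear (-1) 0 0 jn'.
  by rewrite scaler0 addr0 scaleN1r addNr.
by rewrite -[a *: x]addr0 iter_generator_linear// E0 addr0.
Qed.

Lemma graph_norm_eq0 (x : dom n) : graph_norm x = 0 -> x = 0.
Proof.
move=> /eqP; rewrite paddr_eq0 ?sumr_ge0// => /andP[].
by rewrite normr_eq0 => /eqP x0 _; exact: val_inj.
Qed.

HB.instance Definition _ :=
  Lmodule_isNormed.Build R (dom n) ler_graph_normD graph_normZ graph_norm_eq0.

Lemma dom_incl_subproof : (fun y : dom n => dom_val y) \in lin_cont (dom n) W.
Proof.
have ld : linear (fun y : dom n => dom_val y) by [].
rewrite inE; split => //.
pose G : {linear dom n -> W} := HB.pack (fun y : dom n => dom_val y)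
  (GRing.isLinear.Build _ _ _ _ _ ld).
apply: (@bounded_linear_continuous _ _ _ G); apply/linear_boundedP.
near=> r => y; apply: (@le_trans _ _ (1 * `|y|)).
  by rewrite mul1r lerDl sumr_ge0.
by rewrite ler_wpM2r.
Unshelve. all: by end_near. Qed.

Definition dom_incl : blin (dom n) W := Blin dom_incl_subproof.

End dom_structure.

End semigroup.
Arguments dom {R W} S n.

(* A Banach tensor product of V with itself such that L(V, L(V, F)) embeds
   continuously into L(V (x) V, F) for every Banach space F. The embedding tlift
   is determined by its values on elementary tensors because their span is
   dense. *)
Record tensor (R : realType) (V : normedModType R) := Tensor {
  tensor_space :> completeNormedModType R ;
  tmul : V -> V -> tensor_space ;
  tmul_linearl : forall y, linear (fun x => tmul x y) ;
  tmul_linearr : forall x, linear (tmul x) ;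
  tmul_norm : forall x y, `|tmul x y| <= `|x| * `|y| ;
  tmul_dense : forall (z : tensor_space) (eps : R), 0 < eps ->
    exists s : seq (V * V), `|z - \sum_(p <- s) tmul p.1 p.2| < eps ;
  tlift : forall F : completeNormedModType R,
    blin V (blin V F) -> blin tensor_space F ;
  tlift_tmul : forall (F : completeNormedModType R) (B : blin V (blin V F)) x y,
    tlift B (tmul x y) = B x y ;
  tlift_bounded : forall F : completeNormedModType R, exists C : R,
    forall B : blin V (blin V F), `|tlift B| <= C * `|B|
}.
Arguments tmul {R V} t x y.
Arguments tlift {R V} t {F} B.

Section bochner.
Context {R : realType} {W : normedModType R}.
Notation mu := (@lebesgue_measure R).

(* finite sums of 1_(cell i) * coef i with measurable cells contained in D *)
Record simple_fun (D : set R) := SimpleFun {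
  simple_size : nat ;
  cell : 'I_simple_size -> set R ;
  coef : 'I_simple_size -> W ;
  cell_measurable : forall i, measurable (cell i) ;
  cell_sub : forall i, cell i `<=` D
}.
Arguments cell {D} s i.
Arguments coef {D} s i.

Definition simple_val (D : set R) (s : simple_fun D) (t : R) : W :=
  \sum_i \1_(cell s i) t *: coef s i.

Definition simple_integral (D : set R) (s : simple_fun D) : W :=
  \sum_i fine (mu (cell s i)) *: coef s i.

(* f is Bochner integrable on [a, b] with integral I *)
Definition is_bochner (a b : R) (f : R -> W) (I : W) :=
  exists s : nat -> simple_fun `[a, b],
  [/\ {ae mu, forall t : R, a <= t <= b -> simple_val (s n) t @[n --> \oo] --> f t},
      (\int[mu]_(t in `[a, b]) `|f t - simple_val (s n) t|%:E)%E @[n --> \oo]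
        --> 0%E &
      simple_integral (s n) @[n --> \oo] --> I].

End bochner.

Section rough.
Context {R : realType} {V : completeNormedModType R} (VV : tensor V).

Definition rough_path (T beta : R) (X : R -> V) (XX : R -> R -> VV) :=
  [/\ holder T beta X,
      holder2 T (2 * beta) XX &
      forall s u t : R, 0 <= s <= T -> 0 <= u <= T -> 0 <= t <= T ->
        XX s t - XX s u - XX u t = tmul VV (X u - X s) (X t - X u)].

Variable W : completeNormedModType R.

Definition controlled (T beta : R) (X : R -> V)
    (Y : R -> W) (Y' : R -> blin V W) :=
  [/\ holder T beta Y,
      holder T beta Y' &
      holder2 T (2 * beta) (fun s t => (Y t - Y s) - Y' s (X t - X s))].

Definition compensated_sum (X : R -> V) (XX : R -> R -> VV) (Z : R -> blin V W)
    (Z' : R -> blin V (blin V W)) (s : seq R) : W :=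
  \sum_(i < size s) let u := (0 :: s)`_i in let v := s`_i in
    (Z u (X v - X u) + tlift VV (Z' u) (XX u v)).

(* J is the limit of the compensated Riemann sums over the partitions 0 :: s of
   [0, t], as the mesh tends to 0 *)
Definition is_rough_integral (t : R) (X : R -> V) (XX : R -> R -> VV)
    (Z : R -> blin V W) (Z' : R -> blin V (blin V W)) (J : W) :=
  forall eps : R, 0 < eps -> exists2 delta : R, 0 < delta &
    forall s : seq R, itv_partition 0 t s ->
      (forall i, (i < size s)%N -> s`_i - (0 :: s)`_i < delta) ->
      `|compensated_sum X XX Z Z' s - J| < eps.

(* Gubinelli derivative of t |-> f(t, Y_t) *)
Definition comp_deriv (f : R -> W -> blin V W) (Y : R -> W) (Y' : R -> blin V W)
    (t : R) : blin V (blin V W) :=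
  blin_comp (Fderiv (f t) (Y t)) (Y' t).

Variable S : R -> blin W W.

Definition mild_solution (T beta : R) (X : R -> V) (XX : R -> R -> VV)
    (f0 : R -> W -> W) (f : R -> W -> blin V W) (xi : W)
    (Y : R -> W) (Y' : R -> blin V W) :=
  [/\ controlled T beta X Y Y',
      forall t : R, 0 <= t <= T -> Y' t = f t (Y t) &
      forall t : R, 0 <= t <= T -> exists I J : W,
        [/\ is_bochner 0 t (fun s => S (t - s) (f0 s (Y s))) I,
            is_rough_integral t X XX
              (fun s => blin_comp (S (t - s)) (f s (Y s)))
              (fun s => blin_comp (postcomp V (S (t - s))) (comp_deriv f Y Y' s))
              J &
            Y t = S t xi + I + J]].

Definition strong_solution (T beta : R) (X : R -> V) (XX : R -> R -> VV)
    (f0 : R -> W -> W) (f : R -> W -> blin V W) (xi : W)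
    (Y : R -> W) (Y' : R -> blin V W) :=
  [/\ controlled T beta X Y Y',
      forall t : R, 0 <= t <= T -> gendom S (Y t),
      exists C : R, forall t : R, 0 <= t <= T -> `|generator S (Y t)| <= C,
      forall t : R, 0 <= t <= T -> Y' t = f t (Y t) &
      forall t : R, 0 <= t <= T -> exists I J : W,
        [/\ is_bochner 0 t (fun s => generator S (Y s) + f0 s (Y s)) I,
            is_rough_integral t X XX (fun s => f s (Y s)) (comp_deriv f Y Y') J &
            Y t = xi + I + J]].

End rough.

(* Main.v *)
(* The solution is built as [Y = U + Z], where [Z_t] is the rough integral of
   [f(s, Y_s)] over [0, t], which lives in D(A^2), and
   [U_t = S_t xi + \int_0^t S_(t-s) (f0(s, Y_s) + A Z_s) ds] lives in D(A). This
   agrees with the mild formulation by integration by parts: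
   [\int_0^t S_(t-s) f(s, Y_s) dX_s = Z_t + \int_0^t S_(t-s) A Z_s ds]. Hence the
   semigroup only acts on a Riemann integral in D(A), whose increments in W are
   Lipschitz in time, and the rough integral requires the sewing lemma for the
   usual germ only. The map [(Y, Y') |-> (U + Z, f(., Y))] has a unique fixed point
   on the whole of [0, T]: Hoelder seminorms are taken over windows of length
   [tau] and weighted by [exp(t / tau)]; as [f] is bounded, a first estimate is
   linear in the norm of the path and yields an invariant set, on which the map is
   a contraction for small [tau]. Differentiating [U] gives the strong equation. *)

Require Import Defs.
From HB Require Import structures.
From mathcomp Require Import all_boot all_order all_algebra.
From mathcomp Require Import all_classical all_reals all_analysis.
From mathcomp Require Import measurable_realfun.
From mathcomp Require Import ring lra.

Set Implicit Arguments.
Unset Strict Implicit.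
Unset Printing Implicit Defensive.

Import Order.TTheory GRing.Theory Num.Theory.
Import numFieldNormedType.Exports.
Local Open Scope classical_set_scope.
Local Open Scope ring_scope.

(** A germ containing [S_(t-s)] changes with the end time [t], so its integrals are not the
    increments of one path; this is what moving the semigroup into a Riemann integral avoids. The
    price is one application of [A] to the rough integral, hence values in D(A^2): [A Z] then lies
    in D(A), where [|S_h y - y| <= M h |A y|], and such a Lipschitz bound suffices for remainders
    because [2 beta <= 1]. As [f] maps all of [W] into D(A^2), the path itself is measured in [W]
    only and the iteration loses no regularity. Over a window the weight grows by the factor [e] at
    most, and it at least doubles, so window bounds add up like a geometric series whatever their
    number, and no local solutions have to be glued. The estimate for the difference of two images
    has a constant depending on the size of both paths. The invariant set therefore comes before the
    contraction, and the window is shrunk a second time once its bounds are known. Uniqueness among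
    all mild solutions also needs the converse, that every mild solution is a fixed point; this
    rests on uniqueness of Bochner and rough integrals. *)

Section zmodule_normalization.

Inductive zexpr := ZVar of nat | ZZero | ZAdd of zexpr & zexpr | ZOpp of zexpr.

Fixpoint zeval (E : zmodType) (env : seq E) (e : zexpr) : E :=
  match e with
  | ZVar i => env`_i
  | ZZero => 0
  | ZAdd e1 e2 => zeval env e1 + zeval env e2
  | ZOpp e1 => - zeval env e1
  end.

Fixpoint zcoef (e : zexpr) (i : nat) : int :=
  match e with
  | ZVar j => (i == j)%:Z
  | ZZero => 0
  | ZAdd e1 e2 => zcoef e1 i + zcoef e2 i
  | ZOpp e1 => - zcoef e1 i
  end.

Lemma zevalE (E : zmodType) (env : seq E) e :
  zeval env e = \sum_(i < size env) env`_i *~ zcoef e i.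
Proof.
elim: e => [j||e1 IH1 e2 IH2|e IH] /=.
- have [js|js] := ltnP j (size env).
    rewrite (bigD1 (Ordinal js))//= eqxx mulr1z big1 ?addr0// => i ij.
    by rewrite (_ : (_ == _) = false) ?mulr0z//; apply/negbTE.
  rewrite nth_default// big1// => i _; rewrite (_ : (_ == _) = false) ?mulr0z//.
  by apply/negbTE; rewrite neq_ltn (leq_trans (ltn_ord i) js).
- by rewrite big1// => i _; rewrite mulr0z.
- by rewrite IH1 IH2 -big_split; apply: eq_bigr => i _; rewrite mulrzDr.
- by rewrite IH -sumrN; apply: eq_bigr => i _; rewrite mulrNz.
Qed.

(** Reflection: by [zevalE] both sides are integer combinations of the atoms, so that for reified
    expressions the hypothesis is a closed boolean computing to [true]. *)
Lemma zeval_eq (E : zmodType) (env : seq E) e1 e2 :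
  all (fun i => zcoef e1 i == zcoef e2 i) (iota 0 (size env)) ->
  zeval env e1 = zeval env e2.
Proof.
move=> /allP H; rewrite !zevalE; apply: eq_bigr => i _.
suff /eqP -> : zcoef e1 i == zcoef e2 i by [].
by apply: (H (i : nat)); rewrite mem_iota add0n leq0n ltn_ord.
Qed.

End zmodule_normalization.

(* Atoms are compared up to conversion: the same term may occur with several
   paths through the hierarchy of structures. *)
Ltac zsame x y :=
  match goal with
  | _ => let _ := constr:(erefl x : x = y) in constr:(true)
  | _ => constr:(false)
  end.
Ltac zmem x l :=
  lazymatch l with
  | nil => constr:(false)
  | ?y :: ?l' => lazymatch zsame x y with true => constr:(true) | _ => zmem x l' end
  end.
Ltac zatoms t l :=
  lazymatch t with
  | ?a + ?b => let l1 := zatoms a l in zatoms b l1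
  | - ?a => zatoms a l
  | 0 => l
  | _ => lazymatch zmem t l with true => l | false => constr:(t :: l) end
  end.
Ltac zindex x l :=
  lazymatch l with
  | ?y :: ?l' => lazymatch zsame x y with
    | true => constr:(0%N)
    | _ => let n := zindex x l' in constr:(S n)
    end
  end.
Ltac zreify t l :=
  lazymatch t with
  | ?a + ?b => let e1 := zreify a l in let e2 := zreify b l in constr:(ZAdd e1 e2)
  | - ?a => let e1 := zreify a l in constr:(ZOpp e1)
  | 0 => constr:(ZZero)
  | _ => let n := zindex t l in constr:(ZVar n)
  end.
(* Decides equalities that hold in every abelian group, for which [ring] does
   not apply. *)
Ltac zmodule :=
  lazymatch goal with
  | |- @eq ?E ?a ?b =>
    let l0 := zatoms a (@nil E) in
    let l := zatoms b l0 in
    let e1 := zreify a l in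
    let e2 := zreify b l in
    exact: (@zeval_eq _ l e1 e2 isT)
  end.

(** * Sewing *)

Section partitions.
Context {R : realType}.
Implicit Types (a b d : R) (p q : seq R).

(** A partition of [[a, b]] with mesh below [d] is encoded as [path (gap d) a p] with
    [last a p = b]; the initial point [a] is not stored in [p]. *)
Definition gap d : rel R := fun x y => (x < y) && (y - x < d).

Lemma gap_path_lt d a p : path (gap d) a p -> path <%R a p.
Proof. by apply: sub_path => x y /andP[]. Qed.

Lemma path_lt_le_last a p : path <%R a p -> a <= last a p.
Proof.
elim: p a => //= x p IH a /andP[ax /IH]; exact/le_trans/ltW.
Qed.

Lemma lt_path_gap d a p : path <%R a p -> last a p - a < d -> path (gap d) a p.
Proof.
elim: p a => //= x p IH a /andP[ax pP] ld.
have := path_lt_le_last pP => xl.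
by rewrite /gap ax IH//= ?andbT; lra.
Qed.

Lemma path_lt_mem a p x : path <%R a p -> x \in p -> a < x <= last a p.
Proof.
move=> + xp; case/splitPr: xp => p1 p2; rewrite cat_path last_cat /= => /and3P[p1P xP p2P].
by rewrite (le_lt_trans (path_lt_le_last p1P) xP) path_lt_le_last.
Qed.

Lemma path_lt_last_nil a p : path <%R a p -> last a p = a -> p = [::].
Proof.
case: p => //= x p /andP[ax /path_lt_le_last xl] E.
by have := lt_le_trans ax xl; rewrite E ltxx.
Qed.

Lemma gap_partition d a b : 0 < d -> a <= b ->
  exists2 p, path (gap d) a p & last a p = b.
Proof.
move=> d0 ab.
(* Steps of length [d / 2] keep the gaps strictly below [d]; the induction is on the number of steps
   that suffices. *)
suff H n : forall a, a <= b -> b - a <= n%:R * (d / 2) ->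
    exists2 p, path (gap d) a p & last a p = b.
  apply: (H (Num.Def.truncn ((b - a) / (d / 2))).+1 a ab).
  by rewrite -ler_pdivrMr ?divr_gt0//; apply/ltW/truncnS_gt.
elim: n => [|n IH] {ab}a ab; rewrite ?mul0r -1?natr1 => ban.
  by exists [::] => //=; apply/eqP; rewrite eq_le ab; lra.
have [le|lt] := leP b (a + d / 2).
  have [->|nab] := eqVneq a b; first by exists [::].
  exists [:: b] => //=; rewrite /gap lt_neqAle nab ab /= andbT; lra.
have [||p pP pl] := IH (a + d / 2); [exact: ltW | lra |].
exists (a + d / 2 :: p) => //=; rewrite pP andbT /gap; apply/andP; split; lra.
Qed.

Lemma common_refinement a p q : path <%R a p -> path <%R a q ->
  last a p = last a q ->
  exists r, [/\ path <%R a r, last a r = last a p, {subset p <= r} &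
    {subset q <= r}].
Proof.
move=> pP qP pq.
pose r := sort <=%R (undup (p ++ q)).
have rE x : (x \in r) = (x \in p) || (x \in q).
  by rewrite mem_sort mem_undup mem_cat.
have ra x : x \in r -> a < x <= last a p.
  by rewrite rE => /orP[/(path_lt_mem pP)|]//; rewrite pq; exact: path_lt_mem.
have rs : sorted <%R r.
  by rewrite lt_sorted_uniq_le sort_uniq undup_uniq sort_le_sorted.
have rP : path <%R a r.
  rewrite path_min_sorted//; apply/allP => x /ra; by case/andP.
exists r; split => //; [|by move=> x xp; rewrite rE xp|
  by move=> x xq; rewrite rE xq orbT].
apply/eqP; rewrite eq_le; apply/andP; split.
  have := mem_last a r; rewrite inE => /predU1P[->|/ra/andP[]//].
  exact: path_lt_le_last.
have [/eqP p0|p0] := boolP (p == [::]).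
  by rewrite {1}p0 /= path_lt_le_last.
have lp : last a p \in p by case: (p) p0 => //= x p' _; exact: mem_last.
have : last a p \in r by rewrite rE lp.
by move=> /(path_lt_mem rP)/andP[].
Qed.

End partitions.

(** * Sums of a germ along a partition *)

Section germ_sums.
Context {R : realType}.

Fixpoint psum (E : zmodType) (Xi : R -> R -> E) (a : R) (p : seq R) : E :=
  if p is x :: p' then Xi a x + psum Xi x p' else 0.

Lemma psum_cat (E : zmodType) (Xi : R -> R -> E) a p q :
  psum Xi a (p ++ q) = psum Xi a p + psum Xi (last a p) q.
Proof. by elim: p a => [|x p IH] a /=; rewrite ?add0r// IH addrA. Qed.

Lemma psum_morph (E F : zmodType) (L : {additive E -> F}) Xi a p :
  L (psum Xi a p) = psum (fun u v => L (Xi u v)) a p.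
Proof. by elim: p a => [|x p IH] a /=; rewrite ?raddf0// raddfD /= IH. Qed.

Lemma psumB (E : zmodType) (Xi Th : R -> R -> E) a p :
  psum (fun u v => Xi u v - Th u v) a p = psum Xi a p - psum Th a p.
Proof.
by elim: p a => [|x p IH] a /=; rewrite ?subr0// IH opprD addrACA.
Qed.

Lemma psumD (E : zmodType) (Xi Th : R -> R -> E) a p :
  psum (fun u v => Xi u v + Th u v) a p = psum Xi a p + psum Th a p.
Proof.
by elim: p a => [|x p IH] a /=; rewrite ?addr0// IH addrACA.
Qed.

Lemma psum_tele (E : zmodType) (phi : R -> E) a p :
  psum (fun u v => phi v - phi u) a p = phi (last a p) - phi a.
Proof.
elim: p a => [|x p IH] a /=; rewrite ?subrr// IH.
by zmodule.
Qed.

(** The increments of the majorant [Phi] telescope. A linear [Phi] gives bounds by the length; a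
    multiple of the weight gives the weighted bounds on convolutions. *)
Lemma psum_bound (E : normedZmodType R) (Xi : R -> R -> E) (Phi : R -> R) d a p :
  path (gap d) a p ->
  (forall u v, a <= u -> u <= v -> v <= last a p -> v - u < d ->
     `|Xi u v| <= Phi v - Phi u) ->
  `|psum Xi a p| <= Phi (last a p) - Phi a.
Proof.
elim: p a => [|x p IH] a /=; first by rewrite normr0 subrr.
move=> /andP[/andP[ax xad] pP] H.
have xl := path_lt_le_last (gap_path_lt pP).
rewrite (le_trans (ler_normD _ _))//.
have -> : Phi (last x p) - Phi a = (Phi x - Phi a) + (Phi (last x p) - Phi x).
  by rewrite [RHS]addrC addrA subrK.
apply: lerD; first by apply: H => //; exact: ltW.
by apply: IH => // u v xu uv vl; apply: H => //; rewrite (le_trans (ltW ax)).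
Qed.

Lemma eq_psum (E : zmodType) (Xi Th : R -> R -> E) a p :
  path <%R a p ->
  (forall u v, a <= u -> u <= v -> v <= last a p -> Xi u v = Th u v) ->
  psum Xi a p = psum Th a p.
Proof.
elim: p a => [//|x p IH] a /= /andP[ax pP] H.
have xl := path_lt_le_last pP.
rewrite (H _ _ (lexx a) (ltW ax) xl); congr (_ + _).
by apply: IH => // u v xu uv vl; apply: H => //; rewrite (le_trans (ltW ax)).
Qed.

Lemma split_at (a m : R) p : path <%R a p -> a <= m < last a p ->
  exists p1 x p2, p = p1 ++ x :: p2 /\ last a p1 <= m < x.
Proof.
elim: p a => [|y p IH] a /=; first by move=> _ /andP[]; lra.
move=> /andP[ay yp] /andP[am ml].
have [my|ym] := ltP m y; first by exists [::], y, p; rewrite /= am.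
have [||p1 [x [p2 [-> H]]]] := IH y => //; first by rewrite ym.
by exists (y :: p1), x, p2.
Qed.

(* The sum is split at the largest partition point below the midpoint, so that
   the two remaining sums run over intervals of at most half the length. *)
Lemma sewing_bound (E : normedZmodType R) (Xi : R -> R -> E) (C th a b : R) :
  1 < th -> 0 <= C ->
  (forall u, a <= u <= b -> Xi u u = 0) ->
  (forall u v w, a <= u -> u <= v -> v <= w -> w <= b ->
     `|Xi u w - Xi u v - Xi v w| <= C * (w - u) `^ th) ->
  forall p, path <%R a p -> last a p = b ->
    `|psum Xi a p - Xi a b| <= (2 / (1 - 2 `^ (1 - th))) * C * (b - a) `^ th.
Proof.
move=> th1 C0.
have lt1 : (2 : R) `^ (1 - th) < 1.
  rewrite /powR pnatr_eq0 /= expR_lt1 nmulr_rlt0; last by lra.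
  by rewrite ln_gt0// ltr1n.
set K := 2 / _ * C.
have den0 : 0 < 1 - (2 : R) `^ (1 - th) by lra.
have K0 : 0 <= K by rewrite mulr_ge0// divr_ge0// ltW.
(* [K] solves the recursion of the bisection: the two halves together contribute [K] times a power
   of 2 below 1, and the two defects contribute [C] each. *)
have KE : K * 2 `^ (1 - th) + C * 2 = K.
  by rewrite /K; field; rewrite gt_eqF.
move=> XiO XiC p; move: {2}(size p) (leqnn (size p)) => n.
elim: n p a b XiO XiC => [|n IH] p a b XiO XiC.
  rewrite leqn0 => /nilP -> _ /= ab; rewrite -{}ab in XiO *.
  have -> : Xi a a = 0 by apply: XiO; rewrite lexx.
  by rewrite subrr normr0 mulr_ge0// powR_ge0.
move=> sp pP lb.
have ab : a <= b by rewrite -lb path_lt_le_last.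
have [/eqP eab|nab] := boolP (a == b).
  move: lb; rewrite -eab => /(path_lt_last_nil pP) -> /=.
  have -> : Xi a a = 0 by apply: XiO; rewrite lexx ab.
  by rewrite subrr normr0 mulr_ge0// powR_ge0.
have lab : a < b by rewrite lt_neqAle nab.
have [|p1 [x [p2 [pE /andP[l1m mx]]]]] := @split_at a ((a + b) / 2) p pP.
  by rewrite lb; apply/andP; split; lra.
move: sp pP lb; rewrite pE size_cat cat_path last_cat /= addnS ltnS => sp.
move=> /and3P[p1P lx xP] lb.
set m := last a p1 in l1m lx *.
have am : a <= m by exact: path_lt_le_last.
have xb : x <= b by rewrite -lb path_lt_le_last.
have mx' := ltW lx.
have mono y z : 0 <= y -> y <= z -> y `^ th <= z `^ th.
  move=> y0 yz; apply: ge0_ler_powR; rewrite ?nnegrE//; last exact: le_trans yz.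
  by rewrite ltW// (lt_trans _ th1).
have am0 : 0 <= m - a by rewrite subr_ge0.
have xb0 : 0 <= b - x by rewrite subr_ge0.
have mb0 : 0 <= b - m by lra.
have am2 : m - a <= (b - a) / 2 by lra.
have xb2 : b - x <= (b - a) / 2 by lra.
have mb2 : b - m <= b - a by lra.
have H1 : `|psum Xi a p1 - Xi a m| <= K * ((b - a) / 2) `^ th.
  apply: (le_trans (IH p1 a m _ _ _ p1P _)) => //.
  - by move=> u /andP[au um]; apply: XiO; rewrite au /=; lra.
  - by move=> u v w au uv vw wm; apply: XiC => //; lra.
  - by rewrite (leq_trans _ sp)// leq_addr.
  - by apply: ler_wpM2l => //; exact: mono.
have H2 : `|psum Xi x p2 - Xi x b| <= K * ((b - a) / 2) `^ th.
  apply: (le_trans (IH p2 x b _ _ _ xP lb)) => //.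
  - by move=> u /andP[xu ub]; apply: XiO; rewrite ub andbT; lra.
  - by move=> u v w au uv vw wm; apply: XiC => //; lra.
  - by rewrite (leq_trans _ sp)// leq_addl.
  - by apply: ler_wpM2l => //; exact: mono.
have H3 : `|Xi a b - Xi a m - Xi m b| <= C * (b - a) `^ th.
  by apply: XiC => //; lra.
have H4 : `|Xi m b - Xi m x - Xi x b| <= C * (b - a) `^ th.
  apply: (le_trans (XiC m x b _ _ _ _)) => //.
  by apply: ler_wpM2l => //; exact: mono.
rewrite psum_cat /= -/m.
have -> : psum Xi a p1 + (Xi m x + psum Xi x p2) - Xi a b =
  (psum Xi a p1 - Xi a m) + (psum Xi x p2 - Xi x b) -
  (Xi a b - Xi a m - Xi m b) - (Xi m b - Xi m x - Xi x b).
  by zmodule.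
rewrite (le_trans (ler_normB _ _))//.
have -> : K * (b - a) `^ th = K * ((b - a) / 2) `^ th + K * ((b - a) / 2) `^ th +
    C * (b - a) `^ th + C * (b - a) `^ th.
  have -> : ((b - a) / 2) `^ th = (b - a) `^ th * (2 `^ (1 - th) / 2).
    rewrite powRM ?subr_ge0 ?invr_ge0//; congr (_ * _).
    rewrite powRD ?pnatr_eq0 ?implybT// powRr1// mulrAC divff ?pnatr_eq0// mul1r.
    by rewrite -{1}powR_inv1// -powRrM mulN1r.
  by rewrite -[in LHS]KE; field.
rewrite lerD//.
rewrite (le_trans (ler_normB _ _))// lerD//.
by rewrite (le_trans (ler_normD _ _))// lerD.
Qed.

End germ_sums.

(** * Limits of germ sums *)

Section sewing.
Context {R : realType}.

Let min_leL (x y : R) : Num.min x y <= x. Proof. by rewrite ge_min lexx. Qed.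
Let min_leR (x y : R) : Num.min x y <= y.
Proof. by rewrite ge_min lexx orbT. Qed.

Lemma cauchy_eps_cvg (E : completeNormedModType R) (u : nat -> E) :
  (forall eps : R, 0 < eps -> exists N, forall m n, (N <= m)%N -> (N <= n)%N ->
     `|u m - u n| <= eps) ->
  exists l, forall eps : R, 0 < eps -> exists N, forall n, (N <= n)%N ->
     `|u n - l| <= eps.
Proof.
move=> H; have cu : cvg (u @ \oo).
  apply: cauchy_cvg; apply: cauchy_exP => e e0.
  have e20 : 0 < e / 2 by rewrite divr_gt0.
  have [N HN] := H _ e20; exists (u N); exists N => // n /= Nn.
  rewrite -ball_normE /= (le_lt_trans (HN _ _ (leqnn N) Nn))//; lra.
exists (lim (u @ \oo)) => eps eps0.
have /cvgrPdist_le /(_ _ eps0)[N _ HN] := cu.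
by exists N => n /HN; rewrite distrC.
Qed.

(** Convergence of the sums as the mesh tends to 0. Rough integrals, Riemann integrals and
    convolutions are all of this form, so additivity, linearity and uniqueness are proved once. *)
Definition sews (E : normedModType R) (Xi : R -> R -> E) (a b : R) (I : E) :=
  forall eps : R, 0 < eps -> exists2 d : R, 0 < d &
    forall p, path (gap d) a p -> last a p = b -> `|psum Xi a p - I| < eps.

(** The Cauchy criterion common to both kinds of germs: over short intervals, sums agree with the
    germ up to a small multiple of the length. It follows from a defect of order above 1, and also
    from uniform continuity for Riemann germs, whose defect has no such exponent. *)
Definition coherent (E : normedModType R) (Xi : R -> R -> E) (a b : R) :=
  forall eps : R, 0 < eps -> exists2 d : R, 0 < d &
    forall s t p, a <= s -> s <= t -> t <= b -> t - s < d ->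
      path <%R s p -> last s p = t -> `|psum Xi s p - Xi s t| <= eps * (t - s).

Lemma gap_mono (d d' : R) a p : d <= d' -> path (gap d) a p -> path (gap d') a p.
Proof.
move=> dd; apply: sub_path => x y /andP[xy xd].
by rewrite /gap xy (lt_le_trans xd).
Qed.

Lemma sews_uniq (E : normedModType R) (Xi : R -> R -> E) a b I J : a <= b ->
  sews Xi a b I -> sews Xi a b J -> I = J.
Proof.
move=> ab HI HJ; apply/eqP; rewrite -subr_eq0 -normr_le0.
apply/ler_addgt0Pl => e e0; rewrite addr0.
have e20 : 0 < e / 2 by rewrite divr_gt0.
have [d1 d10 H1] := HI _ e20; have [d2 d20 H2] := HJ _ e20.
have [|p pP pl] := @gap_partition _ (Num.min d1 d2) a b _ ab.
  by rewrite lt_min d10.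
have l1 := H1 p (gap_mono (min_leL _ _) pP) pl.
have l2 := H2 p (gap_mono (min_leR _ _) pP) pl.
have -> : I - J = (psum Xi a p - J) - (psum Xi a p - I) by zmodule.
by rewrite (le_trans (ler_normB _ _))//; lra.
Qed.

Lemma sews_close (E : normedModType R) (Xi : R -> R -> E) a b I y (c d : R) :
  a <= b -> 0 < d -> sews Xi a b I ->
  (forall p, path (gap d) a p -> last a p = b -> `|psum Xi a p - y| <= c) ->
  `|I - y| <= c.
Proof.
move=> ab d0 HI H; apply/ler_addgt0Pl => e e0.
have [d1 d10 H1] := HI _ e0.
have [|p pP pl] := @gap_partition _ (Num.min d1 d) a b _ ab.
  by rewrite lt_min d10.
have l1 := H1 p (gap_mono (min_leL _ _) pP) pl.
have l2 := H p (gap_mono (min_leR _ _) pP) pl.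
have -> : I - y = (psum Xi a p - y) - (psum Xi a p - I) by zmodule.
by rewrite (le_trans (ler_normB _ _))//; lra.
Qed.

Lemma sews_norm (E : normedModType R) (Xi : R -> R -> E) (Phi : R -> R) a b I d :
  a <= b -> 0 < d -> sews Xi a b I ->
  (forall u v, a <= u -> u <= v -> v <= b -> v - u < d ->
     `|Xi u v| <= Phi v - Phi u) ->
  `|I| <= Phi b - Phi a.
Proof.
move=> ab d0 HI H; rewrite -[I]subr0; apply: (sews_close ab d0 HI) => p pP pl.
rewrite subr0 -pl; apply: psum_bound pP _ => u v au uv vl.
by apply: H => //; rewrite -pl.
Qed.

Lemma sews_eq (E : normedModType R) (Xi Th : R -> R -> E) a b I :
  (forall u v, a <= u -> u <= v -> v <= b -> Xi u v = Th u v) ->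
  sews Xi a b I -> sews Th a b I.
Proof.
move=> H HI e e0; have [d d0 H1] := HI e e0; exists d => // p pP pl.
rewrite -(@eq_psum _ _ Xi) ?H1//; first exact: gap_path_lt pP.
by move=> u v au uv vl; apply: H => //; rewrite -pl.
Qed.

Lemma sewsB (E : normedModType R) (Xi Th : R -> R -> E) a b I J :
  sews Xi a b I -> sews Th a b J ->
  sews (fun u v => Xi u v - Th u v) a b (I - J).
Proof.
move=> HI HJ e e0; have e20 : 0 < e / 2 by rewrite divr_gt0.
have [d1 d10 H1] := HI _ e20; have [d2 d20 H2] := HJ _ e20.
exists (Num.min d1 d2); first by rewrite lt_min d10.
move=> p pP pl; rewrite psumB.
have l1 := H1 p (gap_mono (min_leL _ _) pP) pl.
have l2 := H2 p (gap_mono (min_leR _ _) pP) pl.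
have -> : psum Xi a p - psum Th a p - (I - J) =
  (psum Xi a p - I) - (psum Th a p - J) by zmodule.
by rewrite (le_lt_trans (ler_normB _ _))//; lra.
Qed.

Lemma sewsD (E : normedModType R) (Xi Th : R -> R -> E) a b I J :
  sews Xi a b I -> sews Th a b J ->
  sews (fun u v => Xi u v + Th u v) a b (I + J).
Proof.
move=> HI HJ e e0; have e20 : 0 < e / 2 by rewrite divr_gt0.
have [d1 d10 H1] := HI _ e20; have [d2 d20 H2] := HJ _ e20.
exists (Num.min d1 d2); first by rewrite lt_min d10.
move=> p pP pl; rewrite psumD.
have l1 := H1 p (gap_mono (min_leL _ _) pP) pl.
have l2 := H2 p (gap_mono (min_leR _ _) pP) pl.
have -> : psum Xi a p + psum Th a p - (I + J) =
  (psum Xi a p - I) + (psum Th a p - J) by zmodule.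
by rewrite (le_lt_trans (ler_normD _ _))//; lra.
Qed.

Lemma sews_blin (E F : normedModType R) (L : blin E F) (Xi : R -> R -> E) a b I :
  sews Xi a b I -> sews (fun u v => L (Xi u v)) a b (L I).
Proof.
move=> HI e e0; have k0 : 0 < opnorm L + 1 by have := opnorm_ge0 L; lra.
have ek : 0 < e / (opnorm L + 1) by rewrite divr_gt0.
have [d d0 H] := HI _ ek; exists d => // p pP pl.
rewrite -(psum_morph L) -linearB /= (le_lt_trans (opnorm_ub L _))//.
have := H p pP pl; rewrite ltr_pdivlMr// => /(le_lt_trans _); apply.
by rewrite mulrC ler_wpM2l//; lra.
Qed.

(** Errors that are small relative to the interval length sum to a small multiple of [b - a], so a
    path is identified as an integral by its infinitesimal increments alone. The integral equations
    below are verified in this way. *)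
Lemma sews_path (E : normedModType R) (Xi : R -> R -> E) (phi : R -> E) a b :
  (forall eps : R, 0 < eps -> exists2 d : R, 0 < d & forall u v,
     a <= u -> u <= v -> v <= b -> v - u < d ->
     `|phi v - phi u - Xi u v| <= eps * (v - u)) ->
  sews Xi a b (phi b - phi a).
Proof.
move=> H e e0.
have [ba|ab] := ltP b a.
  exists 1 => // p pP pl; have := path_lt_le_last (gap_path_lt pP).
  by rewrite pl leNgt ba.
have k0 : 0 < b - a + 1 by lra.
have ek : 0 < e / (b - a + 1) by rewrite divr_gt0.
have [d d0 Hd] := H _ ek; exists d => // p pP pl.
rewrite -pl -(psum_tele phi) -psumB.
set c := e / _ in ek Hd.
apply: (@le_lt_trans _ _ (c * last a p - c * a)).
  apply: (@psum_bound _ _ _ (fun x => c * x)) pP _ => u v au uv vl vud.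
  rewrite distrC -mulrBr; apply: Hd => //; by rewrite -pl.
by rewrite pl -mulrBr /c mulrAC ltr_pdivrMr// ltr_pM2l//; lra.
Qed.

(** Each interval of the coarse partition [p] is short, so coherence replaces its germ by the sum
    over the points of [q] inside it, at a cost proportional to its length; the costs add up to the
    total length. *)
Lemma coherent_refine (E : normedModType R) (Xi : R -> R -> E) a b (eps d : R) :
  (forall s t p, a <= s -> s <= t -> t <= b -> t - s < d ->
      path <%R s p -> last s p = t -> `|psum Xi s p - Xi s t| <= eps * (t - s)) ->
  forall p q s, a <= s -> last s p <= b -> path (gap d) s p -> path <%R s q ->
    last s p = last s q -> {subset p <= q} ->
    `|psum Xi s q - psum Xi s p| <= eps * (last s p - s).
Proof.
move=> H; elim=> [|x p IH] q s as_ lb /=.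
  move=> _ qP /esym /(path_lt_last_nil qP) -> _.
  by rewrite /= !subrr normr0 mulr0.
move=> /andP[/andP[sx xsd] pP] qP lpq sub.
have xq : x \in q by apply: sub; rewrite mem_head.
have pP' := gap_path_lt pP.
move: qP lpq sub; case/splitPr: xq => q1 q2.
rewrite cat_path last_cat /= => /and3P[q1P lx q2P] lpq sub.
have sub' : {subset p <= q2}.
  move=> y yp; have /andP[xy _] := path_lt_mem pP' yp.
  have : y \in q1 ++ x :: q2 by apply: sub; rewrite inE yp orbT.
  rewrite mem_cat inE (gt_eqF xy) /= => /orP[yq1|//].
  have /andP[_ yl] := path_lt_mem q1P yq1.
  by have := lt_le_trans (lt_trans xy (le_lt_trans yl lx)) (lexx x); rewrite ltxx.
have xb : x <= b by rewrite (le_trans (path_lt_le_last pP')).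
have l1 := IH q2 x (le_trans as_ (ltW sx)) lb pP q2P lpq sub'.
have l2 : `|psum Xi s (rcons q1 x) - Xi s x| <= eps * (x - s).
  apply: H => //; first exact: ltW.
    by rewrite rcons_path q1P.
  by rewrite last_rcons.
have -> : psum Xi s (q1 ++ x :: q2) - (Xi s x + psum Xi x p) =
   (psum Xi s (rcons q1 x) - Xi s x) + (psum Xi x q2 - psum Xi x p).
  by rewrite -cats1 !psum_cat /=; zmodule.
rewrite (le_trans (ler_normD _ _))//.
have -> : eps * (last x p - s) = eps * (x - s) + eps * (last x p - x) by ring.
exact: lerD.
Qed.

(** Two fine partitions are compared through their common refinement, so the sums are Cauchy as the
    mesh tends to 0. *)
Lemma coherent_sews (E : completeNormedModType R) (Xi : R -> R -> E) a b :
  a <= b -> coherent Xi a b -> exists I, sews Xi a b I.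
Proof.
move=> ab H.
have K (e : R) : 0 < e -> exists2 d : R, 0 < d & forall p q,
    path (gap d) a p -> path (gap d) a q -> last a p = b -> last a q = b ->
    `|psum Xi a p - psum Xi a q| <= e.
  (* The factor 2 pays for the two comparisons with the refinement; the summand 1 keeps the divisor
     positive when [a = b]. *)
  move=> e0; have k0 : 0 < 2 * (b - a + 1) by lra.
  have ek : 0 < e / (2 * (b - a + 1)) by rewrite divr_gt0.
  have [d d0 Hd] := H _ ek; exists d => // p q pP qP lp lq.
  have [|r [rP lr pr qr]] := common_refinement (gap_path_lt pP) (gap_path_lt qP).
    by rewrite lp.
  have lpb : last a p <= b by rewrite lp.
  have lqb : last a q <= b by rewrite lq.
  have l1 := coherent_refine Hd (lexx a) lpb pP rP (esym lr) pr.
  have lqr : last a q = last a r by rewrite lr lp lq.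
  have l2 := coherent_refine Hd (lexx a) lqb qP rP lqr qr.
  have -> : psum Xi a p - psum Xi a q =
    (psum Xi a r - psum Xi a q) - (psum Xi a r - psum Xi a p) by zmodule.
  rewrite (le_trans (ler_normB _ _))// (le_trans (lerD l2 l1))// lp lq.
  set c := e / _ in ek *.
  have : c * (2 * (b - a + 1)) = e by rewrite /c divfK// gt_eqF.
  by lra.
have dn n : 0 < n.+1%:R^-1 :> R by rewrite invr_gt0 ltr0n.
have /all_sig2[P PP Pl] n : {p | path (gap n.+1%:R^-1) a p & last a p = b}.
  by apply: cid2; apply: gap_partition.
have small (d : R) : 0 < d -> exists N, forall n, (N <= n)%N -> path (gap d) a (P n).
  move=> d0; exists (Num.Def.truncn d^-1) => n Nn; apply: gap_mono (PP n).
  rewrite -[d]invrK lef_pV2 ?posrE ?invr_gt0//.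
  by rewrite (le_trans (ltW (truncnS_gt _)))// ler_nat ltnS.
have [e e0|I HI] := @cauchy_eps_cvg E (fun n => psum Xi a (P n)).
  have [d d0 Hd] := K _ e0; have [N HN] := small _ d0.
  by exists N => m n Nm Nn; apply: Hd => //; exact: HN.
exists I => e e0; have e30 : 0 < e / 3 by rewrite divr_gt0.
have [d d0 Hd] := K _ e30; have [N HN] := small _ d0.
have [N' HN'] := HI _ e30.
exists d => // p pP pl; pose n := maxn N N'.
have l1 := Hd p (P n) pP (HN n (leq_maxl _ _)) pl (Pl n).
have l2 := HN' n (leq_maxr _ _).
have -> : psum Xi a p - I =
  (psum Xi a p - psum Xi a (P n)) + (psum Xi a (P n) - I) by zmodule.
rewrite (le_lt_trans (ler_normD _ _))//; lra.
Qed.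

Lemma coherentW (E : normedModType R) (Xi : R -> R -> E) a b a' b' :
  a <= a' -> b' <= b -> coherent Xi a b -> coherent Xi a' b'.
Proof.
move=> aa bb H e e0; have [d d0 Hd] := H e e0; exists d => // s t p as_ st tb.
by apply: Hd => //; [exact: le_trans as_ | exact: le_trans bb].
Qed.

Lemma sews_additive (E : normedModType R) (Xi : R -> R -> E) a b c I J K :
  a <= b -> b <= c -> sews Xi a b I -> sews Xi b c J -> sews Xi a c K ->
  K = I + J.
Proof.
move=> ab bc HI HJ HK; apply/eqP; rewrite -subr_eq0 -normr_le0.
apply/ler_addgt0Pl => e e0; rewrite addr0.
have e30 : 0 < e / 3 by rewrite divr_gt0.
have [d1 d10 H1] := HI _ e30; have [d2 d20 H2] := HJ _ e30.
have [d3 d30 H3] := HK _ e30.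
pose d := Num.min d1 (Num.min d2 d3).
have d0 : 0 < d by rewrite !lt_min d10 d20.
have dd1 : d <= d1 by rewrite ge_min lexx.
have dd2 : d <= d2 by rewrite !ge_min lexx orbT.
have dd3 : d <= d3 by rewrite !ge_min lexx !orbT.
have [p pP pl] := gap_partition d0 ab.
have [q qP ql] := gap_partition d0 bc.
have l1 := H1 p (gap_mono dd1 pP) pl.
have l2 := H2 q (gap_mono dd2 qP) ql.
have l3 : `|psum Xi a (p ++ q) - K| < e / 3.
  apply: H3; last by rewrite last_cat pl.
  by rewrite cat_path pl (gap_mono dd3 pP) (gap_mono dd3 qP).
have -> : K - (I + J) = (psum Xi a p - I) + (psum Xi b q - J)
   - (psum Xi a (p ++ q) - K) by rewrite psum_cat pl; zmodule.
rewrite (le_trans (ler_normB _ _))//.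
by have := ler_normD (psum Xi a p - I) (psum Xi b q - J); lra.
Qed.

(** [phi] is the primitive vanishing at [a], obtained by choice with value 0 outside [[a, b]];
    additivity makes its increments the integrals over all subintervals. *)
Lemma coherent_path (E : completeNormedModType R) (Xi : R -> R -> E) a b :
  a <= b -> coherent Xi a b ->
  exists2 phi : R -> E, phi a = 0 &
    forall s t, a <= s -> s <= t -> t <= b -> sews Xi s t (phi t - phi s).
Proof.
move=> ab H.
have ex s t : a <= s -> s <= t -> t <= b -> exists I, sews Xi s t I.
  by move=> as_ st tb; apply: coherent_sews => //; apply: coherentW H.
have /choice[phi Hphi] : forall t, exists I, a <= t -> t <= b -> sews Xi a t I.
  move=> t; have [/andP[at_ tb]|nt] := boolP (a <= t <= b).
    by have [I HI] := ex _ _ (lexx a) at_ tb; exists I.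
  by exists 0 => at_ tb; rewrite at_ tb in nt.
have p0 : phi a = 0.
  have HI := Hphi a (lexx a) ab.
  have : phi a = phi a + phi a by exact: (sews_additive (lexx a) (lexx a) HI HI HI).
  by move=> /(congr1 (fun x => x - phi a)); rewrite subrr addrK => /esym.
exists phi => // s t as_ st tb.
have [I HI] := ex _ _ as_ st tb.
have -> : phi t = phi s + I.
  apply: (sews_additive as_ st _ HI); apply: Hphi => //.
    exact: le_trans st tb.
  exact: le_trans as_ st.
by rewrite addrC addKr.
Qed.

(** For [th > 1] the bound of [sewing_bound] is negligible against the length. Coherence concerns
    short intervals only, so a defect bound on windows of length [tau] is enough. *)
Lemma sewing_coherent (E : normedModType R) (Xi : R -> R -> E) (C th tau a b : R) :
  1 < th -> 0 < tau -> 0 <= C ->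
  (forall u, a <= u <= b -> Xi u u = 0) ->
  (forall u v w, a <= u -> u <= v -> v <= w -> w <= b -> w - u <= tau ->
     `|Xi u w - Xi u v - Xi v w| <= C * (w - u) `^ th) ->
  coherent Xi a b.
Proof.
move=> th1 tau0 C0 XiO XiC e e0.
set K := (2 / (1 - 2 `^ (1 - th))) * C.
have K0 : 0 <= K.
  rewrite mulr_ge0// divr_ge0//.
  have : (2 : R) `^ (1 - th) <= 1.
    by rewrite -[leRHS](powRr0 2); apply: ler_powR; lra.
  by lra.
have K10 : 0 < K + 1 by lra.
have th0 : 0 < th - 1 by lra.
have ek : 0 < e / (K + 1) by rewrite divr_gt0.
have /cvgrPdist_le /(_ _ ek) [/= d d0 Hd] := @powR_cvg0 R _ th0.
exists (Num.min d tau); first by rewrite lt_min d0.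
move=> s t p as_ st tb; rewrite lt_min => /andP[tsd tst] pP pl.
apply: (@le_trans _ _ (K * (t - s) `^ th)).
  apply: sewing_bound => //.
    by move=> u /andP[su ut]; apply: XiO; lra.
  move=> u v w su uv vw wt; apply: XiC => //; lra.
have [->|nst] := eqVneq t s.
  by rewrite subrr powR0 ?mulr0//; lra.
have lst : 0 < t - s by rewrite subr_gt0 lt_neqAle eq_sym nst.
have th00 : 0 < th by lra.
rewrite -(mulr_powRB1 (ltW lst) th00) mulrCA mulrC; apply: ler_wpM2r.
  exact: ltW.
have := Hd (t - s); rewrite /= sub0r normrN gtr0_norm// => /(_ tsd lst).
rewrite sub0r normrN ger0_norm ?powR_ge0// ler_pdivlMr// => /(le_trans _); apply.
by rewrite mulrC ler_wpM2l ?powR_ge0//; lra.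
Qed.

End sewing.

(** * Riemann integrals of uniformly continuous paths *)

Section riemann.
Context {R : realType}.

Definition ucont (E : normedModType R) (a b : R) (g : R -> E) :=
  forall eps : R, 0 < eps -> exists2 d : R, 0 < d & forall s t,
    a <= s -> s <= t -> t <= b -> t - s < d -> `|g t - g s| <= eps.

Definition riem (E : normedModType R) (g : R -> E) (u v : R) : E := (v - u) *: g u.

Lemma ucontD (E : normedModType R) a b (g h : R -> E) :
  ucont a b g -> ucont a b h -> ucont a b (fun t => g t + h t).
Proof.
move=> Hg Hh e e0; have e20 : 0 < e / 2 by rewrite divr_gt0.
have [d1 d10 H1] := Hg _ e20; have [d2 d20 H2] := Hh _ e20.
exists (Num.min d1 d2); first by rewrite lt_min d10.
move=> s t as_ st tb; rewrite lt_min => /andP[t1 t2].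
rewrite opprD addrACA (le_trans (ler_normD _ _))//.
have := H1 s t as_ st tb t1; have := H2 s t as_ st tb t2; lra.
Qed.

Lemma ucontB (E : normedModType R) a b (g h : R -> E) :
  ucont a b g -> ucont a b h -> ucont a b (fun t => g t - h t).
Proof.
move=> Hg Hh; apply: ucontD => // e e0; have [d d0 Hd] := Hh e e0.
exists d => // s t as_ st tb tsd.
have -> : - h t - - h s = - (h t - h s) by zmodule.
by rewrite normrN Hd.
Qed.

Lemma ucont_blin (E F : normedModType R) (L : blin E F) a b (g : R -> E) :
  ucont a b g -> ucont a b (fun t => L (g t)).
Proof.
move=> H e e0; have k0 : 0 < opnorm L + 1 by have := opnorm_ge0 L; lra.
have ek : 0 < e / (opnorm L + 1) by rewrite divr_gt0.
have [d d0 Hd] := H _ ek; exists d => // s t as_ st tb tsd.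
rewrite -linearB /= (le_trans (opnorm_ub L _))//.
have := Hd s t as_ st tb tsd; rewrite ler_pdivlMr// => /(le_trans _); apply.
by rewrite mulrC ler_wpM2l//; lra.
Qed.

(** Both sides are sums of lengths times values of [g], and these values differ by the oscillation
    of [g] over the short interval. *)
Lemma riem_coherent (E : normedModType R) a b (g : R -> E) :
  ucont a b g -> coherent (riem g) a b.
Proof.
move=> H e e0; have [d d0 Hd] := H e e0; exists d => // s t p as_ st tb tsd pP pl.
have -> : riem g s t = psum (fun u v => (v *: g s) - (u *: g s)) s p.
  by rewrite (psum_tele (fun v => v *: g s)) pl -scalerBl.
rewrite -psumB mulrBr -pl.
have qP : path (gap d) s p by apply: lt_path_gap; rewrite ?pl.
apply: (@psum_bound _ _ _ (fun x => e * x)) qP _ => u v su uv vl _.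
rewrite /riem -scalerBl -scalerBr normrZ ger0_norm ?subr_ge0//.
rewrite -mulrBr mulrC ler_wpM2r ?subr_ge0//; apply: Hd => //.
- by rewrite (le_trans uv)// (le_trans vl)// pl.
- by move: vl; rewrite pl; lra.
Qed.

Lemma riem_sews (E : completeNormedModType R) a b (g : R -> E) :
  a <= b -> ucont a b g -> exists I, sews (riem g) a b I.
Proof. by move=> ab /riem_coherent; exact: coherent_sews. Qed.

(** A finite partition on whose intervals [g] oscillates by at most 1 gives the bound, accumulated
    along the partition points. *)
Lemma ucont_bounded (E : normedModType R) a b (g : R -> E) :
  a <= b -> ucont a b g -> exists2 M : R, 0 <= M & forall t, a <= t <= b -> `|g t| <= M.
Proof.
move=> ab H; have [d d0 Hd] := H 1 ltr01.
have [p pP pl] := gap_partition d0 ab.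
have : forall s, a <= s -> last s p = b -> path (gap d) s p ->
    exists2 M : R, 0 <= M & forall t, s <= t <= b -> `|g t| <= M.
  elim: {pP pl}p => [|x p IH] s as_ /=.
    move=> -> _; exists `|g b| => // t /andP[bt tb].
    by have -> : t = b by apply/eqP; rewrite eq_le tb.
  move=> lb /andP[/andP[sx xsd] pP].
  have [M M0 HM] := IH x (le_trans as_ (ltW sx)) lb pP.
  have xb : x <= b by rewrite -lb path_lt_le_last// (gap_path_lt pP).
  exists (M + (`|g s| + 1)); first by rewrite !addr_ge0.
  move=> t /andP[st tb].
  have [xt|tx] := leP x t.
    by rewrite (le_trans (HM t _)) ?xt// lerDl addr_ge0.
  have : `|g t - g s| <= 1 by apply: Hd => //; lra.
  have := ler_normD (g t - g s) (g s); rewrite subrK; lra.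
by apply.
Qed.

End riemann.

(** * Taylor estimates *)

Section mean_value.
Context {R : realType}.

Lemma blin_norm_ub (V W : normedModType R) (f : blin V W) x : `|f x| <= `|f| * `|x|.
Proof. exact: opnorm_ub. Qed.

Lemma blin_norm_lub (V W : normedModType R) (f : blin V W) (c : R) :
  0 <= c -> (forall x, `|f x| <= c * `|x|) -> `|f| <= c.
Proof. exact: opnorm_lub. Qed.

Lemma blin_norm_le (V W : normedModType R) (f : blin V W) x (c d : R) :
  `|f| <= c -> `|x| <= d -> `|f x| <= c * d.
Proof.
by move=> fc xd; rewrite (le_trans (blin_norm_ub f x))// ler_pM.
Qed.

Lemma blinB (V W : normedModType R) (f g : blin V W) x : (f - g) x = f x - g x.
Proof. by []. Qed.

Lemma blinBr (V W : normedModType R) (f : blin V W) x y : f (x - y) = f x - f y.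
Proof. exact: linearB. Qed.

Lemma blinDr (V W : normedModType R) (f : blin V W) x y : f (x + y) = f x + f y.
Proof. exact: linearD. Qed.

Lemma blinZr (V W : normedModType R) (f : blin V W) (a : R) x : f (a *: x) = a *: f x.
Proof. exact: linearZ. Qed.

(** Continuous induction: the supremum of the times up to which the bound holds has the property
    itself, and the local bound there pushes it further unless it is 1. The radius [d] may depend on
    [t], so no integral of a derivative is involved. *)
Lemma locally_lipschitz01 (E : normedModType R) (psi : R -> E) (c : R) :
  (forall t : R, 0 <= t <= 1 -> exists2 d : R, 0 < d & forall s,
     0 <= s <= 1 -> `|s - t| < d -> `|psi s - psi t| <= c * `|s - t|) ->
  `|psi 1 - psi 0| <= c.
Proof.
move=> H.
pose S := [set t : R | 0 <= t <= 1 /\ `|psi t - psi 0| <= c * t].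
have S0 : S 0 by split; rewrite ?lexx ?ler01// subrr normr0 mulr0.
have Sb : has_sup S.
  by split; [exists 0 | exists 1 => t [/andP[_ t1] _]].
have s0 : 0 <= sup S by apply: (ub_le_sup Sb.2).
have s1 : sup S <= 1 by apply: (ge_sup Sb.1) => t [/andP[_ t1] _].
have [|d d0 Hd] := H (sup S); first by rewrite s0.
have Ss : S (sup S).
  split; first by rewrite s0.
  have [t [/andP[t0 t1] ht] st] := sup_adherent d0 Sb.
  have ts : t <= sup S by apply: (ub_le_sup Sb.2); split => //; rewrite t0.
  have := Hd t; rewrite t0 t1 distrC (distrC (psi t)) ger0_norm ?subr_ge0//.
  have tsd : sup S - t < d by lra.
  move=> /(_ isT tsd) h.
  have -> : psi (sup S) - psi 0 = (psi (sup S) - psi t) + (psi t - psi 0).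
    by zmodule.
  by rewrite (le_trans (ler_normD _ _))//; lra.
have [s_lt1|s_ge1] := ltP (sup S) 1; last first.
  have sE : sup S = 1 by apply/eqP; rewrite eq_le s1.
  by case: Ss => _; rewrite sE mulr1.
pose t := Num.min 1 (sup S + d / 2).
have t1 : t <= 1 by rewrite ge_min lexx.
have ts : sup S < t by rewrite lt_min s_lt1; lra.
have td : t <= sup S + d / 2 by rewrite ge_min lexx orbT.
have St : S t.
  split; first by rewrite t1 andbT; lra.
  have := Hd t; rewrite t1 andbT gtr0_norm ?subr_gt0//.
  have t0 : 0 <= t by lra.
  have tsd : t - sup S < d by lra.
  move=> /(_ t0 tsd) h; case: Ss => _ h'.
  have -> : psi t - psi 0 = (psi t - psi (sup S)) + (psi (sup S) - psi 0).
    by zmodule.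
  by rewrite (le_trans (ler_normD _ _))//; lra.
by have := ub_le_sup Sb.2 St; rewrite leNgt ts.
Qed.

Lemma Fderiv_remainder (E F : normedModType R) (f : E -> F) x : differentiable f x ->
  forall eps : R, 0 < eps -> exists2 d : R, 0 < d & forall h, `|h| < d ->
    `|f (x + h) - f x - Fderiv f x h| <= eps * `|h|.
Proof.
move=> df e e0; have := diff_locally df.
move=> /eqaddoP /(_ _ e0) /nbhs_ballP[d /= d0 Hd]; exists d => // h hd.
have := Hd h; rewrite -ball_normE /= sub0r normrN => /(_ hd) H.
by rewrite FderivE// [x + h]addrC -addrA -opprD; exact: H.
Qed.

Lemma Fderiv_blin_comp (E F G : normedModType R) (L : blin F G) (f : E -> F) x :
  differentiable f x -> Fderiv (fun y => L (f y)) x = blin_comp L (Fderiv f x).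
Proof.
move=> df; have cL := @blin_continuous _ _ _ L.
have dL : differentiable L (f x) by exact: linear_differentiable.
apply: blin_eqP => v /=; rewrite !FderivE//; last exact: differentiable_comp.
by rewrite (diff_comp df dL) /= (diff_lin _ cL).
Qed.

(** A mean value inequality along two segments at once, with a linear correction [e]. Lipschitz
    bounds, Taylor bounds and comparisons of expansions at two base points are instances; [e]
    carries the first-order terms to be subtracted. *)
Lemma mean_value2 (W E : normedModType R) (phi phi' : W -> E) a b a' b' e (c : R) :
  (forall x, differentiable phi x) -> (forall x, differentiable phi' x) ->
  (forall t : R, 0 <= t <= 1 ->
    `|Fderiv phi (a + t *: b) b - Fderiv phi' (a' + t *: b') b' - e| <= c) ->
  `|(phi (a + b) - phi' (a' + b') - e) - (phi a - phi' a')| <= c.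
Proof.
move=> dphi dphi' H; apply/ler_addgt0Pl => k k0.
pose psi t := phi (a + t *: b) - phi' (a' + t *: b') - t *: e.
have -> : phi (a + b) - phi' (a' + b') - e - (phi a - phi' a') = psi 1 - psi 0.
  by rewrite /psi !scale1r !scale0r !addr0 subr0.
apply: locally_lipschitz01 => t t01.
(* With Frechet errors of relative size [k / m] in both directions, the total error stays below [k]
   per unit of time. *)
pose m := `|b| + `|b'| + 1.
have m0 : 0 < m by rewrite ltr_wpDl// addr_ge0.
have km : 0 < k / m by rewrite divr_gt0.
have [d d0 Hd] := Fderiv_remainder (dphi (a + t *: b)) km.
have [d' d'0 Hd'] := Fderiv_remainder (dphi' (a' + t *: b')) km.
have dm0 : 0 < Num.min d d' / m by rewrite divr_gt0// lt_min d0.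
exists (Num.min d d' / m) => // s s01 std.
have bm : `|b| <= m by rewrite /m -addrA lerDl addr_ge0.
have bm' : `|b'| <= m by rewrite /m addrAC lerDr addr_ge0.
have stm : `|s - t| * m < Num.min d d' by rewrite -ltr_pdivlMr.
have h1 : `|(s - t) *: b| < d.
  rewrite normrZ (@le_lt_trans _ _ (`|s - t| * m))// ?ler_wpM2l//.
  by rewrite (lt_le_trans stm)// ge_min lexx.
have h2 : `|(s - t) *: b'| < d'.
  rewrite normrZ (@le_lt_trans _ _ (`|s - t| * m))// ?ler_wpM2l//.
  by rewrite (lt_le_trans stm)// ge_min lexx orbT.
have := Hd _ h1; have := Hd' _ h2; rewrite !linearZ /= !normrZ.
have tsE (F : normedModType R) (x y : F) : x + t *: y + (s - t) *: y = x + s *: y.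
  by rewrite -addrA -scalerDl addrCA subrr addr0.
rewrite !tsE.
set A := Fderiv phi _ b; set A' := Fderiv phi' _ b'; rewrite !scalerN => r2 r1.
have -> : psi s - psi t =
  (phi (a + s *: b) - phi (a + t *: b) - (s - t) *: A) -
  (phi' (a' + s *: b') - phi' (a' + t *: b') - (s - t) *: A') +
  (s - t) *: (A - A' - e).
  by rewrite /psi !scalerBr !scalerBl; zmodule.
rewrite (le_trans (ler_normD _ _))//.
have hA : `|(s - t) *: (A - A' - e)| <= `|s - t| * c.
  by rewrite normrZ ler_wpM2l// H.
apply: (le_trans (lerD (le_trans (ler_normB _ _) (lerD r1 r2)) hA)).
have kE : k = k / m * (`|b| + `|b'| + 1) by rewrite divfK// gt_eqF.
rewrite -subr_ge0 [X in (X + c) * _]kE.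
have -> : forall q r x y : R, (q * (x + y + 1) + c) * r -
    (q * (r * x) + q * (r * y) + r * c) = q * r by move=> *; ring.
by rewrite mulr_ge0// ltW.
Qed.

End mean_value.

(** The consequences of the regularity of [f] on which the estimates rely, with a single constant.
    The mixed bounds come from the time regularity of the derivative of the next order; [tb_taylorB]
    and [tb_incrB] compare expansions at two base points and come from the third derivative. *)
Record Taylor_bounds {R : realType} {W E : normedModType R} (T gam C : R)
    (f : R -> W -> E) (df : R -> W -> blin W E) : Prop := TaylorBounds {
  tb_ge0 : 0 <= C ;
  tb_f : forall t y, 0 <= t <= T -> `|f t y| <= C ;
  tb_df : forall t y, 0 <= t <= T -> `|df t y| <= C ;
  tb_f_lip : forall t y z, 0 <= t <= T -> `|f t y - f t z| <= C * `|y - z| ;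
  tb_df_lip : forall t y z, 0 <= t <= T -> `|df t y - df t z| <= C * `|y - z| ;
  tb_f_time : forall s t y, 0 <= s -> s <= t -> t <= T ->
    `|f t y - f s y| <= C * (t - s) `^ gam ;
  tb_df_time : forall s t y, 0 <= s -> s <= t -> t <= T ->
    `|df t y - df s y| <= C * (t - s) `^ gam ;
  tb_f_mix : forall s t y z, 0 <= s -> s <= t -> t <= T ->
    `|(f t y - f s y) - (f t z - f s z)| <= C * (t - s) `^ gam * `|y - z| ;
  tb_df_mix : forall s t y z, 0 <= s -> s <= t -> t <= T ->
    `|(df t y - df s y) - (df t z - df s z)| <= C * (t - s) `^ gam * `|y - z| ;
  tb_taylor : forall t y z, 0 <= t <= T ->
    `|f t (y + z) - f t y - df t y z| <= C * `|z| ^+ 2 ;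
  tb_taylorB : forall t y z y' z', 0 <= t <= T ->
    `|(f t (y + z) - f t y - df t y z) - (f t (y' + z') - f t y' - df t y' z')| <=
      C * (`|z| ^+ 2 * `|y - y'| + (`|z| + `|z| ^+ 2 + `|z'|) * `|z - z'|) ;
  tb_incrB : forall t y z y' z', 0 <= t <= T ->
    `|(df t (y + z) - df t y) - (df t (y' + z') - df t y')| <=
      C * (`|z| * `|y - y'| + (1 + `|z|) * `|z - z'|)
}.

Section taylor.
Context {R : realType} {W E : normedModType R}.

Lemma lip_of_deriv (F : normedModType R) (phi : W -> F) (c : R) y z :
  (forall x, differentiable phi x) -> (forall x, `|Fderiv phi x| <= c) ->
  `|phi y - phi z| <= c * `|y - z|.
Proof.
move=> dphi H.
have := @mean_value2 _ _ _ phi phi z (y - z) z 0 0 (c * `|y - z|) dphi dphi.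
have -> : z + (y - z) = y by rewrite addrC subrK.
rewrite addr0 subr0 subrr subr0; apply => t _.
by rewrite linear0 !subr0 blin_norm_le.
Qed.

Lemma lip2_of_deriv (F : normedModType R) (phi phi' : W -> F) (c : R) y z :
  (forall x, differentiable phi x) -> (forall x, differentiable phi' x) ->
  (forall x, `|Fderiv phi x - Fderiv phi' x| <= c) ->
  `|(phi y - phi' y) - (phi z - phi' z)| <= c * `|y - z|.
Proof.
move=> dphi dphi' H.
have := @mean_value2 _ _ _ phi phi' z (y - z) z (y - z) 0 (c * `|y - z|) dphi dphi'.
have -> : z + (y - z) = y by rewrite addrC subrK.
rewrite subr0; apply => t _.
by rewrite subr0 -blinB blin_norm_le.
Qed.

Lemma Cb_holder_Taylor_bounds (T gam : R) (f : R -> W -> E) :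
  Cb_holder T gam 3 f -> exists C, Taylor_bounds T gam C f (fun t => Fderiv (f t)).
Proof.
move=> [Hd [C1 HC1] [C2 HC2]].
pose C := `|C1| + `|C2|.
have C0 : 0 <= C by rewrite addr_ge0.
have d0 t x : 0 <= t <= T -> differentiable (f t) x.
  by move=> tT; have [/(_ 0%N x isT)] := Hd t tT.
have d1 t x : 0 <= t <= T -> differentiable (Fderiv (f t)) x.
  by move=> tT; have [/(_ 1%N x isT)] := Hd t tT.
have d2 t x : 0 <= t <= T -> differentiable (Fderiv (Fderiv (f t))) x.
  by move=> tT; have [/(_ 2%N x isT)] := Hd t tT.
have C1C x : x <= C1 -> x <= C.
  by move=> /le_trans; apply; rewrite (le_trans (ler_norm _))// lerDl.
have b0 t y : 0 <= t <= T -> `|f t y| <= C.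
  by move=> tT; apply/C1C/(HC1 0%N).
have b1 t y : 0 <= t <= T -> `|Fderiv (f t) y| <= C.
  by move=> tT; apply/C1C/(HC1 1%N).
have b2 t y : 0 <= t <= T -> `|Fderiv (Fderiv (f t)) y| <= C.
  by move=> tT; apply/C1C/(HC1 2%N).
have b3 t y : 0 <= t <= T -> `|Fderiv (Fderiv (Fderiv (f t))) y| <= C.
  by move=> tT; apply/C1C/(HC1 3%N).
have hold k s t y : (k < 3)%N -> 0 <= s -> s <= t -> t <= T ->
    `|Dn (f t) k y - Dn (f s) k y| <= C * (t - s) `^ gam.
  move=> k3 s0 st tT; have [<-|nst] := eqVneq s t.
    by rewrite !subrr normr0 mulr_ge0// powR_ge0.
  have s0T : 0 <= s <= T by rewrite s0 (le_trans st).
  have t0T : 0 <= t <= T by rewrite tT (le_trans s0).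
  apply: (le_trans (HC2 k s t y k3 s0T t0T nst)).
  rewrite ger0_norm ?subr_ge0// ler_wpM2r ?powR_ge0//.
  by rewrite (le_trans (ler_norm _))// lerDr.
have inT s t : 0 <= s -> s <= t -> t <= T -> (0 <= s <= T) * (0 <= t <= T).
  by move=> s0 st tT; rewrite s0 tT (le_trans st)// (le_trans s0).
have scal (F : normedModType R) (t : R) (z : F) : 0 <= t <= 1 -> `|t *: z| <= `|z|.
  by move=> /andP[t0 t1]; rewrite normrZ ger0_norm// ler_piMl.
have dflip t y z : 0 <= t <= T ->
    `|Fderiv (f t) y - Fderiv (f t) z| <= C * `|y - z|.
  by move=> tT; apply: lip_of_deriv => x; [exact: d1 | exact: b2].
have incrB t y z y' z' : 0 <= t <= T ->
    `|(Fderiv (f t) (y + z) - Fderiv (f t) y) -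
      (Fderiv (f t) (y' + z') - Fderiv (f t) y')| <=
      C * (`|z| * `|y - y'| + (1 + `|z|) * `|z - z'|).
  move=> tT.
  have -> : Fderiv (f t) (y + z) - Fderiv (f t) y -
     (Fderiv (f t) (y' + z') - Fderiv (f t) y') =
     (Fderiv (f t) (y + z) - Fderiv (f t) (y' + z') - 0) -
      (Fderiv (f t) y - Fderiv (f t) y') by zmodule.
  apply: mean_value2 => [x|x|u u01]; [exact: d1|exact: d1|].
  rewrite subr0; set D := Fderiv (Fderiv (f t)).
  have -> : D (y + u *: z) z - D (y' + u *: z') z' =
     (D (y + u *: z) - D (y' + u *: z')) z + D (y' + u *: z') (z - z').
    by rewrite blinB blinBr; zmodule.
  (* The third derivative enters here: its bound makes the second derivative [D] Lipschitz. *)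
  have h1 : `|D (y + u *: z) - D (y' + u *: z')| <= C * (`|y - y'| + `|z - z'|).
    apply: (@le_trans _ _ (C * `|(y + u *: z) - (y' + u *: z')|)).
      by apply: lip_of_deriv => x; [exact: d2 | exact: b3].
    apply: ler_wpM2l => //.
    have -> : y + u *: z - (y' + u *: z') = (y - y') + u *: (z - z').
      by rewrite scalerBr; zmodule.
    by rewrite (le_trans (ler_normD _ _))// lerD2l scal.
  apply: (le_trans (ler_normD _ _)).
  apply: (le_trans (lerD (blin_norm_le h1 (lexx `|z|))
    (blin_norm_le (b2 t _ tT) (lexx `|z - z'|)))).
  by rewrite le_eqVlt; apply/orP; left; apply/eqP; ring.
exists C; split => //.
- by move=> t y z tT; apply: lip_of_deriv => x; [exact: d0 | exact: b1].
- by move=> s t y s0 st tT; apply: (hold 0%N).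
- by move=> s t y s0 st tT; apply: (hold 1%N).
- move=> s t y z s0 st tT; have [s01 t01] := inT s t s0 st tT.
  apply: lip2_of_deriv => x; [exact: d0|exact: d0|exact: (hold 1%N)].
- move=> s t y z s0 st tT; have [s01 t01] := inT s t s0 st tT.
  apply: lip2_of_deriv => x; [exact: d1|exact: d1|exact: (hold 2%N)].
- move=> t y z tT.
  have -> : f t (y + z) - f t y - Fderiv (f t) y z =
    (f t (y + z) - f t (y + 0) - Fderiv (f t) y z) - (f t y - f t y).
    by rewrite addr0; zmodule.
  apply: mean_value2 => [x|x|u u01]; [exact: d0|exact: d0|].
  rewrite linear0 subr0 -blinB expr2 mulrA; apply: blin_norm_le => //.
  apply: (le_trans (dflip _ _ _ tT)); rewrite addrC addKr.
  by rewrite ler_wpM2l// scal.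
move=> t y z y' z' tT.
have -> : f t (y + z) - f t y - Fderiv (f t) y z -
    (f t (y' + z') - f t y' - Fderiv (f t) y' z') =
  (f t (y + z) - f t (y' + z') - (Fderiv (f t) y z - Fderiv (f t) y' z')) -
    (f t y - f t y') by zmodule.
apply: mean_value2 => [x|x|u u01]; [exact: d0|exact: d0|].
set D := Fderiv (f t).
have -> : D (y + u *: z) z - D (y' + u *: z') z' - (D y z - D y' z') =
  (D (y + u *: z) - D y - (D (y' + u *: z') - D y')) z +
  (D (y' + u *: z') - D y') (z - z').
  by rewrite !blinB !blinBr; zmodule.
have h1 : `|D (y + u *: z) - D y - (D (y' + u *: z') - D y')| <=
    C * (`|z| * `|y - y'| + (1 + `|z|) * `|z - z'|).
  apply: (le_trans (incrB _ _ _ _ _ tT)); apply: ler_wpM2l => //.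
  apply: lerD; first by rewrite ler_wpM2r// scal.
  by rewrite -scalerBr ler_pM ?addr_ge0// ?lerD2l scal.
have h2 : `|D (y' + u *: z') - D y'| <= C * `|z'|.
  apply: (le_trans (dflip _ _ _ tT)); rewrite addrC addKr.
  by rewrite ler_wpM2l// scal.
apply: (le_trans (ler_normD _ _)).
apply: (le_trans (lerD (blin_norm_le h1 (lexx `|z|))
  (blin_norm_le h2 (lexx `|z - z'|)))).
by rewrite le_eqVlt; apply/orP; left; apply/eqP; ring.
Qed.

End taylor.

(** * Bochner integrals of continuous functions *)

Section bochner_facts.
Context {R : realType} {W : normedModType R}.
Notation mu := (@lebesgue_measure R).
Arguments simple_size {R W D} s.
Arguments cell {R W D} s i.
Arguments coef {R W D} s i.

Section atoms.
Context {a b : R} (s : simple_fun (W := W) `[a, b]).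
Notation D := [set` `[a, b]].
Notation I := 'I_(simple_size s).

(** The cells of a simple function may overlap. The atoms of the algebra they generate are disjoint,
    and the function is constant on each of them, so integrals of norms can be computed atom by
    atom. *)
Definition atom (J : {set I}) : set R :=
  \bigcap_(i in [set: I]) (if i \in J then cell s i else ~` cell s i).

Definition cells_at (t : R) : {set I} := [set i : I | t \in cell s i]%SET.

Definition atom_value (J : {set I}) : W := \sum_(i in J) coef s i.

Lemma atom_measurable J : measurable (atom J).
Proof.
apply: fin_bigcap_measurable => // i _; case: ifP => _.
  exact: cell_measurable.
by apply: measurableC; exact: cell_measurable.
Qed.

(** Each [t] lies in exactly one atom, the one indexed by [cells_at t], so only one summand
    survives. *)
Lemma atom_sum (E : zmodType) (g : {set I} -> E) (h : {set I} -> R -> E) t :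
  (forall J, atom J t -> h J t = g J) -> (forall J, ~ atom J t -> h J t = 0) ->
  \sum_J h J t = g (cells_at t).
Proof.
move=> h1 h0; rewrite (bigD1 (cells_at t))//= h1; last first.
  move=> i _; rewrite inE; case: ifPn => [/set_mem//|+ ct].
  by move=> /negP; apply; exact/mem_set.
rewrite big1 ?addr0// => J /eqP nJ; apply: h0 => aJ; apply: nJ.
apply/setP => i; rewrite inE; have := aJ i Logic.I.
case: ifPn => iJ ct; first by rewrite mem_set.
by apply/esym/negbTE/negP => /set_mem.
Qed.

Lemma simple_val_atom t : simple_val s t = atom_value (cells_at t).
Proof.
rewrite /simple_val /atom_value [RHS]big_mkcond; apply: eq_bigr => i _.
by rewrite inE indicE; case: (t \in _); rewrite ?scale1r ?scale0r.
Qed.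

Lemma norm_sub_simple_val (f : R -> W) t :
  `|f t - simple_val s t| = \sum_J \1_(atom J) t * `|f t - atom_value J|.
Proof.
rewrite simple_val_atom; apply/esym.
apply: (@atom_sum _ (fun J => `|f t - atom_value J|)
  (fun J t => \1_(atom J) t * `|f t - atom_value J|)) => J aJ.
  by rewrite indicE mem_set// mul1r.
by rewrite indicE memNset// mul0r.
Qed.

Lemma cell_atom i t : \1_(cell s i) t = \sum_(J : {set I} | i \in J) \1_(atom J) t :> R.
Proof.
rewrite big_mkcond /=.
rewrite (@atom_sum _ (fun J => (i \in J)%:R)
  (fun J t => if i \in J then \1_(atom J) t else 0)).
- by rewrite inE indicE.
- by move=> J aJ; case: ifP => // _; rewrite indicE mem_set.
- by move=> J aJ; case: ifP => // _; rewrite indicE memNset.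
Qed.

(** The atom of the empty set contains the complement of [D], which is why atoms are cut down to [D]
    before being measured. *)
Lemma fin_atom J : (mu (atom J `&` D) < +oo)%E.
Proof.
apply: (@le_lt_trans _ _ (mu D)).
  apply: le_measure; rewrite ?inE//.
  by apply: measurableI => //; exact: atom_measurable.
by rewrite lebesgue_measure_itv /=; case: ifP => _; rewrite ?ltry.
Qed.

Lemma mu_cell i :
  fine (mu (cell s i)) = \sum_(J : {set I} | i \in J) fine (mu (atom J `&` D)).
Proof.
have mD : measurable D by [].
have -> : mu (cell s i) = (\int[mu]_(t in D) (\1_(cell s i) t)%:E)%E.
  rewrite integral_indic//; last exact: cell_measurable.
  by congr (mu _); apply/esym/setIidPl; exact: cell_sub.
under eq_integral do rewrite cell_atom -sumEFin.
under eq_integral do rewrite big_mkcond /=.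
rewrite (ge0_integral_sum mu mD); last 2 first.
  move=> J; case: (i \in J); last exact: measurable_cst.
  by apply/measurable_EFinP/measurable_indic; exact: atom_measurable.
  by move=> J t _; case: ifP => // _; rewrite lee_fin.
rewrite -[RHS]/(fine (_%:E)) -sumEFin big_mkcond [in RHS]big_mkcond /=; congr fine.
apply: eq_bigr => J _; case: ifP => iJ; last by rewrite integral0.
rewrite integral_indic//; last exact: atom_measurable.
by rewrite fineK// ge0_fin_numE ?measure_ge0//; exact: fin_atom.
Qed.

Lemma simple_integral_atom :
  simple_integral s = \sum_J fine (mu (atom J `&` D)) *: atom_value J.
Proof.
rewrite /simple_integral.
under eq_bigr do rewrite mu_cell scaler_suml.
rewrite (exchange_big_dep predT)//=; apply: eq_bigr => J _.
by rewrite scaler_sumr.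
Qed.

(** On disjoint atoms this is the triangle inequality for a finite sum. *)
Lemma norm_simple_integral_le :
  (`|simple_integral s|%:E <= \int[mu]_(t in D) `|simple_val s t|%:E)%E.
Proof.
have mD : measurable D by [].
have -> : (\int[mu]_(t in D) `|simple_val s t|%:E)%E =
    (\sum_J (fine (mu (atom J `&` D)) * `|atom_value J|)%:E)%E.
  under eq_integral => t _.
    have -> : `|simple_val s t| = `|0 - simple_val s t| by rewrite sub0r normrN.
    rewrite (norm_sub_simple_val (fun=> 0)) -sumEFin; over.
  rewrite (ge0_integral_sum mu mD); last 2 first.
    move=> J; apply/measurable_EFinP; apply: measurable_funM => //.
    by apply: measurable_indic; exact: atom_measurable.
    by move=> J t _; rewrite lee_fin mulr_ge0.
  apply: eq_bigr => J _.
  under eq_integral do rewrite EFinM muleC sub0r normrN.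
  have mA : measurable_fun D (fun t => (\1_(atom J) t : R)%:E).
    by apply/measurable_EFinP/measurable_indic; exact: atom_measurable.
  rewrite (ge0_integralZl mu mD mA) ?lee_fin//.
  rewrite integral_indic//; last exact: atom_measurable.
  rewrite EFinM muleC fineK// ge0_fin_numE ?measure_ge0//; exact: fin_atom.
rewrite sumEFin lee_fin simple_integral_atom (le_trans (ler_norm_sum _ _ _))//.
by apply: ler_sum => J _; rewrite normrZ ger0_norm ?fine_ge0 ?measure_ge0.
Qed.

(** [W] carries no measurable structure here: on each atom the integrand is the norm of a continuous
    map, hence a continuous real function on [[a, b]]. *)
Lemma measurable_sub_simple (f : R -> W) : ucont a b f ->
  measurable_fun D (fun t => `|f t - simple_val s t|%:E).
Proof.
move=> cf; apply/measurable_EFinP.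
have -> : (fun t => `|f t - simple_val s t|) =
    (fun t => \sum_J \1_(atom J) t * `|f t - atom_value J|).
  by apply/funext => t; exact: norm_sub_simple_val.
apply: measurable_sum => J; apply: measurable_funM.
  by apply: measurable_indic; exact: atom_measurable.
apply: subspace_continuous_measurable_fun => //.
apply/subspace_continuousP => x abx.
apply/cvgrPdist_le => e e0; have [d d0 Hd] := cf e e0.
rewrite near_withinE; near=> y => aby.
have xyd : `|x - y| < d.
  by near: y; apply/nbhs_ballP; exists d => //= y; rewrite -ball_normE.
have xy : `|f x - f y| <= e.
  move: abx aby; rewrite /= !in_itv /= => /andP[ax xb] /andP[ay yb].
  have [xy|yx] := leP x y.
    by rewrite distrC; apply: Hd => //; rewrite distrC ger0_norm ?subr_ge0// in xyd.
  by apply: Hd => //; rewrite ?ltW// gtr0_norm ?subr_gt0// in xyd *.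
apply: le_trans xy.
have -> : f x - f y = (f x - atom_value J) - (f y - atom_value J) by zmodule.
exact: ler_dist_dist.
Unshelve. all: by end_near. Qed.

End atoms.

Lemma simple_funB {D : set R} (s s' : simple_fun (W := W) D) :
  exists s'' : simple_fun (W := W) D,
    (forall t, simple_val s'' t = simple_val s t - simple_val s' t) /\
    simple_integral s'' = simple_integral s - simple_integral s'.
Proof.
pose c (i : 'I_(simple_size s + simple_size s')) :=
  match fintype.split i with inl j => cell s j | inr j => cell s' j end.
pose k (i : 'I_(simple_size s + simple_size s')) :=
  match fintype.split i with inl j => coef s j | inr j => - coef s' j end.
have mc i : measurable (c i).
  by rewrite /c; case: (fintype.split i) => j; exact: cell_measurable.
have sc i : c i `<=` D by rewrite /c; case: (fintype.split i) => j; exact: cell_sub.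
exists (SimpleFun k mc sc); split.
  move=> t; rewrite /simple_val /= big_split_ord /=; congr (_ + _).
    by apply: eq_bigr => i _; rewrite /c /k (unsplitK (inl i)).
  rewrite -sumrN; apply: eq_bigr => i _.
  by rewrite /c /k (unsplitK (inr i)) scalerN.
rewrite /simple_integral /= big_split_ord /=; congr (_ + _).
  by apply: eq_bigr => i _; rewrite /c /k (unsplitK (inl i)).
rewrite -sumrN; apply: eq_bigr => i _.
by rewrite /c /k (unsplitK (inr i)) scalerN.
Qed.

(** The difference of two approximating simple functions is simple, and its L^1 norm is at most the
    sum of both errors. This identifies the drift integral of an arbitrary mild solution with a
    limit of Riemann sums. *)
Lemma bochner_unique (a b : R) (f : R -> W) I I' : ucont a b f ->
  is_bochner a b f I -> is_bochner a b f I' -> I = I'.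
Proof.
move=> cf [s [_ s0 sI]] [s' [_ s'0 s'I']].
have mD : measurable (`[a, b] : set R) by [].
have le n : (`|simple_integral (s n) - simple_integral (s' n)|%:E <=
   \int[mu]_(t in `[a, b]) `|f t - simple_val (s n) t|%:E +
   \int[mu]_(t in `[a, b]) `|f t - simple_val (s' n) t|%:E)%E.
  have [s'' [sv <-]] := simple_funB (s n) (s' n).
  apply: (le_trans (norm_simple_integral_le s'')).
  have m1 := measurable_sub_simple (s n) cf.
  have m2 := measurable_sub_simple (s' n) cf.
  rewrite -ge0_integralD//; apply: ge0_le_integral => //.
  - have -> : (fun t => `|simple_val s'' t|%:E) =
        (fun t => `|0 - simple_val s'' t|%:E).
      by apply/funext => t; rewrite sub0r normrN.
    apply: (@measurable_sub_simple _ _ s'' (fun=> 0)).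
    by move=> e e0; exists 1 => // *; rewrite subrr normr0 ltW.
  - exact: emeasurable_funD.
  - move=> t _; rewrite -EFinD lee_fin sv.
    have -> : simple_val (s n) t - simple_val (s' n) t =
      (f t - simple_val (s' n) t) - (f t - simple_val (s n) t) by zmodule.
    by rewrite [leRHS]addrC; exact: ler_normB.
have cv : (`|simple_integral (s n) - simple_integral (s' n)|%:E @[n --> \oo]
    --> 0)%E.
  apply: (@squeeze_cvge _ _ _ _ (fun=> 0%E) _ (fun n =>
   \int[mu]_(t in `[a, b]) `|f t - simple_val (s n) t|%:E +
   \int[mu]_(t in `[a, b]) `|f t - simple_val (s' n) t|%:E)%E).
  - by apply: nearW => n; rewrite (le n) andbT lee_fin.
  - exact: cvg_cst.
  - by rewrite -[X in _ --> X]adde0; apply: cvgeD.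
have cv' : `|simple_integral (s n) - simple_integral (s' n)|%:E @[n --> \oo]
    --> `|I - I'|%:E.
  by apply: cvg_EFin; [exact: nearW | apply: cvg_norm; exact: cvgB].
have e0 := @cvg_lim _ (@ereal_hausdorff R) _ _ eventually_filter _ _ cv.
have := @cvg_lim _ (@ereal_hausdorff R) _ _ eventually_filter _ _ cv'.
rewrite e0 => /esym [] /eqP.
by rewrite normr_eq0 subr_eq0 => /eqP.
Qed.

Lemma psum_simple (f : R -> W) (a : R) p : path <%R a p ->
  \sum_(i < size p) fine (mu `[(a :: p)`_i, p`_i[) *: f (a :: p)`_i =
  psum (riem f) a p.
Proof.
elim: p a => [|x p IH] a /=; first by rewrite big_ord0.
move=> /andP[ax pP]; rewrite big_ord_recl /= IH//; congr (_ + _).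
by rewrite lebesgue_measure_itv /= lte_fin ax.
Qed.

Lemma step_val (f : R -> W) (d a : R) p t : path (gap d) a p ->
  a <= t < last a p -> exists u, [/\ a <= u, u <= t, t - u < d &
  \sum_(i < size p) \1_(`[(a :: p)`_i, p`_i[) t *: f (a :: p)`_i = f u].
Proof.
elim: p a => [|x p IH] a /=.
  by move=> _ /andP[at_ ta]; have := le_lt_trans at_ ta; rewrite ltxx.
move=> /andP[/andP[ax xad] pP] /andP[at_ tl].
rewrite big_ord_recl /=; have [tx|xt] := ltP t x.
  exists a; split => //; first lra.
  rewrite indicE mem_set; last by rewrite /= in_itv /= at_ tx.
  rewrite scale1r big1 ?addr0// => i _ /=.
  rewrite indicE memNset ?scale0r// /= in_itv /= => /andP[].
  have : x <= (x :: p)`_i.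
    have := ltn_ord i; case: (nat_of_ord i) => //= j jp.
    by have /andP[/ltW] := path_lt_mem (gap_path_lt pP) (mem_nth 0 (ltnW jp)).
  by move=> xi it_; have := le_lt_trans (le_trans xi it_) tx; rewrite ltxx.
have [|u [xu ut tud E]] := IH x pP; first by rewrite xt.
exists u; split => //; first by rewrite (le_trans (ltW ax)).
rewrite indicE memNset ?scale0r ?add0r//= in_itv /= => /andP[_].
by rewrite ltNge xt.
Qed.

(** Step functions taking the left endpoint values on finer and finer partitions converge uniformly
    on the half-open interval, and their integrals are the Riemann sums. *)
Lemma bochner_of_riem (a b : R) (f : R -> W) I : a <= b -> ucont a b f ->
  sews (riem f) a b I -> is_bochner a b f I.
Proof.
move=> ab cf HI.
have dn n : 0 < n.+1%:R^-1 :> R by rewrite invr_gt0 ltr0n.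
have /all_sig2[P PP Pl] n : {p | path (gap n.+1%:R^-1) a p & last a p = b}.
  by apply: cid2; apply: gap_partition.
have small (d : R) : 0 < d -> \forall n \near \oo, path (gap d) a (P n).
  move=> d0; exists (Num.Def.truncn d^-1) => // n /= Nn; apply: gap_mono (PP n).
  rewrite -[d]invrK lef_pV2 ?posrE ?invr_gt0//.
  by rewrite (le_trans (ltW (truncnS_gt _)))// ler_nat ltnS.
have mc n i : measurable `[(a :: P n)`_i, (P n)`_i[ by [].
have Pltl n := gap_path_lt (PP n).
have sc n (i : 'I_(size (P n))) :
    [set` `[(a :: P n)`_i, (P n)`_i[] `<=` [set` `[a, b]].
  move=> x; rewrite /= !in_itv /= => /andP[x1 x2]; apply/andP; split.
    apply: le_trans x1; have := ltn_ord i; case: (nat_of_ord i) => //= j jp.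
    by have /andP[/ltW] := path_lt_mem (Pltl n) (mem_nth 0 (ltnW jp)).
  apply: le_trans (ltW x2) _; rewrite -(Pl n).
  by have /andP[_] := path_lt_mem (Pltl n) (mem_nth 0 (ltn_ord i)).
pose s n : simple_fun (W := W) [set` `[a, b]] :=
  SimpleFun (fun i : 'I_(size (P n)) => f (a :: P n)`_i) (mc n) (@sc n).
have close (e : R) : 0 < e -> \forall n \near \oo, forall t, a <= t < b ->
    `|f t - simple_val (s n) t| <= e.
  move=> e0; have [d d0 Hd] := cf e e0.
  near=> n => t /andP[at_ tb].
  have pn : path (gap d) a (P n) by near: n; exact: small.
  have [|u [au ut tud E]] := step_val f pn (t := t); first by rewrite Pl at_.
  by rewrite /simple_val /= E; apply: Hd => //; exact: ltW.
exists s; split.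
- exists [set b]; split; [exact: measurable_set1 | exact: lebesgue_measure_set1 |].
  move=> t /= H; apply: contrapT => tb; apply: H => /andP[at_ tb'].
  have ltb : t < b by rewrite lt_neqAle tb' andbT; apply/eqP.
  apply/cvgrPdist_le => e e0; have := close e e0; apply: filterS => n; apply.
  by rewrite at_.
- have mD : measurable ([set` `[a, b]] : set R) by [].
  have le (e : R) : 0 < e -> \forall n \near \oo,
      (\int[mu]_(t in `[a, b]) `|f t - simple_val (s n) t|%:E <=
        (e * (b - a))%:E)%E.
    move=> e0; have := close e e0; apply: filterS => n Hn.
    (* The half-open cells leave out [b]; the error there has size [B] but sits on a null set. *)
    pose B := `|f b - simple_val (s n) b|.
    have mb : measurable [set b] by exact: measurable_set1.
    have mB : measurable_fun [set` `[a, b]] (fun t => (\1_[set b] t : R)%:E).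
      by apply/measurable_EFinP/measurable_indic.
    have mBB : measurable_fun [set` `[a, b]]
        (fun t => B%:E * (\1_[set b] t : R)%:E)%E.
      by apply: emeasurable_funM => //; exact: measurable_cst.
    apply: (@le_trans _ _ (\int[mu]_(t in `[a, b])
        (e%:E + B%:E * (\1_[set b] t : R)%:E))%E).
      apply: ge0_le_integral => //.
      - exact: measurable_sub_simple.
      - by apply: emeasurable_funD => //; exact: measurable_cst.
      move=> t; rewrite /= in_itv /= => /andP[at_ tb].
      rewrite -EFinM -EFinD lee_fin indicE.
      have [->|tnb] := eqVneq t b; first by rewrite mem_set// mulr1 lerDr ltW.
      rewrite memNset ?mulr0 ?addr0; last by apply/eqP.
      by apply: Hn; rewrite at_ lt_neqAle tnb.
    have he t : [set` `[a, b]] t -> (0 <= e%:E)%E by rewrite lee_fin ltW.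
    have hB t : [set` `[a, b]] t -> (0 <= B%:E * (\1_[set b] t : R)%:E)%E.
      by rewrite -EFinM lee_fin mulr_ge0// /B normr_ge0.
    rewrite (ge0_integralD mu mD he (measurable_cst _) hB mBB).
    rewrite (ge0_integralZl mu mD mB) ?lee_fin ?/B ?normr_ge0// integral_indic//.
    have -> : [set b] `&` [set` `[a, b]] = [set b].
      by apply/setIidPl => _ ->; rewrite /= in_itv /= ab lexx.
    rewrite [X in (_ + _ * X)%E]lebesgue_measure_set1 mule0 adde0 integral_cst//.
    rewrite [X in (_ * X <= _)%E](_ : _ = (b - a)%:E) -?EFinM//.
    rewrite [LHS]lebesgue_measure_itv /= lte_fin; case: ifPn => // nab.
    have -> : b = a by apply/eqP; rewrite eq_le ab leNgt nab.
    by rewrite subrr.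
  have ge0 n : (0 <= \int[mu]_(t in `[a, b]) `|f t - simple_val (s n) t|%:E)%E.
    by apply: integral_ge0 => t _; rewrite lee_fin.
  apply/fine_cvgP; split.
    have := le _ ltr01; apply: filterS => n H; rewrite ge0_fin_numE//.
    by rewrite (le_lt_trans H)// ltry.
  apply/cvgrPdist_le => e e0.
  have k0 : 0 < e / (b - a + 1) by rewrite divr_gt0//; lra.
  have := le _ k0; apply: filterS => n H.
  rewrite sub0r normrN ger0_norm ?fine_ge0//.
  rewrite -lee_fin /= fineK; last by rewrite ge0_fin_numE// (le_lt_trans H)// ltry.
  rewrite (le_trans H)// lee_fin mulrAC ler_pdivrMr; last by lra.
  by rewrite ler_wpM2l ?ltW//; lra.
- apply/cvgrPdist_lt => e e0; have [d d0 Hd] := HI e e0.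
  have := small d d0; apply: filterS => n pn; rewrite distrC.
  by rewrite /simple_integral /= psum_simple//; apply: Hd.
Unshelve. all: by end_near. Qed.

End bochner_facts.

(** * Semigroups and the domains of powers of the generator *)

Section semigroup_theory.
Context {R : realType} {E : completeNormedModType R}.
Context (S : R -> blin E E) (hS : C0_semigroup S).

Lemma semi0 x : S 0 x = x. Proof. by have [] := hS. Qed.

Lemma semiD s t x : 0 <= s -> 0 <= t -> S (s + t) x = S s (S t x).
Proof. by have [_ H _] := hS; exact: H. Qed.

Lemma semi_right x (eps : R) : 0 < eps -> exists2 d : R, 0 < d &
  forall h, 0 <= h -> h < d -> `|S h x - x| <= eps.
Proof.
move=> e0; have [_ _ /(_ x) /cvgrPdist_le /(_ _ e0) [/= d d0 Hd]] := hS.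
exists d => // h; rewrite le_eqVlt => /predU1P[<- _|h0 hd].
  by rewrite semi0 subrr normr0 ltW.
rewrite distrC; apply: (Hd h) => //=.
by rewrite sub0r normrN gtr0_norm.
Qed.

(** Otherwise there are times [h n] tending to 0 with [S (h n)] unbounded in norm, although each
    orbit [S (h n) x] is bounded by right continuity at 0, contradicting the Banach-Steinhaus
    theorem. *)
Lemma semi_bounded_near0 : exists d M : R, [/\ 0 < d, 1 <= M &
  forall h, 0 <= h -> h <= d -> `|S h| <= M].
Proof.
apply/not_existsP => H.
have /choice[h Hh] : forall n : nat, exists h : R,
    [/\ 0 <= h, h <= n.+1%:R^-1 & n%:R + 1 < `|S h|].
  move=> n; apply/not_existsP => Hn; apply: (H n.+1%:R^-1).
  exists (n%:R + 1); split; first by rewrite invr_gt0 ltr0n.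
    by rewrite lerDr.
  move=> h h0 hn; rewrite leNgt; apply/negP => hS'; apply: (Hn h); split => //.
pose F := [set (blin_val (S (h n))) | n in [set: nat]].
have ptF : pointwise_bounded F.
  move=> x; have [d d0 Hd] := semi_right x ltr01.
  pose N := Num.Def.truncn d^-1.
  exists (`|x| + 1 + \sum_(n < N.+1) `|S (h n) x|) => _ [n _ <-].
  have [nN|Nn] := ltnP n N.+1.
    rewrite (bigD1 (Ordinal nN))//= addrCA lerDl addr_ge0 ?addr_ge0 ?sumr_ge0//.
  have [h0 hn _] := Hh n.
  have hd : h n < d.
    rewrite (le_lt_trans hn)// -[d]invrK ltf_pV2 ?posrE ?invr_gt0//.
    by rewrite (lt_le_trans (truncnS_gt _))// ler_nat ltnS ltnW.
  have := Hd _ h0 hd => hx.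
  have -> : S (h n) x = (S (h n) x - x) + x by rewrite subrK.
  rewrite (le_trans (ler_normD _ _))// [`|x| + 1]addrC -addrA lerD//.
  by rewrite lerDl sumr_ge0.
have := Banach_Steinhauss _ ptF.
have prop f : F f -> bounded_fun_norm f /\ linear f.
  move=> [n _ <-]; split; last exact: blin_linear.
  move=> r; exists (`|S (h n)| * r) => x xr; exact: blin_norm_le.
move=> /(_ prop 1)[M HM].
pose n := Num.Def.truncn `|M|.
have [_ _] := Hh n; rewrite ltNge => /negP; apply.
apply: (@le_trans _ _ (Num.max M 0)); last first.
  by rewrite ge_max addr_ge0// andbT (le_trans (ler_norm _))// natr1 ltW// truncnS_gt.
apply: ge_sup; first exact: (opnorm_has_sup (S (h n))).1.
move=> _ [x /= x1 <-]; rewrite le_max (HM (S (h n)))//; by exists n.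
Qed.

(** The time is cut into pieces of length [d], each costing a factor [M]; since [M >= 1], the
    largest power bounds all of them. *)
Lemma semi_bounded (T : R) : 0 <= T -> exists2 M : R, 1 <= M &
  forall t, 0 <= t -> t <= T -> `|S t| <= M.
Proof.
move=> T0; have [d [M [d0 M1 HM]]] := semi_bounded_near0.
have M0 : 0 <= M by rewrite (le_trans ler01).
have H n : forall t, 0 <= t -> t <= n%:R * d -> `|S t| <= M ^+ n.+1.
  elim: n => [|n IH] t t0.
    by rewrite mul0r expr1 => t1; apply: HM => //; rewrite (le_trans t1)// ltW.
  rewrite -natr1 mulrDl mul1r => tn.
  have [td|dt] := leP t d.
    rewrite (le_trans (HM _ t0 td))// -[leLHS]expr1 ler_weXn2l//.
  have td0 : 0 <= t - d by rewrite subr_ge0 ltW.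
  apply: blin_norm_lub => [|x]; first exact: exprn_ge0.
  have -> : S t x = S d (S (t - d) x).
    by rewrite -(semiD _ (ltW d0) td0) [d + _]addrC subrK.
  rewrite exprS -mulrA; apply: blin_norm_le; first by apply: HM => //; exact: ltW.
  by apply: blin_norm_le => //; apply: IH => //; lra.
exists (M ^+ (Num.Def.truncn (T / d)).+2); first exact: exprn_ege1.
move=> t t0 tT; apply: H => //; rewrite -ler_pdivrMr//.
rewrite (le_trans _ (ltW (truncnS_gt _)))// ler_wpM2r// invr_ge0 ltW//.
Qed.

(** Strong continuity becomes uniform along a continuous path: it is used at finitely many points of
    [g], and the other values are within [e / (3 * M)] of these, so that applying [S h] to the
    difference costs at most [e / 3]. *)
Lemma semi_unif (T : R) (g : R -> E) : 0 <= T -> ucont 0 T g ->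
  forall eps : R, 0 < eps -> exists2 d : R, 0 < d &
    forall h s, 0 <= h -> h < d -> 0 <= s <= T -> `|S h (g s) - g s| <= eps.
Proof.
move=> T0 Hg e e0; have [M M1 HM] := semi_bounded ler01.
have M0 : 0 < M by rewrite (lt_le_trans ltr01).
have ek : 0 < e / (3 * M) by rewrite divr_gt0// mulr_gt0.
have eM : e / (3 * M) * M = e / 3 by field; rewrite gt_eqF.
have e3 : e / (3 * M) <= e / 3 by rewrite -eM ler_peMr// ltW.
have [d d0 Hd] := Hg _ ek.
have e30 : 0 < e / 3 by rewrite divr_gt0.
have near_point a : 0 <= a -> exists2 d' : R, 0 < d' &
    forall h s, 0 <= h -> h < d' -> a <= s -> s <= T -> s - a < d ->
      `|S h (g s) - g s| <= e.
  move=> a0; have [d' d'0 Hd'] := semi_right (g a) e30.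
  exists (Num.min d' 1); first by rewrite lt_min d'0 ltr01.
  move=> h s h0; rewrite lt_min => /andP[hd h1] as_ sT sad.
  have sa := Hd a s a0 as_ sT sad.
  have -> : S h (g s) - g s = S h (g s - g a) + (S h (g a) - g a) - (g s - g a).
    by rewrite blinBr; zmodule.
  have h2 : `|S h (g s - g a)| <= M * (e / (3 * M)).
    by apply: blin_norm_le => //; apply: HM => //; exact: ltW.
  have := Hd' h h0 hd; rewrite mulrC eM in h2 => h3.
  rewrite (le_trans (ler_normB _ _))//.
  by have := ler_normD (S h (g s - g a)) (S h (g a) - g a); lra.
have [p pP pl] := gap_partition d0 T0.
suff : forall a, 0 <= a -> path (gap d) a p -> last a p = T ->
    exists2 d', 0 < d' & forall h s, 0 <= h -> h < d' -> a <= s <= T ->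
      `|S h (g s) - g s| <= e by apply.
elim: {pP pl} p => [|x p IH] a a0 /=.
  move=> _ aT; have [d' d'0 Hd'] := near_point a a0.
  exists d' => // h s h0 hd' /andP[as_ sT]; apply: Hd' => //; lra.
move=> /andP[/andP[ax axd] pP] pl.
have [d1 d10 H1] := near_point a a0.
have [|//|d2 d20 H2] := IH x _ pP; first by rewrite (le_trans a0)// ltW.
exists (Num.min d1 d2); first by rewrite lt_min d10.
move=> h s h0; rewrite lt_min => /andP[hd1 hd2] /andP[as_ sT].
have [xs|sx] := leP x s; first by apply: H2; rewrite ?xs.
by apply: H1 => //; lra.
Qed.

(** The operators need not be continuous in norm. Factoring [S (t - v)] out of the increment leaves
    an increment of [g] and [S (v - u) (g u) - g u], which [semi_unif] controls uniformly in [u]. *)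
Lemma convolution_ucont (T t : R) (g : R -> E) : 0 <= t -> t <= T ->
  ucont 0 T g -> ucont 0 t (fun s => S (t - s) (g s)).
Proof.
move=> t0 tT Hg e e0; have T0 := le_trans t0 tT.
have [M M1 HM] := semi_bounded T0.
have M0 : 0 < M by rewrite (lt_le_trans ltr01).
have ek : 0 < e / (2 * M) by rewrite divr_gt0// mulr_gt0.
have [d1 d10 H1] := semi_unif T0 Hg ek.
have [d2 d20 H2] := Hg _ ek.
exists (Num.min d1 d2); first by rewrite lt_min d10.
move=> u v u0 uv vt; rewrite lt_min => /andP[vu1 vu2].
have -> : S (t - v) (g v) - S (t - u) (g u) =
    S (t - v) (g v - g u) - S (t - v) (S (v - u) (g u) - g u).
  rewrite !blinBr -semiD ?subr_ge0//.
  have -> : t - v + (v - u) = t - u by ring.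
  by zmodule.
have SM : `|S (t - v)| <= M by apply: HM; rewrite ?subr_ge0//; lra.
have h1 : `|S (t - v) (g v - g u)| <= M * (e / (2 * M)).
  by apply: blin_norm_le => //; apply: H2 => //; exact: le_trans tT.
have h2 : `|S (t - v) (S (v - u) (g u) - g u)| <= M * (e / (2 * M)).
  apply: blin_norm_le => //; apply: H1; rewrite ?subr_ge0// u0.
  by rewrite (le_trans uv)// (le_trans vt).
have eE : M * (e / (2 * M)) = e / 2 by field; rewrite gt_eqF.
rewrite (le_trans (ler_normB _ _))//; lra.
Qed.

Lemma gendom_approx y : gendom S y -> forall eps : R, 0 < eps ->
  exists2 d : R, 0 < d & forall h, 0 <= h -> h < d ->
    `|S h y - y - h *: generator S y| <= eps * h.
Proof.
move=> gy e e0; have /cvgrPdist_le /(_ _ e0) [/= d d0 Hd] := gy.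
exists d => // h; rewrite le_eqVlt => /predU1P[<- _|h0 hd].
  by rewrite semi0 subrr scale0r subrr normr0 mulr0.
have := Hd h; rewrite /= sub0r normrN gtr0_norm// => /(_ hd h0) H.
have -> : S h y - y - h *: generator S y =
   - (h *: (generator S y - h^-1 *: (S h y - y))).
  have hK (x : E) : h *: (h^-1 *: x) = x.
    by rewrite scalerA divff ?gt_eqF// scale1r.
  by rewrite [h *: (_ - _)]scalerBr hK opprB.
by rewrite normrN normrZ gtr0_norm// mulrC ler_wpM2r// ltW.
Qed.

Lemma gendom_intro y z : (forall eps : R, 0 < eps ->
  exists2 d : R, 0 < d & forall h, 0 < h -> h < d ->
    `|S h y - y - h *: z| <= eps * h) ->
  gendom S y /\ generator S y = z.
Proof.
move=> H.
have cv : (h^-1 *: (S h y - y) @[h --> 0^'+]) --> z.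
  apply/cvgrPdist_le => e e0; have [d d0 Hd] := H e e0.
  exists d => //= h; rewrite /= sub0r normrN => hd h0.
  rewrite gtr0_norm// in hd.
  have -> : z - h^-1 *: (S h y - y) = - (h^-1 *: (S h y - y - h *: z)).
    have hK (x : E) : h^-1 *: (h *: x) = x.
      by rewrite scalerA mulVf ?gt_eqF// scale1r.
    by rewrite [h^-1 *: (_ - h *: z)]scalerBr hK opprB.
  rewrite normrN normrZ gtr0_norm ?invr_gt0// mulrC ler_pdivrMr//.
  exact: Hd.
split; first by apply/cvg_ex; exists z.
by apply/cvg_lim => //; exact: norm_hausdorff.
Qed.

Lemma gendom_semi y t : 0 <= t -> gendom S y ->
  gendom S (S t y) /\ generator S (S t y) = S t (generator S y).
Proof.
move=> t0 gy; apply: gendom_intro => e e0.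
have k0 : 0 < `|S t| + 1 by rewrite ltr_wpDl.
have [|d d0 Hd] := gendom_approx gy (_ : 0 < e / (`|S t| + 1)).
  by rewrite divr_gt0.
exists d => // h h0 hd.
have -> : S h (S t y) - S t y - h *: S t (generator S y) =
   S t (S h y - y - h *: generator S y).
  by rewrite !blinBr blinZr -(semiD _ (ltW h0) t0) -(semiD _ t0 (ltW h0)) [t + h]addrC.
apply: (le_trans (blin_norm_le (lexx _) (Hd h (ltW h0) hd))).
rewrite mulrA; apply: ler_wpM2r; first exact: ltW.
by rewrite mulrCA ger_pMr// ler_pdivrMr// mul1r lerDl.
Qed.

Lemma orbit_integral y t : 0 <= t -> gendom S y ->
  sews (riem (fun r => S r (generator S y))) 0 t (S t y - y).
Proof.
move=> t0 gy; rewrite -[X in _ - X]semi0.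
apply: (@sews_path _ _ _ (fun r => S r y)) => e e0.
have [M M1 HM] := semi_bounded t0.
have M0 : 0 < M by rewrite (lt_le_trans ltr01).
have [|d d0 Hd] := gendom_approx gy (_ : 0 < e / M); first by rewrite divr_gt0.
exists d => // u v u0 uv vt vud.
have -> : S v y - S u y - riem (fun r => S r (generator S y)) u v =
  S u (S (v - u) y - y - (v - u) *: generator S y).
  rewrite !blinBr blinZr -!semiD ?subr_ge0//.
  by rewrite [u + _]addrC subrK.
have -> : e * (v - u) = M * (e / M * (v - u)) by field; rewrite gt_eqF.
apply: blin_norm_le; first by apply: HM => //; exact: le_trans vt.
by apply: Hd; rewrite ?subr_ge0.
Qed.

(** One power of the generator buys Lipschitz continuity in time, by integrating the orbit of
    [generator S y]. All time regularity of the semigroup terms in [W] stems from this. *)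
Lemma semi_lip (T M : R) y h : (forall t, 0 <= t -> t <= T -> `|S t| <= M) ->
  0 <= h -> h <= T -> gendom S y -> `|S h y - y| <= h * (M * `|generator S y|).
Proof.
move=> HM h0 hT gy; set k := M * _.
have := @sews_norm _ _ _ (fun x => x * k) _ _ _ 1 h0 ltr01 (orbit_integral h0 gy).
rewrite mul0r subr0; apply => u v u0 uv vh _.
rewrite /riem normrZ ger0_norm ?subr_ge0// -mulrBl ler_wpM2l ?subr_ge0//.
apply: blin_norm_le => //; apply: HM => //.
by rewrite (le_trans uv)// (le_trans vh).
Qed.

(** The integral formula for [S h y' - y'] survives the limit in [y'] for fixed [h]; only afterwards
    does [h] tend to 0. *)
Lemma generator_closed y z : (forall eps : R, 0 < eps -> exists y',
    [/\ gendom S y', `|y' - y| <= eps & `|generator S y' - z| <= eps]) ->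
  gendom S y /\ generator S y = z.
Proof.
move=> H; apply: gendom_intro => e e0.
have [M M1 HM] := semi_bounded ler01.
have M0 : 0 < M by rewrite (lt_le_trans ltr01).
have [|d d0 Hd] := @semi_right z (e / 2); first by rewrite divr_gt0.
exists (Num.min d 1); first by rewrite lt_min d0 ltr01.
move=> h h0; rewrite lt_min => /andP[hd h1].
have hM : `|S h| <= M by apply: HM; exact: ltW.
(* The errors [h * M * k], [M * k] and [k] must fit together into [e * h / 2]. The approximant [y']
   thus depends on [h]. *)
pose k := e * h / (2 * (M + 1 + h * M)).
have den : 0 < 2 * (M + 1 + h * M).
  by rewrite mulr_gt0// addr_gt0 ?mulr_gt0// addr_gt0.
have k0 : 0 < k by rewrite divr_gt0// mulr_gt0.
have [y' [gy' yy' gz]] := H k k0.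
have H1 : `|S h y' - y' - h *: z| <= h * (e / 2 + M * k).
  apply: (sews_close (ltW h0) d0 (orbit_integral (ltW h0) gy')) => p pP pl.
  have -> : h *: z = psum (fun u v => v *: z - u *: z) 0 p.
    by rewrite (psum_tele (fun v => v *: z)) pl scale0r subr0.
  rewrite -psumB -[h in leRHS]subr0 -pl mulrBl.
  apply: (@psum_bound _ _ _ (fun x => x * (e / 2 + M * k))) pP _ => u v u0 uv vl _.
  rewrite /riem -scalerBl -scalerBr normrZ ger0_norm ?subr_ge0// -mulrBl.
  rewrite ler_wpM2l ?subr_ge0//.
  have uh : u <= h by rewrite -pl (le_trans uv).
  have -> : S u (generator S y') - z = S u (generator S y' - z) + (S u z - z).
    by rewrite blinBr; zmodule.
  rewrite (le_trans (ler_normD _ _))// addrC lerD//.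
    by apply: Hd => //; exact: le_lt_trans hd.
  apply: blin_norm_le => //; apply: HM => //.
  by rewrite (le_trans uh)// ltW.
have -> : S h y - y - h *: z = (S h y' - y' - h *: z) - (S h (y' - y) - (y' - y)).
  by rewrite blinBr; zmodule.
have H2 : `|S h (y' - y)| <= M * k by exact: blin_norm_le.
have kE : k * (2 * (M + 1 + h * M)) = e * h by rewrite divfK// gt_eqF.
rewrite (le_trans (ler_normB _ _))//.
by have := ler_normB (S h (y' - y)) (y' - y); lra.
Qed.

End semigroup_theory.

(** * Domains of powers of the generator as Banach spaces *)

Section domains.
Context {R : realType} {W : completeNormedModType R}.
Context (S : R -> blin W W) (hS : C0_semigroup S).
Notation A := (generator S).

Lemma iter_gen_le_graph n (x : dom S n) j : (j <= n)%N ->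
  `|iter j A (dom_val x)| <= `|x|.
Proof.
move=> jn; rewrite [leRHS]/Num.norm /= /graph_norm.
case: j jn => [_|j jn]; first by rewrite lerDl sumr_ge0.
rewrite (bigD1_seq j.+1) ?mem_index_iota ?iota_uniq//= addrCA lerDl.
by rewrite addr_ge0 ?sumr_ge0.
Qed.

Lemma graph_norm_le n (x : dom S n) (c : R) :
  (forall j, (j <= n)%N -> `|iter j A (dom_val x)| <= c) -> `|x| <= n.+1%:R * c.
Proof.
move=> H; rewrite [leLHS]/Num.norm /= /graph_norm -natr1 mulrDl mul1r addrC.
apply: lerD; last exact: (H 0%N).
apply: (@le_trans _ _ (\sum_(1 <= j < n.+1) c)).
  by rewrite !big_nat; apply: ler_sum => j /andP[_ jn]; apply: H.
by rewrite sumr_const_nat subn1 mulr_natl.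
Qed.

Lemma iter_genB n (x y : dom S n) j : (j <= n)%N ->
  iter j A (dom_val (x - y)) = iter j A (dom_val x) - iter j A (dom_val y).
Proof.
move=> jn; have := iter_generator_linear (-1) y x jn.
by rewrite !scaleN1r addrC [RHS]addrC.
Qed.

Lemma domn_gendom n j (x : W) : domn S n x -> (j < n)%N ->
  gendom S (iter j A x).
Proof.
elim: n => // m IH [/= xm gx]; rewrite ltnS leq_eqVlt => /predU1P[->//|].
exact: IH.
Qed.

(** Each iterate of the generator converges separately in [W]; closedness identifies these limits
    with the iterates applied to the first one. *)
Lemma dom_complete n (F : set_system (dom S n)) : ProperFilter F ->
  cauchy F -> cvg F.
Proof.
move=> FF /cauchy_ballP cF.
have /choice[y Hy] : forall j, exists y : W, (j <= n)%N -> forall eps : R,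
    0 < eps -> F [set x | `|iter j A (dom_val x) - y| <= eps].
  move=> j; have [jn|_] := boolP (j <= n)%N; last by exists 0.
  pose phi (x : dom S n) := iter j A (dom_val x).
  have cphi : cvg (phi @ F).
    apply: cauchy_cvg; apply/cauchy_ballP => e e0.
    have := cF _ e0; rewrite near_simpl => -[[P Q] /= [FP FQ] PQ].
    exists (phi @` P, phi @` Q) => /=.
      by split; [apply: filterS FP | apply: filterS FQ] => x Px; exists x.
    move=> [_ _] /= [[x Px <-] [x' Qx' <-]].
    have /= := PQ (x, x') (conj Px Qx').
    rewrite -!ball_normE /= => /(le_lt_trans _); apply.
    by rewrite /phi -iter_genB// iter_gen_le_graph.
  exists (lim (phi @ F)) => _ e e0.
  by have /cvgrPdist_le /(_ _ e0) := cphi; apply: filterS => x; rewrite distrC.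
have yS j : (j < n)%N -> gendom S (y j) /\ A (y j) = y j.+1.
  move=> jn; apply: generator_closed => // e e0.
  have [x [/= x1 x2]] := filter_ex (filterI (Hy j (ltnW jn) _ e0) (Hy j.+1 jn _ e0)).
  exists (iter j A (dom_val x)); split => //.
  by apply: domn_gendom jn; apply/set_mem/dom_valP.
have yE j : (j <= n)%N -> iter j A (y 0%N) = y j.
  elim: j => // j IH jn; rewrite iterS IH ?(ltnW jn)//.
  by have [_ ->] := yS j jn.
have y0 m : (m <= n)%N -> domn S m (y 0%N).
  elim: m => // m IH mn; split; first by apply: IH; exact: ltnW.
  by rewrite /= yE ?(ltnW mn)//; have [] := yS m mn.
pose l : dom S n := Dom (mem_set (y0 n (leqnn n))).
apply/cvg_ex; exists l; apply/cvgrPdist_le => e e0.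
have k0 : 0 < e / n.+1%:R by rewrite divr_gt0// ltr0n.
have : \forall x \near F, forall j : 'I_n.+1,
    `|iter j A (dom_val x) - y j| <= e / n.+1%:R.
  by apply: filter_forall => j; apply: Hy => //; rewrite -ltnS.
apply: filterS => x Hx.
have -> : e = n.+1%:R * (e / n.+1%:R) by rewrite mulrC divfK// pnatr_eq0.
apply: graph_norm_le => j jn; rewrite iter_genB// distrC.
have -> : iter j A (dom_val l) = y j by exact: yE.
by have := Hx (Ordinal (jn : (j < n.+1)%N)).
Qed.

(** Completeness rests on closedness of the generator, hence on [hS]; so it is packed here instead
    of being attached to [dom S n] itself. *)
Definition domC n : completeNormedModType R :=
  HB.pack (dom S n) (Uniform_isComplete.Build (dom S n) (@dom_complete n)).

Lemma blin_of_bound (U V : normedModType R) (f : U -> V) (c : R) :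
  linear f -> (forall x, `|f x| <= c * `|x|) ->
  exists2 L : blin U V, (L : U -> V) = f & `|L| <= `|c|.
Proof.
move=> lf fc.
pose g : {linear U -> V} := HB.pack f (GRing.isLinear.Build _ _ _ _ _ lf).
have fc' x : `|f x| <= `|c| * `|x|.
  by rewrite (le_trans (fc x))// ler_wpM2r// ler_norm.
have cf : f \in lin_cont U V.
  rewrite inE; split => //; apply: (@bounded_linear_continuous _ _ _ g).
  apply/linear_boundedP; near=> r => x; rewrite (le_trans (fc' x))// ler_wpM2r//.
exists (Blin cf) => //; exact: blin_norm_lub.
Unshelve. all: by end_near. Qed.

Lemma domn_gen n (x : W) : domn S n.+1 x -> domn S n (A x).
Proof.
elim: n => // n IH [/= xn gx]; split; first exact: IH.
by rewrite /= -iterSr.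
Qed.

Lemma dom_gen n : exists L : blin (dom S n.+1) (dom S n),
  forall y, dom_val (L y) = A (dom_val y).
Proof.
pose f (y : dom S n.+1) : dom S n :=
  Dom (mem_set (domn_gen (set_mem (dom_valP y)))).
have [||L LE _] := @blin_of_bound (dom S n.+1) (dom S n) f n.+1%:R.
- move=> a x y; apply: val_inj => /=.
  exact: (@iter_generator_linear _ _ S n.+1 1 a x y isT).
- move=> x; apply: graph_norm_le => j jn /=.
  by rewrite -iterSr; exact: iter_gen_le_graph.
- by exists L => y; rewrite LE.
Qed.

Lemma dom_semi n : exists S' : R -> blin (dom S n) (dom S n),
  forall t y, 0 <= t -> dom_val (S' t y) = S t (dom_val y).
Proof.
suff H t : exists L : blin (dom S n) (dom S n),
    0 <= t -> forall y, dom_val (L y) = S t (dom_val y).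
  have [S' HS'] := choice H; exists S' => t y t0; exact: HS'.
(* [S] is a semigroup for nonnegative times only; elsewhere the default is the zero operator. *)
have [t0|_] := boolP (0 <= t); last by exists 0.
have HD m (x : W) : domn S m x -> domn S m (S t x) /\
    forall j, (j <= m)%N -> iter j A (S t x) = S t (iter j A x).
  elim: m => [_|m IH [/= xm gx]]; first by split => // -[].
  have [D1 D2] := IH xm; have [g1 g2] := gendom_semi hS t0 gx.
  split; first by split => //=; rewrite D2.
  move=> j; rewrite leq_eqVlt => /predU1P[->|]; last exact: D2.
  by rewrite !iterS D2.
pose f (y : dom S n) : dom S n := Dom (mem_set (HD n _ (set_mem (dom_valP y))).1).
have [||L LE _] := @blin_of_bound (dom S n) (dom S n) f (n.+1%:R * `|S t|).
- by move=> a x y; apply: val_inj; exact: (blin_linear (S t) a (dom_val x) (dom_val y)).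
- move=> x; rewrite -mulrA; apply: graph_norm_le => j jn /=.
  rewrite (HD n _ (set_mem (dom_valP x))).2//.
  by apply: blin_norm_le => //; exact: iter_gen_le_graph.
- by exists L => _ y; rewrite LE.
Qed.

Lemma dom_semi_C0 n (S' : R -> blin (dom S n) (dom S n)) :
  (forall t y, 0 <= t -> dom_val (S' t y) = S t (dom_val y)) ->
  C0_semigroup S'.
Proof.
move=> HS'.
have HI j y t : (j <= n)%N -> 0 <= t ->
    iter j A (dom_val (S' t y)) = S t (iter j A (dom_val y)).
  elim: j => [_ t0|j IH jn t0]; first exact: HS'.
  rewrite !iterS IH ?(ltnW jn)//.
  have gx : gendom S (iter j A (dom_val y)).
    by apply: domn_gendom jn; apply/set_mem/dom_valP.
  by have [_ ->] := gendom_semi hS t0 gx.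
split.
- by move=> x; apply: val_inj; rewrite /= HS'// semi0.
- move=> s t x s0 t0; apply: val_inj => /=.
  by rewrite !HS'// ?addr_ge0// semiD.
move=> x; apply/cvgrPdist_le => e e0.
have k0 : 0 < e / n.+1%:R by rewrite divr_gt0// ltr0n.
have : \forall h \near 0^'+, forall j : 'I_n.+1,
    `|S h (iter j A (dom_val x)) - iter j A (dom_val x)| <= e / n.+1%:R.
  apply: filter_forall => j; have [_ _ H] := hS.
  have /cvgrPdist_le /(_ _ k0) := H (iter j A (dom_val x)).
  by apply: filterS => h; rewrite distrC.
have : \forall h \near 0^'+, (0 : R) < h by exact: nbhs_right_gt.
apply: filterS2 => h h0 Hh.
have -> : e = n.+1%:R * (e / n.+1%:R) by rewrite mulrC divfK// pnatr_eq0.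
apply: graph_norm_le => j jn; rewrite iter_genB// distrC (HI _ _ _ jn (ltW h0)).
by have := Hh (Ordinal (jn : (j < n.+1)%N)).
Qed.

End domains.

(** * Rough estimates *)

Section composition_bounds.
Context {R : realType} {U V W : normedModType R}.

Lemma blin_comp_norm (g : blin V W) (f : blin U V) :
  `|blin_comp g f| <= `|g| * `|f|.
Proof.
apply: blin_norm_lub => [|x]; first exact: mulr_ge0.
by rewrite -mulrA; exact: (@blin_norm_le _ _ _ g (f x) _ _ (lexx _) (blin_norm_ub f x)).
Qed.

Lemma blin_compBl (g g' : blin V W) (f : blin U V) :
  blin_comp (g - g') f = blin_comp g f - blin_comp g' f.
Proof. exact: blin_eqP. Qed.

Lemma blin_compBr (g : blin V W) (f f' : blin U V) :
  blin_comp g (f - f') = blin_comp g f - blin_comp g f'.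
Proof. by apply: blin_eqP => x; exact: blinBr. Qed.

Lemma blin_comp_dist (g g' : blin V W) (f f' : blin U V) (a b c d : R) :
  `|g - g'| <= a -> `|f| <= b -> `|g'| <= c -> `|f - f'| <= d ->
  `|blin_comp g f - blin_comp g' f'| <= a * b + c * d.
Proof.
move=> ga fb gc fd.
have -> : blin_comp g f - blin_comp g' f' =
    blin_comp (g - g') f + blin_comp g' (f - f').
  by rewrite blin_compBl blin_compBr; zmodule.
rewrite (le_trans (ler_normD _ _))// lerD//.
  by rewrite (le_trans (blin_comp_norm _ _))// ler_pM.
by rewrite (le_trans (blin_comp_norm _ _))// ler_pM.
Qed.

Lemma blin_app_dist (g g' : blin V W) x x' (a b c d : R) :
  `|g - g'| <= a -> `|x| <= b -> `|g'| <= c -> `|x - x'| <= d ->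
  `|g x - g' x'| <= a * b + c * d.
Proof.
move=> ga fb gc fd.
have -> : g x - g' x' = (g - g') x + g' (x - x').
  by rewrite blinB blinBr; zmodule.
by rewrite (le_trans (ler_normD _ _))// lerD// blin_norm_le.
Qed.

End composition_bounds.

(** * Operators on the tensor product *)

Section tensor_facts.
Context {R : realType} {V : completeNormedModType R} (VV : tensor V).

(** By density of the span of elementary tensors. Linearity and naturality of [tlift] in its
    operator argument are read off from it. *)
Lemma tensor_ext (F : normedModType R) (L L' : blin VV F) :
  (forall x y, L (tmul VV x y) = L' (tmul VV x y)) -> L = L'.
Proof.
move=> H; apply: blin_eqP => z; apply/eqP; rewrite -subr_eq0 -normr_le0.
apply/ler_addgt0Pl => e e0; rewrite addr0.
have k0 : 0 < `|L - L'| + 1 by rewrite ltr_wpDl.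
have [|s Hs] := tmul_dense z (_ : 0 < e / (`|L - L'| + 1)).
  by rewrite divr_gt0.
have E : (L - L') (\sum_(p <- s) tmul VV p.1 p.2) = 0.
  rewrite linear_sum big1// => p _.
  by rewrite -[LHS]/(L _ - L' _) H subrr.
have -> : L z - L' z = (L - L') (z - \sum_(p <- s) tmul VV p.1 p.2).
  by rewrite blinBr E subr0.
apply: (le_trans (blin_norm_le (lexx _) (ltW Hs))).
by rewrite mulrCA ger_pMr// ler_pdivrMr// mul1r lerDl.
Qed.

Lemma tliftB (F : completeNormedModType R) (B B' : blin V (blin V F)) :
  tlift VV (B - B') = tlift VV B - tlift VV B'.
Proof. by apply: tensor_ext => x y; rewrite blinB !tlift_tmul. Qed.

(** Continuous operators can be pulled out of the second-order term; thus the mild germ is the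
    semigroup applied to the usual germ. *)
Lemma tlift_comp (F G : completeNormedModType R) (L : blin F G)
    (B : blin V (blin V F)) z :
  tlift VV (blin_comp (postcomp V L) B) z = L (tlift VV B z).
Proof.
suff -> : tlift VV (blin_comp (postcomp V L) B) = blin_comp L (tlift VV B) by [].
by apply: tensor_ext => x y; rewrite tlift_tmul /= tlift_tmul.
Qed.

Lemma tlift_bound (F : completeNormedModType R) : exists2 C : R, 0 <= C &
  forall (B : blin V (blin V F)) z, `|tlift VV B z| <= C * `|B| * `|z|.
Proof.
have [C HC] := tlift_bounded VV F; exists `|C| => // B z.
apply: blin_norm_le => //; rewrite (le_trans (HC B))// ler_wpM2r//.
exact: ler_norm.
Qed.

End tensor_facts.

(** * The germ of the rough integral and its defect *)

Section germ.
Context {R : realType} {V W D : completeNormedModType R} (VV : tensor V).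
Context (T beta : R) (X : R -> V) (XX : R -> R -> VV).
Context (f : R -> W -> blin V D) (df : R -> W -> blin W (blin V D)).

Definition gderiv (Y : R -> W) (Y' : R -> blin V W) (s : R) : blin V (blin V D) :=
  blin_comp (df s (Y s)) (Y' s).

Definition germ (Y : R -> W) (Y' : R -> blin V W) (s t : R) : D :=
  f s (Y s) (X t - X s) + tlift VV (gderiv Y Y' s) (XX s t).

Definition remainder (Y : R -> W) (Y' : R -> blin V W) (s t : R) : W :=
  Y t - Y s - Y' s (X t - X s).

(** The remainder of the controlled path [f(Y)] with Gubinelli derivative [gderiv Y Y']. *)
Definition gremainder (Y : R -> W) (Y' : R -> blin V W) (s u : R) : blin V D :=
  f u (Y u) - f s (Y s) - df s (Y s) (Y' s (X u - X s)).

Context (Cx Cf Cl : R) (hbeta : 0 < beta).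
Context (Cx0 : 0 <= Cx) (Cl0 : 0 <= Cl).
Context (hX : forall s t, 0 <= s -> s <= t -> t <= T ->
  `|X t - X s| <= Cx * (t - s) `^ beta).
Context (hXX : forall s t, 0 <= s -> s <= t -> t <= T ->
  `|XX s t| <= Cx * (t - s) `^ (2 * beta)).
Context (chen : forall s u t, 0 <= s -> s <= u -> u <= t -> t <= T ->
  XX s t - XX s u - XX u t = tmul VV (X u - X s) (X t - X u)).
Context (hl : forall (B : blin V (blin V D)) z,
  `|tlift VV B z| <= Cl * `|B| * `|z|).
Context (hf : Taylor_bounds T (2 * beta) Cf f df).

Let Cf0 : 0 <= Cf. Proof. exact: tb_ge0 hf. Qed.

Lemma powR_double (x : R) : x `^ (2 * beta) = (x `^ beta) ^+ 2.
Proof. by rewrite mulrC powRrM powR_mulrn ?powR_ge0. Qed.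

Lemma powR_triple (x : R) : x `^ (3 * beta) = (x `^ beta) ^+ 3.
Proof. by rewrite mulrC powRrM powR_mulrn ?powR_ge0. Qed.

Lemma powR_le1 (x : R) : 0 <= x -> x <= 1 -> x `^ beta <= 1.
Proof.
move=> x0 x1; have -> : (1 : R) = 1 `^ beta by rewrite powR1.
by apply: ge0_ler_powR; rewrite ?nnegrE// ltW.
Qed.

Lemma powR_mono (x y : R) : 0 <= x -> x <= y -> x `^ beta <= y `^ beta.
Proof.
move=> x0 xy; have y0 := le_trans x0 xy.
by apply: ge0_ler_powR; rewrite ?nnegrE// ltW.
Qed.

Lemma XX_diag s : 0 <= s -> s <= T -> XX s s = 0.
Proof.
move=> s0 sT; apply/eqP; rewrite -normr_le0 (le_trans (hXX _ _ _))//.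
by rewrite subrr powR0 ?mulr0// gt_eqF// mulr_gt0.
Qed.

Lemma germ_diag Y Y' s : 0 <= s -> s <= T -> germ Y Y' s s = 0.
Proof. by move=> s0 sT; rewrite /germ subrr !linear0 XX_diag// linear0 addr0. Qed.

(** Chen's relation produces an elementary tensor, on which [tlift] evaluates to the first-order
    term of [f(Y)]; it completes the increment of [f(Y)] to its remainder. *)
Lemma germ_delta Y Y' s u t : 0 <= s -> s <= u -> u <= t -> t <= T ->
  germ Y Y' s t - germ Y Y' s u - germ Y Y' u t =
  - gremainder Y Y' s u (X t - X u) -
    tlift VV (gderiv Y Y' u - gderiv Y Y' s) (XX u t).
Proof.
move=> s0 su ut tT; rewrite tliftB !blinB /germ.
have -> : tlift VV (gderiv Y Y' s) (XX s t) =
  tlift VV (gderiv Y Y' s) (XX s u) + tlift VV (gderiv Y Y' s) (XX u t) +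
  df s (Y s) (Y' s (X u - X s)) (X t - X u).
  rewrite -[df s _ _ _]/(gderiv Y Y' s (X u - X s) (X t - X u)) -(tlift_tmul VV).
  by rewrite -(chen s0 su ut tT) !blinBr; zmodule.
have -> : X t - X s = (X u - X s) + (X t - X u) by zmodule.
by rewrite blinDr; zmodule.
Qed.

(** Both terms of the defect have order [3 * beta]: a remainder of order [2 * beta] against [X], and
    a derivative increment of order [beta] against [XX]. *)
Let pre_bound (s u t : R) (g : blin V D) (p : blin V (blin V D)) (kG kP : R) :
  0 <= s -> s <= u -> u <= t -> t <= T -> 0 <= kG -> 0 <= kP ->
  `|g| <= kG * (u - s) `^ beta ^+ 2 -> `|p| <= kP * (u - s) `^ beta ->
  `|- g (X t - X u) - tlift VV p (XX u t)| <=
    (kG + Cl * kP) * Cx * (t - s) `^ (3 * beta).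
Proof.
move=> s0 su ut tT kG0 kP0 hg hp.
have u0 := le_trans s0 su.
have ac : (u - s) `^ beta <= (t - s) `^ beta by apply: powR_mono; lra.
have bc : (t - u) `^ beta <= (t - s) `^ beta by apply: powR_mono; lra.
have hx := hX u0 ut tT.
have hxx := hXX u0 ut tT.
rewrite powR_double in hxx; rewrite powR_triple.
have := powR_ge0 (u - s) beta; have := powR_ge0 (t - u) beta.
move: ac bc hx hxx hg hp.
set a := (u - s) `^ beta; set b := (t - u) `^ beta; set c := (t - s) `^ beta.
move=> ac bc hx hxx hg hp b0 a0; have c0 := le_trans a0 ac.
have h1 : `|g (X t - X u)| <= kG * a ^+ 2 * (Cx * b) by exact: blin_norm_le.
have h2 : `|tlift VV p (XX u t)| <= Cl * (kP * a) * (Cx * b ^+ 2).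
  apply: (le_trans (hl _ _)); apply: ler_pM => //; first exact: mulr_ge0.
  exact: ler_wpM2l.
have h3 : kG * a ^+ 2 * (Cx * b) <= kG * Cx * c ^+ 3.
  have -> : kG * a ^+ 2 * (Cx * b) = kG * Cx * (a ^+ 2 * b) by ring.
  apply: ler_wpM2l; first exact: mulr_ge0.
  by rewrite [c ^+ 3]exprSr; apply: ler_pM => //; rewrite ?sqr_ge0// lerXn2r ?nnegrE.
have h4 : Cl * (kP * a) * (Cx * b ^+ 2) <= Cl * kP * Cx * c ^+ 3.
  have -> : Cl * (kP * a) * (Cx * b ^+ 2) = Cl * kP * Cx * (a * b ^+ 2) by ring.
  apply: ler_wpM2l; first by rewrite !mulr_ge0.
  by rewrite [c ^+ 3]exprS; apply: ler_pM => //; rewrite ?sqr_ge0// lerXn2r ?nnegrE.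
rewrite (le_trans (ler_normB _ _))// normrN.
by rewrite !mulrDl lerD// (le_trans h1, le_trans h2).
Qed.

Lemma remainder_incr (Y : R -> W) (Y' : R -> blin V W) s u :
  Y u = Y s + Y' s (X u - X s) + remainder Y Y' s u.
Proof. by rewrite /remainder; zmodule. Qed.

(* Linear in [r] and [q]: the Taylor expansion is only used along [Y' X], the
   remainder being absorbed by the Lipschitz bound. *)
Lemma germ_growth (M : R) : 0 <= M -> exists2 C : R, 0 <= C &
  forall (Y : R -> W) (Y' : R -> blin V W) s u t (r q : R), 0 <= s -> s <= u -> u <= t -> t <= T ->
    t - s <= 1 -> 0 <= r -> 0 <= q -> `|Y' s| <= M -> `|Y' u| <= M ->
    `|remainder Y Y' s u| <= r * (u - s) `^ (2 * beta) ->
    `|Y' u - Y' s| <= q * (u - s) `^ beta ->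
    `|germ Y Y' s t - germ Y Y' s u - germ Y Y' u t| <=
      C * (1 + r + q) * (t - s) `^ (3 * beta).
Proof.
move=> M0.
(* [k] and [l] are the coefficients, relative to [1 + r + q], in the bounds for the remainder of
   [f(Y)] and for the increment of its Gubinelli derivative. *)
pose k := Cf * (1 + (M * Cx) ^+ 2).
pose l := Cf * (1 + M + M * (M * Cx)).
have k0 : 0 <= k by rewrite mulr_ge0// addr_ge0// sqr_ge0.
have l0 : 0 <= l by rewrite mulr_ge0// !addr_ge0// !mulr_ge0.
exists ((k + Cl * l) * Cx); first by rewrite mulr_ge0// addr_ge0// mulr_ge0.
move=> Y Y' s u t r q s0 su ut tT ts1 r0 q0 Ms Mu hR hq.
have u0 := le_trans s0 su; have uT := le_trans ut tT.
have sT : 0 <= s <= T by rewrite s0 (le_trans su).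
have uT' : 0 <= u <= T by rewrite u0.
have kr0 : 0 <= k * (1 + r + q) by rewrite mulr_ge0// !addr_ge0.
have lr0 : 0 <= l * (1 + r + q) by rewrite mulr_ge0// !addr_ge0.
rewrite germ_delta//.
have -> : (k + Cl * l) * Cx * (1 + r + q) =
  (k * (1 + r + q) + Cl * (l * (1 + r + q))) * Cx by ring.
have a1 : (u - s) `^ beta <= 1.
  by apply: powR_le1; rewrite ?subr_ge0// (le_trans _ ts1)// lerD2r.
have hx := hX s0 su uT.
have := powR_ge0 (u - s) beta.
have ft := tb_f_time hf (Y u) s0 su uT.
have dft := tb_df_time hf (Y u) s0 su uT.
rewrite powR_double in hR ft dft.
move: a1 hx hR hq ft dft => a1 hx hR hq ft dft a0.
set a := (u - s) `^ beta in a1 hx hR hq ft dft a0.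
have a20 : 0 <= a ^+ 2 by rewrite sqr_ge0.
have a2a : a ^+ 2 <= a by rewrite expr2 ler_piMl.
set z1 := Y' s (X u - X s).
have hz1 : `|z1| <= M * (Cx * a) by exact: blin_norm_le.
have hz : `|Y u - Y s| <= (M * Cx + r) * a.
  have -> : Y u - Y s = z1 + remainder Y Y' s u.
    by rewrite {1}(remainder_incr Y Y' s u) -/z1; zmodule.
  rewrite (le_trans (ler_normD _ _))// mulrDl lerD//; first by rewrite -mulrA.
  by rewrite (le_trans hR)// ler_wpM2l.
apply: pre_bound => //.
- have -> : gremainder Y Y' s u = (f u (Y u) - f s (Y u)) +
    (f s (Y u) - f s (Y s + z1)) + (f s (Y s + z1) - f s (Y s) - df s (Y s) z1).
    by rewrite /gremainder -/z1; zmodule.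
  have h2 : `|f s (Y u) - f s (Y s + z1)| <= Cf * (r * a ^+ 2).
    rewrite (le_trans (tb_f_lip hf _ _ sT))// ler_wpM2l//.
    by rewrite {1}(remainder_incr Y Y' s u) -/z1 addrC addKr.
  have h3 : `|f s (Y s + z1) - f s (Y s) - df s (Y s) z1| <=
      Cf * (M * (Cx * a)) ^+ 2.
    rewrite (le_trans (tb_taylor hf _ _ sT))// ler_wpM2l//.
    by rewrite lerXn2r ?nnegrE// mulr_ge0// mulr_ge0.
  rewrite (le_trans (ler_normD _ _))// (le_trans (lerD (ler_normD _ _) h3))//.
  apply: (le_trans (lerD (lerD ft h2) (lexx _))).
  rewrite -/a -subr_ge0 /k.
  set m := (_ ^+ 2 : R) in k0 *.
  have -> : (M * (Cx * a)) ^+ 2 = m * a ^+ 2 by rewrite /m; ring.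
  have -> : Cf * (1 + m) * (1 + r + q) * a ^+ 2 -
     (Cf * a ^+ 2 + Cf * (r * a ^+ 2) + Cf * (m * a ^+ 2)) =
     Cf * (q + m * (r + q)) * a ^+ 2 by ring.
  by rewrite !mulr_ge0// addr_ge0// mulr_ge0 ?sqr_ge0// addr_ge0.
have -> : gderiv Y Y' u - gderiv Y Y' s =
  blin_comp (df u (Y u) - df s (Y u)) (Y' u) +
  blin_comp (df s (Y u) - df s (Y s)) (Y' u) +
  blin_comp (df s (Y s)) (Y' u - Y' s).
  by rewrite !blin_compBl blin_compBr /gderiv; zmodule.
have h1 : `|blin_comp (df u (Y u) - df s (Y u)) (Y' u)| <= Cf * a ^+ 2 * M.
  by rewrite (le_trans (blin_comp_norm _ _))// ler_pM.
have h2 : `|blin_comp (df s (Y u) - df s (Y s)) (Y' u)| <=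
    Cf * ((M * Cx + r) * a) * M.
  rewrite (le_trans (blin_comp_norm _ _))// ler_pM//.
  by rewrite (le_trans (tb_df_lip hf _ _ sT))// ler_wpM2l.
have h3 : `|blin_comp (df s (Y s)) (Y' u - Y' s)| <= Cf * (q * a).
  by rewrite (le_trans (blin_comp_norm _ _))// ler_pM// (tb_df hf).
rewrite (le_trans (ler_normD _ _))//.
apply: (le_trans (lerD (le_trans (ler_normD _ _) (lerD h1 h2)) h3)).
have h4 : Cf * a ^+ 2 * M <= Cf * a * M by rewrite ler_wpM2r// ler_wpM2l.
apply: (le_trans (lerD (lerD h4 (lexx _)) (lexx _))).
rewrite -/a -subr_ge0 /l.
have -> : Cf * (1 + M + M * (M * Cx)) * (1 + r + q) * a -
  (Cf * a * M + Cf * ((M * Cx + r) * a) * M + Cf * (q * a)) =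
  Cf * a * (1 + r + M * q + M * M * Cx * (r + q)) by ring.
by rewrite !(mulr_ge0, addr_ge0).
Qed.

(** Here [K] already bounds both pairs, so the expansions run along the full increments and
    quadratic terms are harmless; each difference of products is split so that every summand keeps
    one factor [d]. *)
Lemma germ_difference (K : R) : 0 <= K -> exists2 C : R, 0 <= C &
  forall (Y : R -> W) (Y' : R -> blin V W) (Z : R -> W) (Z' : R -> blin V W)
      s u t (d : R), 0 <= s -> s <= u -> u <= t -> t <= T ->
    t - s <= 1 -> 0 <= d ->
    `|Y' u| <= K -> `|Z' s| <= K -> `|Y' u - Y' s| <= K * (u - s) `^ beta ->
    `|Y' s| <= K -> `|Z' u - Z' s| <= K * (u - s) `^ beta ->
    `|remainder Y Y' s u| <= K * (u - s) `^ (2 * beta) ->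
    `|remainder Z Z' s u| <= K * (u - s) `^ (2 * beta) ->
    `|Y s - Z s| <= d -> `|Y u - Z u| <= d ->
    `|Y' s - Z' s| <= d -> `|Y' u - Z' u| <= d ->
    `|(Y' u - Y' s) - (Z' u - Z' s)| <= d * (u - s) `^ beta ->
    `|remainder Y Y' s u - remainder Z Z' s u| <= d * (u - s) `^ (2 * beta) ->
    `|(germ Y Y' s t - germ Y Y' s u - germ Y Y' u t) -
      (germ Z Z' s t - germ Z Z' s u - germ Z Z' u t)| <=
      C * d * (t - s) `^ (3 * beta).
Proof.
move=> K0.
(* An increment is [Y' X] plus a remainder, whence the factor [Cx + 1]: increments are bounded by
   [k], and their differences by [c1 * d], per unit of [(u - s)] to the power [beta]. *)
pose c1 := Cx + 1; have c10 : 0 <= c1 by rewrite addr_ge0.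
pose k := K * c1; have k0 : 0 <= k by rewrite mulr_ge0.
pose kG := Cf * (2 + K + k ^+ 2 + (2 * k + k ^+ 2) * c1).
pose kP := Cf * (2 + 2 * K + K * (k + (1 + k) * c1) + k).
have kG0 : 0 <= kG by rewrite mulr_ge0// !addr_ge0// ?mulr_ge0// ?addr_ge0// ?sqr_ge0// mulr_ge0.
have kP0 : 0 <= kP by rewrite mulr_ge0// !addr_ge0// ?mulr_ge0// ?addr_ge0// mulr_ge0// addr_ge0.
exists ((kG + Cl * kP) * Cx); first by rewrite mulr_ge0// addr_ge0// mulr_ge0.
move=> Y Y' Z Z' s u t d s0 su ut tT ts1 d0 KYu KZs KYi KYs KZi rY rZ ds du ds' du' di dR.
have u0 := le_trans s0 su; have uT := le_trans ut tT.
have sT : 0 <= s <= T by rewrite s0 (le_trans su).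
have uT' : 0 <= u <= T by rewrite u0.
rewrite !germ_delta//.
set gY := gremainder Y Y' s u; set gZ := gremainder Z Z' s u.
set pY := gderiv Y Y' u - gderiv Y Y' s; set pZ := gderiv Z Z' u - gderiv Z Z' s.
have -> : - gY (X t - X u) - tlift VV pY (XX u t) -
    (- gZ (X t - X u) - tlift VV pZ (XX u t)) =
    - (gY - gZ) (X t - X u) - tlift VV (pY - pZ) (XX u t).
  by rewrite tliftB !blinB; zmodule.
have -> : (kG + Cl * kP) * Cx * d = (kG * d + Cl * (kP * d)) * Cx by ring.
have a1 : (u - s) `^ beta <= 1.
  by apply: powR_le1; rewrite ?subr_ge0// (le_trans _ ts1)// lerD2r.
have hx := hX s0 su uT.
have := powR_ge0 (u - s) beta.
have fm := tb_f_mix hf (Y u) (Z u) s0 su uT.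
have dfm := tb_df_mix hf (Y u) (Z u) s0 su uT.
have dft := tb_df_time hf (Z u) s0 su uT.
rewrite powR_double in rY rZ dR fm dfm dft.
move=> a0; suff [hG hP] : `|gY - gZ| <= kG * d * (u - s) `^ beta ^+ 2 /\
    `|pY - pZ| <= kP * d * (u - s) `^ beta.
  by apply: pre_bound => //; exact: mulr_ge0.
set a := (u - s) `^ beta in a1 hx KYi KZi di rY rZ dR fm dfm dft a0 *.
have a20 : 0 <= a ^+ 2 by rewrite sqr_ge0.
have a2a : a ^+ 2 <= a by rewrite expr2 ler_piMl.
pose zY := Y u - Y s; pose zZ := Z u - Z s.
have EY : Y u = Y s + zY by rewrite /zY; zmodule.
have EZ : Z u = Z s + zZ by rewrite /zZ; zmodule.
have zYE : zY = Y' s (X u - X s) + remainder Y Y' s u.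
  by rewrite /zY /remainder; zmodule.
have zZE : zZ = Z' s (X u - X s) + remainder Z Z' s u.
  by rewrite /zZ /remainder; zmodule.
have hk (c : R) (y : W) (y' : blin V W) : 0 <= c -> `|y'| <= c ->
    `|y| <= c * a ^+ 2 -> `|y' (X u - X s) + y| <= c * c1 * a.
  move=> c0 hy' hy; rewrite (le_trans (ler_normD _ _))//.
  have -> : c * c1 * a = c * (Cx * a) + c * a by rewrite /c1; ring.
  apply: lerD; first exact: blin_norm_le.
  by rewrite (le_trans hy)// ler_wpM2l.
have hzY : `|zY| <= k * a by rewrite zYE; exact: hk.
have hzZ : `|zZ| <= k * a by rewrite zZE; exact: hk.
have hz : `|zY - zZ| <= c1 * d * a.
  have -> : zY - zZ = (Y' s - Z' s) (X u - X s) +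
      (remainder Y Y' s u - remainder Z Z' s u).
    by rewrite zYE zZE blinB; zmodule.
  by rewrite [c1 * d]mulrC; exact: hk.
split.
- have gE (U : R -> W) (U' : R -> blin V W) (zU : W) : zU = U' s (X u - X s) + remainder U U' s u ->
      U u = U s + zU -> gremainder U U' s u = (f u (U u) - f s (U u)) +
      (f s (U s + zU) - f s (U s) - df s (U s) zU) + df s (U s) (remainder U U' s u).
    by move=> E1 E2; rewrite /gremainder -E2 E1 blinDr; zmodule.
  rewrite /gY /gZ (gE Y Y' zY zYE EY) (gE Z Z' zZ zZE EZ).
  rewrite (_ : _ - _ = ((f u (Y u) - f s (Y u)) - (f u (Z u) - f s (Z u))) +
    ((f s (Y s + zY) - f s (Y s) - df s (Y s) zY) -
     (f s (Z s + zZ) - f s (Z s) - df s (Z s) zZ)) +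
    (df s (Y s) (remainder Y Y' s u) - df s (Z s) (remainder Z Z' s u)));
    last by zmodule.
  have h1 : `|(f u (Y u) - f s (Y u)) - (f u (Z u) - f s (Z u))| <= Cf * a ^+ 2 * d.
    by rewrite (le_trans fm)// ler_wpM2l// mulr_ge0.
  have h3 : `|df s (Y s) (remainder Y Y' s u) - df s (Z s) (remainder Z Z' s u)| <=
      Cf * d * (K * a ^+ 2) + Cf * (d * a ^+ 2).
    apply: blin_app_dist => //; last exact: (tb_df hf _ sT).
    by rewrite (le_trans (tb_df_lip hf _ _ sT))// ler_wpM2l.
  have h2 := tb_taylorB hf (Y s) zY (Z s) zZ sT.
  have h2' : `|zY| ^+ 2 * `|Y s - Z s| +
      (`|zY| + `|zY| ^+ 2 + `|zZ|) * `|zY - zZ| <=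
      (k * a) ^+ 2 * d + (k * a + (k * a) ^+ 2 + k * a) * (c1 * d * a).
    have ka0 : 0 <= k * a by exact: mulr_ge0.
    have zk : `|zY| ^+ 2 <= (k * a) ^+ 2 by rewrite lerXn2r ?nnegrE.
    by rewrite lerD// ler_pM ?sqr_ge0// ?addr_ge0 ?sqr_ge0// !lerD.
  rewrite (le_trans (ler_normD _ _))//.
  apply: (le_trans (lerD (le_trans (ler_normD _ _)
    (lerD h1 (le_trans h2 (ler_wpM2l Cf0 h2')))) h3)).
  rewrite -subr_ge0 /kG.
  rewrite (_ : _ - _ = Cf * (k ^+ 2 * c1 * d) * (a ^+ 2 * (1 - a))); last by ring.
  by rewrite !mulr_ge0// ?sqr_ge0// subr_ge0.
have pE (U : R -> W) (U' : R -> blin V W) : gderiv U U' u - gderiv U U' s =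
  blin_comp (df u (U u) - df s (U u)) (U' u) +
  blin_comp (df s (U u) - df s (U s)) (U' u) +
  blin_comp (df s (U s)) (U' u - U' s).
  by rewrite !blin_compBl blin_compBr /gderiv; zmodule.
rewrite /pY /pZ !pE.
rewrite (_ : _ - _ =
  (blin_comp (df u (Y u) - df s (Y u)) (Y' u) -
   blin_comp (df u (Z u) - df s (Z u)) (Z' u)) +
  (blin_comp (df s (Y u) - df s (Y s)) (Y' u) -
   blin_comp (df s (Z u) - df s (Z s)) (Z' u)) +
  (blin_comp (df s (Y s)) (Y' u - Y' s) - blin_comp (df s (Z s)) (Z' u - Z' s)));
  last by zmodule.
have h1 : `|blin_comp (df u (Y u) - df s (Y u)) (Y' u) -
    blin_comp (df u (Z u) - df s (Z u)) (Z' u)| <=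
    Cf * a ^+ 2 * d * K + Cf * a ^+ 2 * d.
  apply: blin_comp_dist => //.
  by rewrite (le_trans dfm)// ler_wpM2l// mulr_ge0.
have h2 : `|blin_comp (df s (Y u) - df s (Y s)) (Y' u) -
    blin_comp (df s (Z u) - df s (Z s)) (Z' u)| <=
    Cf * (k * a * d + (1 + k) * (c1 * d * a)) * K + Cf * (k * a) * d.
  apply: blin_comp_dist => //.
    rewrite EY EZ (le_trans (tb_incrB hf _ _ _ _ sT))// ler_wpM2l//.
    have ka : k * a <= k by rewrite ler_piMr.
    by rewrite lerD// ler_pM ?addr_ge0// lerD2l (le_trans hzY).
  by rewrite (le_trans (tb_df_lip hf _ _ sT))// ler_wpM2l.
have h3 : `|blin_comp (df s (Y s)) (Y' u - Y' s) -
    blin_comp (df s (Z s)) (Z' u - Z' s)| <= Cf * d * (K * a) + Cf * (d * a).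
  apply: blin_comp_dist => //; last exact: (tb_df hf _ sT).
  by rewrite (le_trans (tb_df_lip hf _ _ sT))// ler_wpM2l.
rewrite (le_trans (ler_normD _ _))//.
apply: (le_trans (lerD (le_trans (ler_normD _ _) (lerD h1 h2)) h3)).
rewrite -subr_ge0 /kP.
rewrite (_ : _ - _ = Cf * d * (K + 1) * (a - a ^+ 2)); last by ring.
apply: mulr_ge0; last by rewrite subr_ge0.
by rewrite mulr_ge0 ?addr_ge0// mulr_ge0.
Qed.

End germ.

(** * Exponential weights on windows *)

Section weights.
Context {R : realType}.

(** The properties of [exp(t / tau)] in use: [weight_window] moves the weight inside a window,
    [weight_prim] lets an integral gain a factor [tau], and [weight_double] sums windows
    geometrically. *)
Record weight (tau E : R) (w : R -> R) : Prop := Weight {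
  weight_ge1 : forall t, 0 <= t -> 1 <= w t ;
  weight_mono : forall s t, s <= t -> w s <= w t ;
  weight_window : forall s t, s <= t -> t - s <= tau -> w t <= E * w s ;
  weight_prim : forall u v, u <= v -> (v - u) * w u <= tau * (w v - w u) ;
  weight_double : forall t, 2 * w (t - tau) <= w t
}.

Lemma exp_weight (tau : R) : 0 < tau ->
  weight tau (expR 1) (fun t => expR (t / tau)).
Proof.
move=> tau0; split.
- by move=> t t0; rewrite -expR0 ler_expR divr_ge0// ltW.
- by move=> s t st; rewrite ler_expR ler_wpM2r// invr_ge0 ltW.
- move=> s t st ts; rewrite -expRD ler_expR -lerBlDr -mulrBl ler_pdivrMr//.
  by rewrite mul1r.
- move=> u v uv; have -> : v / tau = u / tau + (v - u) / tau.
    by rewrite -mulrDl addrC subrK.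
  have := expR_ge1Dx ((v - u) / tau); rewrite expRD.
  have := expR_ge0 (u / tau); set p := expR _; set q := expR _ => p0 hq.
  have -> : v - u = tau * ((v - u) / tau) by rewrite mulrC divfK// gt_eqF.
  rewrite -subr_ge0 (_ : _ - _ = tau * (p * (q - (1 + (v - u) / tau)))); last by ring.
  by rewrite !mulr_ge0 ?subr_ge0// ltW.
- move=> t; have -> : t / tau = 1 + (t - tau) / tau by field; rewrite gt_eqF.
  rewrite expRD ler_wpM2r ?expR_ge0//.
  by have := expR_ge1Dx (1 : R); lra.
Qed.

Lemma exists_small_powR (beta eps : R) : 0 < beta -> 0 < eps ->
  exists tau : R, [/\ 0 < tau, tau <= 1 & tau `^ beta <= eps].
Proof.
move=> b0 e0; have := @powR_cvg0 R _ b0.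
move=> /cvgrPdist_le /(_ _ e0) [/= d d0 Hd].
exists (Num.min (d / 2) 1).
have t0 : 0 < Num.min (d / 2) 1 by rewrite lt_min ltr01 divr_gt0.
split => //; first by rewrite ge_min lexx orbT.
have := Hd (Num.min (d / 2) 1); rewrite /= sub0r normrN gtr0_norm// sub0r normrN.
rewrite ger0_norm ?powR_ge0//; apply => //.
by rewrite gt_min; apply/orP; left; lra.
Qed.

End weights.

Section weighted_sewing.
Context {R : realType} {D : normedModType R}.
Context (tau E T th : R) (w : R -> R) (hw : weight tau E w) (th1 : 1 < th).
Context (tau0 : 0 < tau).

(** Sewing on a single window, where the weight at intermediate points is brought back to [s] at the
    price of the factor [E]. *)
Lemma sewn_increment (Xi : R -> R -> D) (a s t : R) (J : D) :
  0 <= a -> 0 <= s -> s <= t -> t <= T -> t - s <= tau ->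
  (forall u, 0 <= u <= T -> Xi u u = 0) ->
  (forall s u t, 0 <= s -> s <= u -> u <= t -> t <= T -> t - s <= tau ->
     `|Xi s t - Xi s u - Xi u t| <= a * w s * (t - s) `^ th) ->
  sews Xi s t J ->
  `|J - Xi s t| <= 2 / (1 - 2 `^ (1 - th)) * E * a * w s * (t - s) `^ th.
Proof.
move=> a0 s0 st tT ts H0 H1 HJ.
apply: (sews_close st ltr01 HJ) => p pP pl.
have -> : 2 / (1 - 2 `^ (1 - th)) * E * a * w s * (t - s) `^ th =
  2 / (1 - 2 `^ (1 - th)) * (a * (E * w s)) * (t - s) `^ th by ring.
have w0 : 0 <= E * w s.
  apply: le_trans (weight_window hw st ts).
  by rewrite (le_trans ler01)// (weight_ge1 hw)// (le_trans s0).
apply: sewing_bound => //.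
- exact: mulr_ge0.
- by move=> u /andP[su ut]; apply: H0; rewrite (le_trans s0)// (le_trans ut).
- move=> u x v su ux xv vt.
  have vus : v - u <= tau by rewrite (le_trans _ ts)// lerB.
  have us : u - s <= tau.
    by rewrite (le_trans _ ts)// lerB// (le_trans ux)// (le_trans xv).
  apply: (le_trans (H1 _ _ _ (le_trans s0 su) ux xv (le_trans vt tT) vus)).
  rewrite ler_wpM2r ?powR_ge0// ler_wpM2l//.
  exact: (weight_window hw su us).
- exact: gap_path_lt pP.
Qed.

(** By doubling, twice the bound at [t - tau] is at most one bound at [t], so the windows already
    passed and the current one together cost a factor 2, however many windows there are. The power
    of [tau] gained is the small factor of the fixed-point argument. *)
Lemma window_sum (beta c : R) (Z : R -> D) : 0 < beta -> 0 <= c -> Z 0 = 0 ->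
  (forall s t, 0 <= s -> s <= t -> t <= T -> t - s <= tau ->
     `|Z t - Z s| <= c * w s * (t - s) `^ beta) ->
  forall t, 0 <= t -> t <= T -> `|Z t| <= 2 * c * tau `^ beta * w t.
Proof.
move=> b0 c0 Z0 H.
have cw t : 0 <= t -> 0 <= c * tau `^ beta * w t.
  by move=> t0; rewrite !mulr_ge0 ?powR_ge0// (le_trans ler01)// (weight_ge1 hw).
have inc s t : 0 <= s -> s <= t -> t <= T -> t - s <= tau ->
    `|Z t - Z s| <= c * tau `^ beta * w s.
  move=> s0 st tT ts; apply: (le_trans (H s t s0 st tT ts)).
  rewrite [leRHS]mulrAC ler_wpM2l//.
    by rewrite mulr_ge0// (le_trans ler01)// (weight_ge1 hw).
  by apply: ge0_ler_powR; rewrite ?nnegrE ?subr_ge0// ltW.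
have K n : forall t, 0 <= t -> t <= T -> t <= n%:R * tau ->
    `|Z t| <= 2 * (c * tau `^ beta * w t).
  elim: n => [|n IH] t t0 tT.
    rewrite mul0r => t0'; have -> : t = 0 by apply/eqP; rewrite eq_le t0'.
    by rewrite Z0 normr0 mulr_ge0// cw.
  rewrite -natr1 mulrDl mul1r => tn.
  have [tt|tt] := leP t tau.
    have := inc 0 t (lexx 0) t0 tT; rewrite subr0 Z0 subr0 => /(_ tt) h.
    apply: (le_trans h); have := cw 0 (lexx 0).
    have : c * tau `^ beta * w 0 <= c * tau `^ beta * w t.
      by rewrite ler_wpM2l ?mulr_ge0 ?powR_ge0// (weight_mono hw).
    by lra.
  have s0 : 0 <= t - tau by rewrite subr_ge0 ltW.
  have st : t - tau <= t by rewrite gerBl ltW.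
  have h1 := IH (t - tau) s0 (le_trans st tT).
  have h2 := inc (t - tau) t s0 st tT; rewrite subKr in h2.
  have h3 : 2 * (c * tau `^ beta * w (t - tau)) <= c * tau `^ beta * w t.
    rewrite mulrCA ler_wpM2l ?mulr_ge0 ?powR_ge0//; exact: (weight_double hw _).
  have -> : Z t = Z (t - tau) + (Z t - Z (t - tau)) by zmodule.
  have sn : t - tau <= n%:R * tau by rewrite lerBlDr.
  apply: (le_trans (ler_normD _ _)).
  by have := h1 sn; have := h2 (lexx _); have := cw _ s0; lra.
move=> t t0 tT; rewrite -!mulrA [c * _]mulrA.
apply: (K (Num.Def.truncn (t / tau)).+1) => //.
by rewrite -ler_pdivrMr// ltW// truncnS_gt.
Qed.

End weighted_sewing.

(** * Convolutions with the semigroup *)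

Section convolution.
Context {R : realType} {D W : completeNormedModType R}.
Context (S : R -> blin D D) (hS : C0_semigroup S) (T M : R).
Context (hM : forall t, 0 <= t -> t <= T -> `|S t| <= M).

Definition conv_germ (g : R -> D) (t : R) : R -> R -> D :=
  riem (fun s => S (t - s) (g s)).

Let M0 : 0 <= T -> 0 <= M. Proof. by move=> T0; rewrite (le_trans _ (hM _ T0)). Qed.

Lemma conv_exists (g : R -> D) : 0 <= T -> ucont 0 T g -> exists C : R -> D,
  forall t, 0 <= t -> t <= T -> sews (conv_germ g t) 0 t (C t).
Proof.
move=> T0 cg.
have /choice[C HC] : forall t, exists I, 0 <= t -> t <= T ->
    sews (conv_germ g t) 0 t I.
  move=> t; have [/andP[t0 tT]|nt] := boolP (0 <= t <= T).
    by have [I HI] := riem_sews t0 (convolution_ucont hS t0 tT cg); exists I.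
  by exists 0 => t0 tT; rewrite t0 tT in nt.
by exists C.
Qed.

Lemma conv_split (g : R -> D) s t Cs Ct : ucont 0 T g -> 0 <= s -> s <= t ->
  t <= T -> sews (conv_germ g s) 0 s Cs -> sews (conv_germ g t) 0 t Ct ->
  exists2 J, sews (conv_germ g t) s t J & Ct = S (t - s) Cs + J.
Proof.
move=> cg s0 st tT HCs HCt; have t0 := le_trans s0 st.
have [J HJ] : exists J, sews (conv_germ g t) s t J.
  apply: coherent_sews => //.
  apply: coherentW s0 (lexx t) _; apply: riem_coherent.
  exact: convolution_ucont cg.
exists J => //; apply: (sews_additive s0 st _ HJ HCt).
apply: (sews_eq _ (sews_blin (S (t - s)) HCs)) => u v u0 uv vs.
rewrite /conv_germ /riem blinZr -(semiD hS) ?subr_ge0//; last exact: le_trans vs.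
by congr (_ *: S _ _); ring.
Qed.

Section bounds.
Context (tau E : R) (w : R -> R) (hw : weight tau E w) (tau0 : 0 < tau).
Context (g : R -> D) (m : R) (m0 : 0 <= m).
Context (hg : forall t, 0 <= t -> t <= T -> `|g t| <= m * w t).

(** [weight_prim] bounds the integral of [w] by [tau] times its increment, whence the factor
    [tau]. *)
Lemma conv_bound t Ct : 0 <= t -> t <= T -> sews (conv_germ g t) 0 t Ct ->
  `|Ct| <= M * m * tau * w t.
Proof.
move=> t0 tT HC; have T0 := le_trans t0 tT.
have := @sews_norm _ _ _ (fun x => M * m * tau * w x) _ _ _ 1 t0 ltr01 HC.
have w0 : 0 <= M * m * tau * w 0.
  by rewrite !mulr_ge0 ?M0// ?ltW// (lt_le_trans ltr01)// (weight_ge1 hw).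
move=> H; apply: le_trans (H _) _; last by lra.
move=> u v u0 uv vt _; rewrite /conv_germ /riem normrZ ger0_norm ?subr_ge0//.
rewrite -mulrBr -!mulrA.
apply: (@le_trans _ _ ((v - u) * (M * (m * w u)))).
  rewrite ler_wpM2l ?subr_ge0//; apply: blin_norm_le; last first.
    by apply: hg => //; rewrite (le_trans uv)// (le_trans vt).
  apply: hM; first by rewrite subr_ge0 (le_trans uv).
  by rewrite (le_trans _ tT)// gerBl.
rewrite mulrCA ler_wpM2l ?M0// mulrCA ler_wpM2l//.
exact: (weight_prim hw uv).
Qed.

Context (i : blin D W) (B : R) (hi : `|i| <= B) (B0 : 0 <= B).
Context (hlip : forall h y, 0 <= h -> h <= T -> `|i (S h y) - i y| <= h * (B * `|y|)).

(** The convolution at [t] is [S (t - s)] applied to the one at [s], plus an integral over [[s, t]].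
    The first part moves by [hlip], which trades the norm of [D] for a factor [t - s] in [W]; the
    second part is short. *)
Lemma conv_incr s t Cs Ct : ucont 0 T g -> tau <= 1 -> 0 <= s -> s <= t -> t <= T ->
  t - s <= tau ->
  sews (conv_germ g s) 0 s Cs -> sews (conv_germ g t) 0 t Ct ->
  `|i Ct - i Cs| <= 2 * B * M * m * E * w s * (t - s).
Proof.
move=> cg tau1 s0 st tT ts HCs HCt; have t0 := le_trans s0 st.
have T0 := le_trans t0 tT; have M0' := M0 T0.
have [J HJ ->] := conv_split cg s0 st tT HCs HCt.
have hCs := conv_bound s0 (le_trans st tT) HCs.
have ts0 : 0 <= t - s by rewrite subr_ge0.
have tsT : t - s <= T by rewrite (le_trans _ tT)// gerBl.
have hw1 := weight_window hw st ts.
have ws0 : 0 <= w s by rewrite (le_trans ler01)// (weight_ge1 hw).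
have wt0 : 0 <= w t by rewrite (le_trans ler01)// (weight_ge1 hw).
have hJ : `|J| <= (t - s) * (M * (m * w t)).
  have := @sews_norm _ _ _ (fun x => x * (M * (m * w t))) _ _ _ 1 st ltr01 HJ.
  rewrite -mulrBl; apply => u v su uv vt _.
  rewrite /conv_germ /riem normrZ ger0_norm ?subr_ge0// -mulrBl.
  rewrite ler_wpM2l ?subr_ge0//; apply: blin_norm_le.
    apply: hM; first by rewrite subr_ge0 (le_trans uv).
    by rewrite (le_trans _ tT)// gerBl (le_trans s0).
  apply: (le_trans (hg _ _)); first exact: le_trans su.
    by rewrite (le_trans uv)// (le_trans vt).
  by rewrite ler_wpM2l// (weight_mono hw)// (le_trans uv).
have -> : i (S (t - s) Cs + J) - i Cs = (i (S (t - s) Cs) - i Cs) + i J.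
  by rewrite blinDr; zmodule.
have h1 := hlip Cs ts0 tsT.
have h2 : `|i J| <= B * ((t - s) * (M * (m * w t))) by exact: blin_norm_le.
have h3 : `|Cs| <= M * m * w s.
  apply: (le_trans hCs); rewrite ler_wpM2r// ler_piMr// mulr_ge0//.
have h4 : (t - s) * (B * `|Cs|) <= (t - s) * (B * (M * m * w s)).
  by rewrite ler_wpM2l// ler_wpM2l.
have h5 : w s <= w t by exact: (weight_mono hw st).
rewrite (le_trans (ler_normD _ _))//.
apply: (le_trans (lerD (le_trans h1 h4) h2)).
have -> : 2 * B * M * m * E * w s * (t - s) =
  (t - s) * (B * (M * m * (E * w s))) + B * ((t - s) * (M * (m * (E * w s)))).
  by ring.
apply: lerD.
  rewrite ler_wpM2l// ler_wpM2l// ler_wpM2l ?mulr_ge0//.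
  exact: le_trans h5 hw1.
by rewrite ler_wpM2l// ler_wpM2l// ler_wpM2l// ler_wpM2l.
Qed.

End bounds.
End convolution.

Section partition_sums.
Context {R : realType}.

Lemma gap_pathP (d a : R) p : path (gap d) a p <->
  path <%R a p /\ forall i, (i < size p)%N -> p`_i - (a :: p)`_i < d.
Proof.
split=> [gp|[/(pathP 0) lp dp]].
  split; first exact: gap_path_lt gp.
  by move=> i ip; have /(pathP 0)/(_ i ip)/andP[] := gp.
by apply/(pathP 0) => i ip; rewrite /gap lp// dp.
Qed.

Lemma sum_psum (E : zmodType) (Xi : R -> R -> E) a p :
  \sum_(i < size p) Xi (a :: p)`_i p`_i = psum Xi a p.
Proof. by elim: p a => [|x p IH] a /=; rewrite ?big_ord0// big_ord_recl IH. Qed.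

Lemma coherent_increment (E : normedModType R) (Xi : R -> R -> E) a b :
  coherent Xi a b -> forall eps : R, 0 < eps -> exists2 d : R, 0 < d &
    forall s t I, a <= s -> s <= t -> t <= b -> t - s < d -> sews Xi s t I ->
      `|I - Xi s t| <= eps * (t - s).
Proof.
move=> H eps e0; have [d d0 Hd] := H eps e0; exists d => // s t I as_ st tb ts HI.
apply: (sews_close st ltr01 HI) => p pg pl.
by apply: Hd => //; exact: gap_path_lt pg.
Qed.

Lemma riem_near (E : normedModType R) (g : R -> E) u v I c (eps : R) : u <= v ->
  sews (riem g) u v I -> (forall r, u <= r -> r <= v -> `|g r - c| <= eps) ->
  `|I - (v - u) *: c| <= eps * (v - u).
Proof.
move=> uv HI Hg.
have Hc : sews (riem (fun=> c)) u v ((v - u) *: c).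
  have -> : (v - u) *: c = v *: c - u *: c by rewrite scalerBl.
  apply: (sews_path (phi := fun r => r *: c)) => e e0; exists 1 => // x y ux xy yv _.
  rewrite /riem scalerBl subrr normr0; apply: mulr_ge0; first exact: ltW.
  by rewrite subr_ge0.
rewrite mulrBr; apply: (sews_norm (Phi := fun r => eps * r) uv ltr01 (sewsB HI Hc)).
move=> x y ux xy yv _; rewrite /riem -scalerBr normrZ ger0_norm ?subr_ge0//.
rewrite -mulrBr mulrC; apply: ler_wpM2r; first by rewrite subr_ge0.
by apply: Hg => //; exact: le_trans yv.
Qed.

(** Increments over more than [tau] are handled by the uniform bound [b], since [t - s] then exceeds
    [tau]. *)
Lemma window_holder (E : normedModType R) (T tau gam c b : R) (Xi : R -> R -> E) :
  0 < tau -> 0 <= gam -> 0 <= c -> 0 <= b ->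
  (forall s t, 0 <= s -> s <= t -> t <= T -> `|Xi s t| <= b) ->
  (forall s t, 0 <= s -> s <= t -> t <= T -> t - s <= tau ->
    `|Xi s t| <= c * (t - s) `^ gam) ->
  forall s t, 0 <= s -> s <= t -> t <= T ->
    `|Xi s t| <= (c + b / tau `^ gam) * (t - s) `^ gam.
Proof.
move=> tau0 g0 c0 b0 Hb Hc s t s0 st tT.
have pt : 0 < tau `^ gam by exact: powR_gt0.
have [ts|ts] := leP (t - s) tau.
  rewrite (le_trans (Hc s t s0 st tT ts))// ler_wpM2r ?powR_ge0// lerDl.
  by rewrite divr_ge0// ltW.
rewrite (le_trans (Hb s t s0 st tT))// mulrDl ler_wpDl ?mulr_ge0 ?powR_ge0//.
rewrite mulrAC ler_pdivlMr// ler_wpM2l//.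
apply: ge0_ler_powR => //; rewrite ?nnegrE; [exact: ltW|exact: ltW (lt_trans tau0 ts)|].
exact: ltW.
Qed.

End partition_sums.

Lemma orbit_increment {R : realType} {W : completeNormedModType R}
    (S : R -> blin W W) (hS : C0_semigroup S) y (h eps : R) :
  0 <= h -> gendom S y ->
  (forall r, 0 <= r -> r <= h -> `|S r (generator S y) - generator S y| <= eps) ->
  `|S h y - y - h *: generator S y| <= eps * h.
Proof.
move=> h0 gy H; rewrite -[h in leRHS]subr0 -[h in _ - h *: _]subr0.
exact: (riem_near h0 (orbit_integral hS h0 gy)).
Qed.

Lemma blinNr {R : realType} (V W : normedModType R) (f : blin V W) x : f (- x) = - f x.
Proof. exact: linearN. Qed.

Section rough_integral.
Context {R : realType} {V W : completeNormedModType R} (VV : tensor V).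

(** Passes from the partitions in the definition of the rough integral to [gap] paths; the germs
    have to agree only inside [[0, t]]. *)
Lemma rough_integral_sews (t : R) (X : R -> V) (XX : R -> R -> VV)
    (Z : R -> blin V W) (Z' : R -> blin V (blin V W)) (J : W) (Xi : R -> R -> W) :
  (forall u v, 0 <= u -> u <= v -> v <= t ->
     Xi u v = Z u (X v - X u) + tlift VV (Z' u) (XX u v)) ->
  is_rough_integral t X XX Z Z' J <-> sews Xi 0 t J.
Proof.
move=> XiE; have sE s : path <%R 0 s -> last 0 s = t ->
    compensated_sum X XX Z Z' s = psum Xi 0 s.
  move=> sp sl; rewrite (eq_psum (Th := fun u v => Z u (X v - X u) +
    tlift VV (Z' u) (XX u v)) sp) -?sum_psum// => u v u0 uv vl.
  by apply: XiE => //; rewrite -sl.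
split=> H e e0; have [d d0 Hd] := H e e0; exists d => // s.
  move=> /gap_pathP[sp sg] sl; rewrite -sE//; apply: Hd => //.
  by split => //; apply/eqP.
move=> [sp /eqP sl] sg; rewrite sE//; apply: Hd => //.
exact/gap_pathP.
Qed.

End rough_integral.

(** * The fixed point *)

Ltac nonneg := repeat first
  [ assumption | exact: ler0n | exact: ler01 | exact: normr_ge0 | exact: powR_ge0
  | apply: exprn_ge0 | apply: addr_ge0 | apply: mulr_ge0 ].

Section picard.
Context {R : realType} {V W D1 D2 : completeNormedModType R} (VV : tensor V).
Context (T beta : R) (X : R -> V) (XX : R -> R -> VV).
Context (f : R -> W -> blin V D2) (df : R -> W -> blin W (blin V D2)).
(* [D1], [D2] stand for D(A), D(A^2) with inclusions [i1], [i2] into [W], [S] for the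
   semigroup on D(A), and [k] for [f0]. *)
Context (k : R -> W -> D1) (S : R -> blin D1 D1).
Context (i1 : blin D1 W) (i2 : blin D2 W) (A : blin D2 D1) (x0 : D1).
(** One constant [B >= 1] dominates all norms and Lipschitz constants of the data, so that the
    estimates only carry powers of [B]. *)
Context (B : R) (B1 : 1 <= B) (T0 : 0 <= T).
Context (beta3 : 1 < 3 * beta) (beta2 : 2 * beta <= 1).
Context (hX : forall s t, 0 <= s -> s <= t -> t <= T ->
  `|X t - X s| <= B * (t - s) `^ beta).
Context (hXX : forall s t, 0 <= s -> s <= t -> t <= T ->
  `|XX s t| <= B * (t - s) `^ (2 * beta)).
Context (chen : forall s u t, 0 <= s -> s <= u -> u <= t -> t <= T ->
  XX s t - XX s u - XX u t = tmul VV (X u - X s) (X t - X u)).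
Context (hl : forall (L : blin V (blin V D2)) z,
  `|tlift VV L z| <= B * `|L| * `|z|).
Context (hf : Taylor_bounds T (2 * beta) B f df).
Context (hi1 : `|i1| <= B) (hi2 : `|i2| <= B) (hA : `|A| <= B).
Context (hS : C0_semigroup S).
Context (hM : forall t, 0 <= t -> t <= T -> `|S t| <= B).
Context (hlip : forall h y, 0 <= h -> h <= T ->
  `|i1 (S h y) - i1 y| <= h * (B * `|y|)).
Context (hk : forall t y z, 0 <= t <= T -> `|k t y - k t z| <= B * `|y - z|).
Context (hk0 : forall t, 0 <= t <= T -> `|k t 0| <= B).
Context (hkc : forall Y : R -> W, ucont 0 T Y -> ucont 0 T (fun t => k t (Y t))).

Notation Germ := (germ (VV := VV) X XX f df).
Notation Rem := (remainder X).
Notation P := (gderiv df).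

Definition drift (Y : R -> W) (Z : R -> D2) (s : R) : D1 := k s (Y s) + A (Z s).

Definition noise (Y : R -> W) (t : R) : blin V W := blin_comp i2 (f t (Y t)).

(* [Y1] is the image of [(Y, Y')], with rough integral [Z] and convolution [C]; its
   Gubinelli derivative is [noise Y]. *)
Record picard (Y : R -> W) (Y' : R -> blin V W) (Z : R -> D2) (C : R -> D1)
    (Y1 : R -> W) : Prop := Picard {
  pic_Z0 : Z 0 = 0 ;
  pic_Z : forall s t, 0 <= s -> s <= t -> t <= T ->
    sews (Germ Y Y') s t (Z t - Z s) ;
  pic_cont : ucont 0 T (drift Y Z) ;
  pic_C : forall t, 0 <= t -> t <= T ->
    sews (conv_germ S (drift Y Z) t) 0 t (C t) ;
  pic_Y : forall t, 0 <= t -> t <= T ->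
    Y1 t = i1 (S t x0) + i1 (C t) + i2 (Z t)
}.

Let B0 : 0 <= B. Proof. exact: le_trans B1. Qed.
Let beta0 : 0 < beta. Proof. by move: beta3; lra. Qed.
Let inT t : 0 <= t -> t <= T -> 0 <= t <= T. Proof. by move=> -> ->. Qed.

Lemma sew_cst_ge0 : 0 <= 2 / (1 - 2 `^ (1 - 3 * beta)) :> R.
Proof.
rewrite divr_ge0//.
have : (2 : R) `^ (1 - 3 * beta) <= 1.
  rewrite -[leRHS](powRr0 2); apply: ler_powR; first by rewrite ler1n.
  by rewrite subr_le0 ltW.
by rewrite subr_ge0.
Qed.

Section window.
Context (tau E : R) (w : R -> R) (hw : weight tau E w).
Context (tau0 : 0 < tau) (tau1 : tau <= 1).

Let kappa := 2 / (1 - 2 `^ (1 - 3 * beta)) * E.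

Let E_ge0 : 0 <= E.
Proof.
have := weight_window hw (lexx 0); rewrite subrr => /(_ (ltW tau0)).
have := weight_ge1 hw (lexx 0) => w1 /(le_trans w1) h.
rewrite leNgt; apply/negP => E0; have : E * w 0 <= 0.
  by rewrite nmulr_rle0// (le_trans ler01).
by lra.
Qed.

Let kappa_ge0 : 0 <= kappa. Proof. exact: mulr_ge0 sew_cst_ge0 E_ge0. Qed.

Lemma weight_ge0 t : 0 <= t -> 0 <= w t.
Proof. by move=> t0; rewrite (le_trans ler01)// (weight_ge1 hw). Qed.

Lemma window_powers s t : s <= t -> t - s <= tau ->
  [/\ 0 <= (t - s) `^ beta, (t - s) `^ beta <= tau `^ beta,
      (t - s) `^ beta <= 1 & t - s <= (t - s) `^ beta ^+ 2].
Proof.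
move=> st ts; have ts0 : 0 <= t - s by rewrite subr_ge0.
split; first exact: powR_ge0.
- exact: powR_mono.
- by apply: powR_le1 => //; exact: le_trans ts tau1.
- rewrite -powR_double; have [->|ts'] := eqVneq (t - s) 0; first exact: powR_ge0.
  by apply: ger1_powR => //; rewrite lt_neqAle eq_sym ts' ts0 (le_trans ts).
Qed.

Lemma tau_le_powR : tau <= tau `^ beta.
Proof.
apply: ger1_powR; rewrite ?tau0//.
by rewrite (le_trans _ beta2)// ler_peMl ?ler1n// ltW.
Qed.

(** The germ is left abstract because this is applied both to the germ of one pair and to the
    difference of the germs of two pairs. *)
Lemma sewn_bounds (Xi : R -> R -> D2) (Z : R -> D2) (a b : R) :
  0 <= a -> 0 <= b -> Z 0 = 0 ->
  (forall u, 0 <= u <= T -> Xi u u = 0) ->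
  (forall s u t, 0 <= s -> s <= u -> u <= t -> t <= T -> t - s <= tau ->
     `|Xi s t - Xi s u - Xi u t| <= a * w s * (t - s) `^ (3 * beta)) ->
  (forall s t, 0 <= s -> s <= t -> t <= T -> t - s <= tau ->
     `|Xi s t| <= b * w s * (t - s) `^ beta) ->
  (forall s t, 0 <= s -> s <= t -> t <= T -> sews Xi s t (Z t - Z s)) ->
  [/\ forall s t, 0 <= s -> s <= t -> t <= T -> t - s <= tau ->
        `|Z t - Z s - Xi s t| <= kappa * a * w s * (t - s) `^ beta ^+ 3,
      forall s t, 0 <= s -> s <= t -> t <= T -> t - s <= tau ->
        `|Z t - Z s| <= (b + kappa * a) * w s * (t - s) `^ beta &
      forall t, 0 <= t -> t <= T ->
        `|Z t| <= 2 * (b + kappa * a) * tau `^ beta * w t].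
Proof.
move=> a0 b0 Z0 Xi0 XiD Xib XiZ.
have k0 : 0 <= kappa := kappa_ge0.
have h1 s t : 0 <= s -> s <= t -> t <= T -> t - s <= tau ->
    `|Z t - Z s - Xi s t| <= kappa * a * w s * (t - s) `^ beta ^+ 3.
  move=> s0 st tT ts; rewrite -powR_triple /kappa.
  exact: (sewn_increment hw beta3 a0 s0 st tT ts Xi0 XiD (XiZ s t s0 st tT)).
have h2 s t : 0 <= s -> s <= t -> t <= T -> t - s <= tau ->
    `|Z t - Z s| <= (b + kappa * a) * w s * (t - s) `^ beta.
  move=> s0 st tT ts; have [q0 qt q1 _] := window_powers st ts.
  have -> : Z t - Z s = Xi s t + (Z t - Z s - Xi s t) by zmodule.
  rewrite (le_trans (ler_normD _ _))// !mulrDl lerD//; first exact: Xib.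
  rewrite (le_trans (h1 s t s0 st tT ts))// ler_wpM2l//.
    by apply: mulr_ge0; [exact: mulr_ge0 | exact: weight_ge0].
  by rewrite exprSr ler_piMl// exprn_ile1.
split => //; apply: (window_sum hw tau0) => //.
by apply: addr_ge0 => //; exact: mulr_ge0.
Qed.

Lemma germ_bound (Y : R -> W) (Y' : R -> blin V W) (M s t : R) : 0 <= M ->
  `|Y' s| <= M -> 0 <= s -> s <= t -> t <= T -> t - s <= tau ->
  `|Germ Y Y' s t| <= (B ^+ 2 + B ^+ 3 * M) * w s * (t - s) `^ beta.
Proof.
move=> M0 hY' s0 st tT ts; have [q0 qt q1 _] := window_powers st ts.
have sT : 0 <= s <= T by rewrite s0 (le_trans st).
have hx := hX s0 st tT; have hxx := hXX s0 st tT; rewrite powR_double in hxx.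
have h1 : `|f s (Y s) (X t - X s)| <= B * (B * (t - s) `^ beta).
  by apply: blin_norm_le => //; exact: (tb_f hf).
have h2 : `|tlift VV (P Y Y' s) (XX s t)| <=
    B * (B * M) * (B * (t - s) `^ beta ^+ 2).
  rewrite (le_trans (hl _ _))// ler_pM ?mulr_ge0// ler_wpM2l//.
  by rewrite (le_trans (blin_comp_norm _ _))// ler_pM// (tb_df hf).
rewrite (le_trans (ler_normD _ _))// (le_trans (lerD h1 h2))//.
set q := (t - s) `^ beta in q0 q1 *.
have w1 := weight_ge1 hw s0.
apply: (@le_trans _ _ ((B ^+ 2 + B ^+ 3 * M) * q)).
  rewrite -subr_ge0 (_ : _ - _ = B ^+ 3 * M * (q - q ^+ 2)); last by ring.
  by rewrite !mulr_ge0 ?exprn_ge0// subr_ge0 expr2 ler_piMl.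
by rewrite ler_wpM2r// ler_peMr// addr_ge0 ?mulr_ge0 ?exprn_ge0.
Qed.

End window.

(** The bound [M] on the derivative carries no weight: the defect of the germ depends on it
    nonlinearly, and for an image it is [B ^+ 2] whatever the path. The weighted constants [b] and
    [K] only ever enter linearly. *)
Definition growth_bound (tau : R) (w : R -> R) (M b K : R)
    (Y : R -> W) (Y' : R -> blin V W) :=
  [/\ forall t, 0 <= t -> t <= T -> `|Y t| <= b * w t,
      forall t, 0 <= t -> t <= T -> `|Y' t| <= M,
      forall s t, 0 <= s -> s <= t -> t <= T -> t - s <= tau ->
        `|Y' t - Y' s| <= K * w s * (t - s) `^ beta &
      forall s t, 0 <= s -> s <= t -> t <= T -> t - s <= tau ->
        `|Rem Y Y' s t| <= K * w s * (t - s) `^ beta ^+ 2].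

Lemma absorbD (c d u x s : R) : 0 <= d -> x <= s -> u <= c * s ->
  u + d * x <= (c + d) * s.
Proof. by move=> d0 xs us; rewrite mulrDl lerD// ler_wpM2l. Qed.

Lemma le_sum5 (a b c d e : R) : 0 <= a -> 0 <= b -> 0 <= c -> 0 <= d -> 0 <= e ->
  let s := a + b + c + d + e in [/\ a <= s, b <= s, c <= s, d <= s & e <= s].
Proof. by move=> a0 b0 c0 d0 e0 /=; split; lra. Qed.

(** The remainder has order [2 * beta], so in an estimate of order [beta] its constant [K] comes
    with a power of [tau]. *)
Lemma growth_incr tau E w M b K (Y : R -> W) (Y' : R -> blin V W) s t :
  weight tau E w -> 0 < tau -> tau <= 1 -> 0 <= K -> 0 <= M ->
  growth_bound tau w M b K Y Y' ->
  0 <= s -> s <= t -> t <= T -> t - s <= tau ->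
  `|Y t - Y s| <= (M * B + K * tau `^ beta) * w s * (t - s) `^ beta.
Proof.
move=> hw tau0 tau1 K0 M0 [_ hY' _ hR] s0 st tT ts.
have [q0 qt q1 _] := window_powers tau1 st ts.
have -> : Y t - Y s = Y' s (X t - X s) + Rem Y Y' s t.
  by rewrite /remainder; zmodule.
have w1 := weight_ge1 hw s0.
have hY's := hY' s s0 (le_trans st tT).
have h1 : `|Y' s (X t - X s)| <= M * (B * (t - s) `^ beta).
  by apply: blin_norm_le => //; exact: hX.
have h2 := hR s t s0 st tT ts.
rewrite (le_trans (ler_normD _ _))// (le_trans (lerD h1 h2))//.
set q := (t - s) `^ beta in q0 qt q1 *.
have h3 : M * (B * q) <= M * B * q * w s.
  by rewrite mulrA ler_peMr// !mulr_ge0.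
have h4 : K * w s * q ^+ 2 <= K * w s * (tau `^ beta * q).
  rewrite ler_wpM2l ?expr2 ?ler_wpM2r// mulr_ge0//.
  exact: le_trans w1.
by rewrite (le_trans (lerD h3 h4))// le_eqVlt; apply/orP; left; apply/eqP; ring.
Qed.

Lemma germ_delta_growth (M : R) : 0 <= M -> exists2 C : R, 0 <= C &
  forall tau E w b K Y Y', weight tau E w -> tau <= 1 -> 0 <= K ->
    growth_bound tau w M b K Y Y' ->
    forall s u t, 0 <= s -> s <= u -> u <= t -> t <= T -> t - s <= tau ->
      `|Germ Y Y' s t - Germ Y Y' s u - Germ Y Y' u t| <=
        C * (1 + 2 * K) * w s * (t - s) `^ (3 * beta).
Proof.
move=> M0; have [C C0 HC] := germ_growth beta0 B0 B0 hX hXX chen hl hf M0.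
exists C => // tau E w b K Y Y' hw tau1 K0 [_ hY' hI hR] s u t s0 su ut tT ts.
have ts1 : t - s <= 1 by exact: le_trans tau1.
have us : u - s <= tau by rewrite (le_trans _ ts)// lerB.
have w1 := weight_ge1 hw s0; have w0 := le_trans ler01 w1.
have Kw0 : 0 <= K * w s by exact: mulr_ge0.
have uT := le_trans ut tT.
have hR' := hR s u s0 su uT us; rewrite -powR_double in hR'.
apply: (le_trans (HC Y Y' s u t (K * w s) (K * w s) s0 su ut tT ts1 Kw0 Kw0
  (hY' s s0 (le_trans su uT)) (hY' u (le_trans s0 su) uT) hR'
  (hI s u s0 su uT us))).
rewrite ler_wpM2r ?powR_ge0// -mulrA ler_wpM2l//.
by lra.
Qed.

Lemma holder_ucont (E : normedModType R) (g : R -> E) (c tau : R) :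
  0 < tau -> 0 <= c ->
  (forall s t, 0 <= s -> s <= t -> t <= T -> t - s <= tau ->
     `|g t - g s| <= c * (t - s) `^ beta) -> ucont 0 T g.
Proof.
move=> tau0 c0 H e e0.
have [|d [d0 _ Hd]] := @exists_small_powR _ beta (e / (c + 1)) beta0.
  by rewrite divr_gt0// ltr_wpDl.
exists (Num.min d tau); first by rewrite lt_min d0.
move=> s t s0 st tT; rewrite lt_min => /andP[tsd tst].
apply: (le_trans (H s t s0 st tT (ltW tst))).
have ts0 : 0 <= t - s by rewrite subr_ge0.
have h1 := powR_mono beta0 ts0 (ltW tsd).
apply: (@le_trans _ _ (c * (e / (c + 1)))).
  by rewrite ler_wpM2l// (le_trans h1).
by rewrite mulrCA ger_pMr// ler_pdivrMr ?mul1r ?lerDl// ltr_wpDl.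
Qed.

Lemma germ_coherent tau E w M b K Y Y' : weight tau E w -> 0 < tau -> tau <= 1 ->
  0 <= M -> 0 <= K -> growth_bound tau w M b K Y Y' -> coherent (Germ Y Y') 0 T.
Proof.
move=> hw tau0 tau1 M0 K0 hY; have [Cg Cg0 HCg] := germ_delta_growth M0.
have a0 : 0 <= Cg * (1 + 2 * K) by rewrite mulr_ge0// addr_ge0// mulr_ge0.
have wT0 : 0 <= w T by exact: (weight_ge0 hw).
apply: (sewing_coherent beta3 tau0 (mulr_ge0 a0 wT0)) => [u /andP[u0 uT]|].
  exact: (germ_diag _ _ _ beta0 hXX).
move=> s u t s0 su ut tT ts.
apply: (le_trans (HCg _ _ _ _ _ _ _ hw tau1 K0 hY s u t s0 su ut tT ts)).
rewrite ler_wpM2r ?powR_ge0// ler_wpM2l// (weight_mono hw)//.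
by rewrite (le_trans su)// (le_trans ut).
Qed.

Lemma picard_exists tau E w M b K Y Y' : weight tau E w -> 0 <= E -> 0 < tau -> tau <= 1 ->
  0 <= M -> 0 <= K -> growth_bound tau w M b K Y Y' ->
  exists Z C Y1, picard Y Y' Z C Y1.
Proof.
move=> hw E0 tau0 tau1 M0 K0 hY.
have [Cg Cg0 HCg] := germ_delta_growth M0.
have hD := HCg _ _ _ _ _ _ _ hw tau1 K0 hY.
have a0 : 0 <= Cg * (1 + 2 * K) by rewrite mulr_ge0// addr_ge0// mulr_ge0.
have Xi0 u : 0 <= u <= T -> Germ Y Y' u u = 0.
  by move=> /andP[u0 uT]; exact: (germ_diag _ _ _ beta0 hXX).
have wT0 : 0 <= w T by exact: (weight_ge0 hw).
have coh := germ_coherent hw tau0 tau1 M0 K0 hY.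
have [Z Z0 HZ] := coherent_path T0 coh.
have hb s t : 0 <= s -> s <= t -> t <= T -> t - s <= tau ->
    `|Germ Y Y' s t| <= (B ^+ 2 + B ^+ 3 * M) * w s * (t - s) `^ beta.
  move=> s0 st tT ts; apply: (germ_bound hw tau1) => //.
  by case: hY => _ hY' _ _; apply: hY' => //; exact: le_trans tT.
have b0 : 0 <= B ^+ 2 + B ^+ 3 * M by rewrite addr_ge0 ?mulr_ge0 ?exprn_ge0.
have [_ hZ _] := sewn_bounds hw tau0 tau1 a0 b0 Z0 Xi0 hD hb HZ.
set c := (_ + _ * (Cg * _)) in hZ.
have c0 : 0 <= c.
  by apply: addr_ge0 => //; apply: mulr_ge0 => //; exact: mulr_ge0 sew_cst_ge0 E0.
have uZ : ucont 0 T Z.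
  apply: (holder_ucont tau0 (mulr_ge0 c0 wT0)) => s t s0 st tT ts.
  apply: (le_trans (hZ s t s0 st tT ts)); rewrite ler_wpM2r ?powR_ge0//.
  by rewrite ler_wpM2l// (weight_mono hw)// (le_trans st).
have uY : ucont 0 T Y.
  have cc0 : 0 <= M * B + K * tau `^ beta by rewrite addr_ge0 ?mulr_ge0 ?powR_ge0.
  apply: (holder_ucont tau0 (mulr_ge0 cc0 wT0)) => s t s0 st tT ts.
  apply: (le_trans (growth_incr hw tau0 tau1 K0 M0 hY s0 st tT ts)).
  rewrite ler_wpM2r ?powR_ge0// ler_wpM2l// (weight_mono hw)//.
  exact: le_trans tT.
have ug : ucont 0 T (drift Y Z) by apply: ucontD; [exact: hkc|exact: ucont_blin].
have [C HC] := conv_exists hS T0 ug.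
by exists Z, C, (fun t => i1 (S t x0) + i1 (C t) + i2 (Z t)); split.
Qed.

(** The new sup bound sees [b] and [K] only through a power of [tau]; the new Hoelder bound sees [b]
    fully, but [K] only through that power. This triangular form allows [b], then [K], to be fixed
    before [tau]. *)
Lemma picard_growth (E M : R) : 0 <= E -> 0 <= M -> exists2 C : R, 0 <= C &
  forall tau w b K Y Y' Z Cv Y1, weight tau E w -> 0 < tau -> tau <= 1 ->
    0 <= b -> 0 <= K -> growth_bound tau w M b K Y Y' ->
    picard Y Y' Z Cv Y1 ->
    growth_bound tau w (B ^+ 2)
      (C * (1 + `|x0| + tau `^ beta * (1 + b + K)))
      (C * (1 + `|x0| + b + tau `^ beta * (1 + K))) Y1 (noise Y).
Proof.
move=> E0 M0.
have [Cg Cg0 HCg] := germ_delta_growth M0.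
have [kp [kp0 kpE]] : exists kp, 0 <= kp /\ kp = 2 / (1 - 2 `^ (1 - 3 * beta)) * E.
  by eexists; split; last reflexivity; exact: mulr_ge0 sew_cst_ge0 E0.
pose bb := B ^+ 2 + B ^+ 3 * M.
(* [c0 + c1 * K] bounds the Hoelder constant of the rough integral. *)
have [c0 [c00 c0E]] : exists c0, 0 <= c0 /\ c0 = bb + kp * Cg.
  by eexists; split; last reflexivity; rewrite /bb; nonneg.
have [c1 [c10 c1E]] : exists c1, 0 <= c1 /\ c1 = 2 * kp * Cg.
  by eexists; split; last reflexivity; nonneg.
(* [C1], [C2] and [C3] serve the sup norm, the remainder and the increments of the derivative. *)
pose C1 := B ^+ 2 + (B ^+ 3 + 2 * (B ^+ 3 + B) * c0) + B ^+ 3 +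
  2 * (B ^+ 3 + B) * c1.
pose C2 := B ^+ 2 + (2 * B ^+ 3 * E + B ^+ 4 * M) + 2 * B ^+ 3 * E +
  (4 * B ^+ 3 * E * c0 + B * kp * Cg) + (4 * B ^+ 3 * E * c1 + 2 * B * kp * Cg).
pose C3 := B ^+ 2 * (1 + M * B) + B ^+ 2.
have C10 : 0 <= C1 by rewrite /C1; nonneg.
have C20 : 0 <= C2 by rewrite /C2; nonneg.
have C30 : 0 <= C3 by rewrite /C3; nonneg.
exists (C1 + C2 + C3); first by nonneg.
have le1 : C1 <= C1 + C2 + C3 by rewrite -addrA lerDl addr_ge0.
have le2 : C2 <= C1 + C2 + C3 by rewrite addrAC lerDr addr_ge0.
have le3 : C3 <= C1 + C2 + C3 by rewrite lerDr addr_ge0.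
move=> tau w b K Y Y' Z Cv Y1 hw tau0 tau1 b0 K0 hY [Z0 HZ ug HC HY1].
have hD := HCg _ _ _ _ _ _ _ hw tau1 K0 hY.
have a0 : 0 <= Cg * (1 + 2 * K) by rewrite mulr_ge0// addr_ge0// mulr_ge0.
have Xi0 u : 0 <= u <= T -> Germ Y Y' u u = 0.
  by move=> /andP[u0 uT]; exact: (germ_diag _ _ _ beta0 hXX).
have hb s t : 0 <= s -> s <= t -> t <= T -> t - s <= tau ->
    `|Germ Y Y' s t| <= bb * w s * (t - s) `^ beta.
  move=> s0 st tT ts; apply: (germ_bound hw tau1) => //.
  by case: hY => _ hY' _ _; apply: hY' => //; exact: le_trans tT.
have bb0 : 0 <= bb by rewrite addr_ge0 ?mulr_ge0 ?exprn_ge0.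
have [hZ1 hZ2 hZ3] := sewn_bounds hw tau0 tau1 a0 bb0 Z0 Xi0 hD hb HZ.
rewrite -kpE in hZ1 hZ2 hZ3.
set c := bb + _ in hZ2 hZ3.
have cE : c = c0 + c1 * K by rewrite /c c0E c1E; ring.
have cc0 : 0 <= c by apply: addr_ge0 => //; exact: mulr_ge0.
have [hYb hY' hI hR] := hY.
set tb := tau `^ beta; have tb0 : 0 <= tb by exact: powR_ge0.
have tb1 : tb <= 1 by apply: powR_le1 => //; exact: ltW.
have ttb : tau <= tb by exact: tau_le_powR.
(* Weighted sup norm of the drift: the value of [k] at 0, its Lipschitz part, and [A Z] bounded by
   summing windows. *)
pose m := B + B * b + 2 * B * c * tb.
have m0 : 0 <= m by rewrite !addr_ge0 ?mulr_ge0.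
have w1 t : 0 <= t -> 1 <= w t by exact: (weight_ge1 hw).
have w0 t : 0 <= t -> 0 <= w t by exact: (weight_ge0 hw).
have hg t : 0 <= t -> t <= T -> `|drift Y Z t| <= m * w t.
  move=> t0 tT; have tT' := inT t0 tT.
  have h1 : `|k t (Y t)| <= B + B * (b * w t).
    have -> : k t (Y t) = k t 0 + (k t (Y t) - k t 0) by zmodule.
    rewrite (le_trans (ler_normD _ _))// lerD ?hk0// (le_trans (hk _ _ tT'))//.
    by rewrite subr0 ler_wpM2l// hYb.
  have h2 : `|A (Z t)| <= B * (2 * c * tb * w t) by apply: blin_norm_le => //; exact: hZ3.
  rewrite (le_trans (ler_normD _ _))// (le_trans (lerD h1 h2))//.
  have h3 : B <= B * w t by rewrite ler_peMr// w1.
  apply: (le_trans (lerD (lerD h3 (lexx _)) (lexx _))).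
  by rewrite le_eqVlt; apply/orP; left; apply/eqP; rewrite /m; ring.
have conv1 t (t0 : 0 <= t) (tT : t <= T) := conv_bound hM hw tau0 m0 hg t0 tT (HC t t0 tT).
split.
- move=> t t0 tT; rewrite HY1//.
  have h1 : `|i1 (S t x0)| <= B * (B * `|x0|).
    by apply: blin_norm_le => //; apply: blin_norm_le => //; exact: hM.
  have h2 : `|i1 (Cv t)| <= B * (B * m * tau * w t).
    by apply: blin_norm_le => //; exact: conv1.
  have h3 : `|i2 (Z t)| <= B * (2 * c * tb * w t).
    by apply: blin_norm_le => //; exact: hZ3.
  rewrite (le_trans (ler_normD _ _))//.
  apply: (le_trans (lerD (le_trans (ler_normD _ _) (lerD h1 h2)) h3)).
  have h4 : m * tau <= (B + B * b + 2 * B * c) * tb.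
    apply: ler_pM => //; first exact: ltW.
    by rewrite /m lerD2l ler_piMr// !mulr_ge0.
  have h5 : B * (B * m * tau * w t) <=
      B ^+ 2 * ((B + B * b + 2 * B * c) * tb) * w t.
    rewrite (_ : B * _ = B ^+ 2 * (m * tau) * w t); last by ring.
    by rewrite ler_wpM2r ?w0// ler_wpM2l// exprn_ge0.
  have h6 : B * (B * `|x0|) <= B ^+ 2 * `|x0| * w t.
    by rewrite mulrA -expr2 ler_peMr ?w1// mulr_ge0// exprn_ge0.
  apply: (le_trans (lerD (lerD h6 h5) (lexx _))).
  set s1 := 1 + `|x0| + tb * (1 + b + K).
  have s1E : s1 = 1 + `|x0| + tb + tb * b + tb * K by rewrite /s1; ring.
  have tbb : 0 <= tb * b by exact: mulr_ge0.
  have tbK : 0 <= tb * K by exact: mulr_ge0.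
  have x00 := normr_ge0 x0.
  have s10 : 0 <= s1 by rewrite s1E; nonneg.
  have [_ l2 l3 l4 l5] := le_sum5 ler01 x00 tb0 tbb tbK; rewrite /= -s1E in l2 l3 l4 l5.
  apply: (@le_trans _ _ (C1 * s1 * w t)); last first.
    by rewrite ler_wpM2r ?w0// ler_wpM2r.
  rewrite (_ : _ + _ = (B ^+ 2 * `|x0| + (B ^+ 3 + 2 * (B ^+ 3 + B) * c0) * tb +
    B ^+ 3 * (tb * b) + 2 * (B ^+ 3 + B) * c1 * (tb * K)) * w t); last first.
    by rewrite cE; ring.
  rewrite ler_wpM2r ?w0//; apply: absorbD l5 _; first by nonneg.
  apply: absorbD l4 _; first by nonneg.
  by apply: absorbD l3 _; [nonneg | apply: ler_wpM2l l2; nonneg].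
- move=> t t0 tT; rewrite expr2 (le_trans (blin_comp_norm _ _))// ler_pM//.
  exact: (tb_f hf _ (inT t0 tT)).
- move=> s t s0 st tT ts; have [q0 qt q1 qq] := window_powers tau1 st ts.
  have sT := inT s0 (le_trans st tT).
  have tT' := inT (le_trans s0 st) tT.
  have h1 := tb_f_time hf (Y t) s0 st tT; rewrite powR_double in h1.
  have h2 := tb_f_lip hf (Y t) (Y s) sT.
  have h3 := growth_incr hw tau0 tau1 K0 M0 hY s0 st tT ts.
  rewrite -/tb in h3.
  set q := (t - s) `^ beta in q0 qt q1 qq h1 h3 *.
  rewrite -blin_compBr (le_trans (blin_comp_norm _ _))//.
  have h4 : `|f t (Y t) - f s (Y s)| <=
      B * (q * w s) + B * ((M * B + K * tb) * w s * q).
    have -> : f t (Y t) - f s (Y s) =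
      (f t (Y t) - f s (Y t)) + (f s (Y t) - f s (Y s)) by zmodule.
    rewrite (le_trans (ler_normD _ _))// lerD//.
      rewrite (le_trans h1)// ler_wpM2l// expr2 ler_wpM2l//.
      exact: le_trans q1 (w1 _ s0).
    by rewrite (le_trans h2)// ler_wpM2l.
  apply: (@le_trans _ _ (B * (B * (q * w s) + B * ((M * B + K * tb) * w s * q)))).
    by apply: ler_pM.
  set s2 := 1 + `|x0| + b + tb * (1 + K).
  have tbK : 0 <= tb * K by exact: mulr_ge0.
  have x00 := normr_ge0 x0.
  have s2E : s2 = 1 + `|x0| + b + tb + tb * K by rewrite /s2; ring.
  have s20 : 0 <= s2 by rewrite s2E; nonneg.
  have [l1 _ _ _ l5] := le_sum5 ler01 x00 b0 tb0 tbK; rewrite /= -s2E in l1 l5.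
  rewrite (_ : B * _ = (B ^+ 2 * (1 + M * B) * 1 + B ^+ 2 * (tb * K)) * w s * q);
    last by ring.
  rewrite ler_wpM2r// ler_wpM2r ?w0//.
  apply: (@le_trans _ _ (C3 * s2)); last by rewrite ler_wpM2r.
  by apply: absorbD l5 _; [nonneg | apply: ler_wpM2l l1; nonneg].
move=> s t s0 st tT ts; have [q0 qt q1 qq] := window_powers tau1 st ts.
have t0 := le_trans s0 st; have sT := le_trans st tT.
have ts0 : 0 <= t - s by rewrite subr_ge0.
have h1 : `|i1 (S t x0) - i1 (S s x0)| <= (t - s) * (B * (B * `|x0|)).
  have -> : S t x0 = S (t - s) (S s x0).
    by rewrite -(semiD hS) ?subr_ge0// subrK.
  apply: (le_trans (hlip _ _ _)) => //.
    by rewrite (le_trans _ tT)// gerBl.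
  rewrite ler_wpM2l// ler_wpM2l//; apply: blin_norm_le => //; exact: hM.
have h2 := conv_incr hS hM hw tau0 m0 hg hi1 B0 hlip ug tau1 s0 st tT ts
  (HC s s0 sT) (HC t t0 tT).
have h3 : `|i2 (Z t - Z s - Germ Y Y' s t)| <=
    B * (kp * (Cg * (1 + 2 * K)) * w s * (t - s) `^ beta ^+ 3).
  by apply: blin_norm_le => //; exact: hZ1.
have h4 : `|i2 (tlift VV (P Y Y' s) (XX s t))| <=
    B * (B * (B * M) * (B * (t - s) `^ beta ^+ 2)).
  apply: blin_norm_le => //; rewrite (le_trans (hl _ _))// ler_pM ?mulr_ge0//.
    rewrite ler_wpM2l// (le_trans (blin_comp_norm _ _))// ler_pM ?hY'//.
    exact: (tb_df hf _ (inT s0 sT)).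
  by rewrite -powR_double; exact: hXX.
(* Subtracting [noise Y s] applied to the increment of [X] cancels the first-order term of the germ.
   There remain the orbit of [x0] and the convolution, Lipschitz in time, the sewing error, and the
   second-order term. *)
have -> : Rem Y1 (noise Y) s t = (i1 (S t x0) - i1 (S s x0)) +
   (i1 (Cv t) - i1 (Cv s)) + i2 (Z t - Z s - Germ Y Y' s t) +
   i2 (tlift VV (P Y Y' s) (XX s t)).
  rewrite /remainder /germ; move: (X t - X s) => x.
  by rewrite !HY1// !blinBr blinDr; zmodule.
set q := (t - s) `^ beta in q0 qt q1 qq h3 h4 *.
rewrite (le_trans (ler_normD _ _))//.
apply: (le_trans (lerD (le_trans (ler_normD _ _) (lerD (le_trans (ler_normD _ _)
  (lerD h1 h2)) h3)) h4)).
have q20 : 0 <= q ^+ 2 by rewrite sqr_ge0.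
have ws0 := w0 s s0; have ws1 := w1 s s0; have x00 := normr_ge0 x0.
have h5 : (t - s) * (B * (B * `|x0|)) <= B ^+ 2 * `|x0| * (w s * q ^+ 2).
  rewrite mulrC mulrA -expr2; apply: ler_wpM2l; first by nonneg.
  by rewrite (le_trans qq)// ler_peMl.
have h6 : 2 * B * B * m * E * w s * (t - s) <= 2 * B ^+ 2 * m * E * (w s * q ^+ 2).
  rewrite (_ : 2 * B * B * m * E * w s * (t - s) = 2 * B ^+ 2 * m * E * (w s * (t - s)));
    last by ring.
  by apply: ler_wpM2l; [nonneg | exact: ler_wpM2l].
have h7 : B * (kp * (Cg * (1 + 2 * K)) * w s * q ^+ 3) <=
    B * kp * Cg * (1 + 2 * K) * tb * (w s * q ^+ 2).
  rewrite (_ : B * _ = B * kp * Cg * (1 + 2 * K) * (w s * q ^+ 2) * q); last by ring.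
  rewrite [leRHS]mulrAC; apply: ler_wpM2l => //; nonneg.
have h8 : B * (B * (B * M) * (B * q ^+ 2)) <= B ^+ 4 * M * (w s * q ^+ 2).
  rewrite (_ : B * _ = B ^+ 4 * M * (q ^+ 2)); last by ring.
  by apply: ler_wpM2l; [nonneg | rewrite ler_peMl].
apply: (le_trans (lerD (lerD (lerD h5 h6) h7) h8)).
set s2 := 1 + `|x0| + b + tb * (1 + K).
have tbK : 0 <= tb * K by exact: mulr_ge0.
have s2E : s2 = 1 + `|x0| + b + tb + tb * K by rewrite /s2; ring.
have s20 : 0 <= s2 by rewrite s2E; nonneg.
have [l1 l2 l3 l4 l5] := le_sum5 ler01 x00 b0 tb0 tbK.
rewrite /= -s2E in l1 l2 l3 l4 l5.
rewrite -[leRHS]mulrA -!mulrDl ler_wpM2r//; first by nonneg.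
apply: (@le_trans _ _ (C2 * s2)); last by rewrite ler_wpM2r.
rewrite (_ : _ + _ = B ^+ 2 * `|x0| + (2 * B ^+ 3 * E + B ^+ 4 * M) * 1 +
  2 * B ^+ 3 * E * b + (4 * B ^+ 3 * E * c0 + B * kp * Cg) * tb +
  (4 * B ^+ 3 * E * c1 + 2 * B * kp * Cg) * (tb * K)); last by rewrite /m cE; ring.
apply: absorbD l5 _; first by nonneg.
apply: absorbD l4 _; first by nonneg.
apply: absorbD l3 _; first by nonneg.
by apply: absorbD l1 _; [nonneg | apply: ler_wpM2l l2; nonneg].
Qed.

(** * Differences of two pairs and the contraction *)

Definition regular (tau K : R) (Y : R -> W) (Y' : R -> blin V W) :=
  [/\ forall t, 0 <= t -> t <= T -> `|Y' t| <= K,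
      forall s t, 0 <= s -> s <= t -> t <= T -> t - s <= tau ->
        `|Y' t - Y' s| <= K * (t - s) `^ beta &
      forall s t, 0 <= s -> s <= t -> t <= T -> t - s <= tau ->
        `|Rem Y Y' s t| <= K * (t - s) `^ beta ^+ 2].

(** Values, derivatives and Hoelder seminorms have separate distances because the fixed-point map
    treats them differently. *)
Definition close (tau : R) (w : R -> R) (d dp dh : R) (Y : R -> W)
    (Y' : R -> blin V W) (U : R -> W) (U' : R -> blin V W) :=
  [/\ forall t, 0 <= t -> t <= T -> `|Y t - U t| <= d * w t,
      forall t, 0 <= t -> t <= T -> `|Y' t - U' t| <= dp * w t,
      forall s t, 0 <= s -> s <= t -> t <= T -> t - s <= tau ->
        `|(Y' t - Y' s) - (U' t - U' s)| <= dh * w s * (t - s) `^ beta &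
      forall s t, 0 <= s -> s <= t -> t <= T -> t - s <= tau ->
        `|Rem Y Y' s t - Rem U U' s t| <= dh * w s * (t - s) `^ beta ^+ 2].

(** [germ_difference] takes a single distance, here [dh * E * w s]: it dominates [d] and [dp], and
    the factor [E] covers the weight at the intermediate time [u]. *)
Lemma germ_delta_close (K : R) : 0 <= K -> exists2 C : R, 0 <= C &
  forall tau E w d dp dh Y Y' U U', weight tau E w -> tau <= 1 -> 1 <= E ->
    0 <= d -> d <= dh -> 0 <= dp -> dp <= dh ->
    regular tau K Y Y' -> regular tau K U U' ->
    close tau w d dp dh Y Y' U U' ->
    forall s u t, 0 <= s -> s <= u -> u <= t -> t <= T -> t - s <= tau ->
      `|(Germ Y Y' s t - Germ Y Y' s u - Germ Y Y' u t) -
        (Germ U U' s t - Germ U U' s u - Germ U U' u t)| <=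
        C * (dh * E) * w s * (t - s) `^ (3 * beta).
Proof.
move=> K0; have [C C0 HC] := germ_difference beta0 B0 B0 hX hXX chen hl hf K0.
exists C => // tau E w d dp dh Y Y' U U' hw tau1 E1 d0 ddh dp0 dpdh.
move=> [rY1 rY2 rY3] [rU1 rU2 rU3] [c1 c2 c3 c4] s u t s0 su ut tT ts.
have ts1 : t - s <= 1 by exact: le_trans tau1.
have us : u - s <= tau by rewrite (le_trans _ ts)// lerB.
have w1 := weight_ge1 hw s0; have w0 := le_trans ler01 w1.
have uT := le_trans ut tT; have u0 := le_trans s0 su; have sT := le_trans su uT.
have dh0 : 0 <= dh by exact: le_trans ddh.
have E0 : 0 <= E by exact: le_trans E1.
have wEs : w s <= E * w s by rewrite ler_peMl.
have wEu : w u <= E * w s by exact: (weight_window hw su us).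
have up (x y : R) : 0 <= x -> x <= dh -> y <= E * w s -> 0 <= y -> x * y <= dh * E * w s.
  by move=> x_ge0 xd ye y0; rewrite -mulrA ler_pM.
have wu0 := le_trans ler01 (weight_ge1 hw u0).
have dw0 : 0 <= dh * E * w s by rewrite !mulr_ge0.
have -> : C * (dh * E) * w s * (t - s) `^ (3 * beta) =
  C * (dh * E * w s) * (t - s) `^ (3 * beta) by ring.
have pw (x : R) : x <= dh * E * w s -> forall p : R, 0 <= p -> x * p <= dh * E * w s * p.
  by move=> xx p p0; rewrite ler_wpM2r.
have dws : dh * w s <= dh * E * w s by exact: up.
apply: (HC Y Y' U U' s u t) => //.
- exact: rY1.
- exact: rU1.
- exact: rY2.
- exact: rY1.
- exact: rU2.
- by rewrite powR_double; exact: rY3.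
- by rewrite powR_double; exact: rU3.
- by apply: (le_trans (c1 _ s0 sT)); exact: up.
- by apply: (le_trans (c1 _ u0 uT)); exact: up.
- by apply: (le_trans (c2 _ s0 sT)); exact: up.
- by apply: (le_trans (c2 _ u0 uT)); exact: up.
- by apply: (le_trans (c3 _ _ s0 su uT us)); apply: pw => //; exact: powR_ge0.
- rewrite powR_double; apply: (le_trans (c4 _ _ s0 su uT us)); apply: pw => //.
  by rewrite exprn_ge0// powR_ge0.
Qed.

Lemma drift_dist tau w d Y Y' U U' dp dh (c : R) (Z ZU : R -> D2) :
  close tau w d dp dh Y Y' U U' ->
  (forall t, 0 <= t -> t <= T -> `|Z t - ZU t| <= 2 * c * tau `^ beta * w t) ->
  forall t, 0 <= t -> t <= T -> `|drift Y Z t - drift U ZU t| <=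
    (B * d + 2 * B * c * tau `^ beta) * w t.
Proof.
move=> [c1 _ _ _] hZ t t0 tT.
have -> : drift Y Z t - drift U ZU t =
    (k t (Y t) - k t (U t)) + A (Z t - ZU t) by rewrite blinBr /drift; zmodule.
have h1 : `|k t (Y t) - k t (U t)| <= B * (d * w t).
  by rewrite (le_trans (hk _ _ (inT t0 tT)))// ler_wpM2l// c1.
have h2 : `|A (Z t - ZU t)| <= B * (2 * c * tau `^ beta * w t).
  by apply: blin_norm_le => //; exact: hZ.
rewrite (le_trans (ler_normD _ _))// (le_trans (lerD h1 h2))//.
by rewrite le_eqVlt; apply/orP; left; apply/eqP; ring.
Qed.

Lemma conv_sub (g h : R -> D1) t I J :
  sews (conv_germ S g t) 0 t I -> sews (conv_germ S h t) 0 t J ->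
  sews (conv_germ S (fun s => g s - h s) t) 0 t (I - J).
Proof.
move=> HI HJ; apply: sews_eq (sewsB HI HJ) => u v _ _ _.
by rewrite /conv_germ /riem blinBr scalerBr.
Qed.

(** Writing increments as [Y' X] plus a remainder keeps [dh] behind a power of [tau]: only the
    remainders bring it in, and they have order [2 * beta]. *)
Lemma noise_incr_dist tau E w d dp dh K Y Y' U U' s t :
  weight tau E w -> 0 < tau -> tau <= 1 -> 0 <= K -> 0 <= d -> 0 <= dp -> 0 <= dh ->
  regular tau K Y Y' -> regular tau K U U' -> close tau w d dp dh Y Y' U U' ->
  0 <= s -> s <= t -> t <= T -> t - s <= tau ->
  `|(noise Y t - noise Y s) - (noise U t - noise U s)| <=
    (B ^+ 2 * (E + (K * B + K) + (K * B + K) ^+ 2) * d +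
     B ^+ 2 * (1 + 2 * (K * B + K) + (K * B + K) ^+ 2) *
       (B * dp + tau `^ beta * dh)) * w s * (t - s) `^ beta.
Proof.
move=> hw tau0 tau1 K0 d0 dp0 dh0 [rY1 rY2 rY3] [rU1 rU2 rU3] [c1 c2 c3 c4].
move=> s0 st tT ts; have [q0 qt q1 qq] := window_powers tau1 st ts.
have t0 := le_trans s0 st; have sT := le_trans st tT.
have w1 := weight_ge1 hw s0; have w0 := le_trans ler01 w1.
have hwt := weight_window hw st ts.
have s0T := inT s0 sT.
have tb0 : 0 <= tau `^ beta by exact: powR_ge0.
pose z := Y t - Y s; pose z' := U t - U s.
have zE : z = Y' s (X t - X s) + Rem Y Y' s t by rewrite /z /remainder; zmodule.
have z'E : z' = U' s (X t - X s) + Rem U U' s t by rewrite /z' /remainder; zmodule.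
have hx := hX s0 st tT.
have hc1 := c1 t t0 tT; have hc1s := c1 s s0 sT; have hc2 := c2 s s0 sT.
have hc4 := c4 s t s0 st tT ts.
have hY1 := rY1 s s0 sT; have hU1 := rU1 s s0 sT.
have hY3 := rY3 s t s0 st tT ts; have hU3 := rU3 s t s0 st tT ts.
have hm := tb_f_mix hf (Y t) (U t) s0 st tT; rewrite powR_double in hm.
have ht := tb_taylorB hf (Y s) z (U s) z' s0T.
have hl1 := tb_df_lip hf (Y s) (U s) s0T; have hd1 := tb_df hf (U s) s0T.
set q := (t - s) `^ beta in q0 qt q1 qq hx hc4 hY3 hU3 hm *.
set tb := tau `^ beta in qt tb0 *; set k1 := K * B + K.
have k10 : 0 <= k1 by rewrite addr_ge0// mulr_ge0.
have q2q : q ^+ 2 <= q by rewrite expr2 ler_piMl.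
have hzz (y : W) (y' : blin V W) : `|y'| <= K -> `|y| <= K * q ^+ 2 ->
    `|y' (X t - X s) + y| <= k1 * q.
  move=> hy' hy; rewrite (le_trans (ler_normD _ _))// /k1 mulrDl lerD//.
    by rewrite -mulrA blin_norm_le.
  by rewrite (le_trans hy)// ler_wpM2l.
have hz : `|z| <= k1 * q by rewrite zE; exact: hzz.
have hz' : `|z'| <= k1 * q by rewrite z'E; exact: hzz.
(* [zeta] is the weighted distance of the increments [z] and [z'] relative to [q]. *)
pose zeta := B * dp + tb * dh.
have zeta0 : 0 <= zeta by rewrite /zeta; nonneg.
have hdz : `|z - z'| <= zeta * w s * q.
  have -> : z - z' = (Y' s - U' s) (X t - X s) + (Rem Y Y' s t - Rem U U' s t).
    by rewrite zE z'E blinB; zmodule.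
  rewrite (le_trans (ler_normD _ _))//.
  apply: (le_trans (lerD (blin_norm_le hc2 hx) hc4)).
  have -> : zeta * w s * q = dp * w s * (B * q) + dh * w s * (tb * q).
    by rewrite /zeta; ring.
  rewrite lerD2l ler_wpM2l ?mulr_ge0// expr2 ler_wpM2r//.
have Ew0 : 0 <= E * w s by exact: le_trans (le_trans w0 (weight_mono hw st)) hwt.
have h1 : `|(f t (Y t) - f s (Y t)) - (f t (U t) - f s (U t))| <=
    B * E * d * w s * q.
  apply: (le_trans hm).
  apply: (@le_trans _ _ (B * q * (d * (E * w s)))); last first.
    by rewrite le_eqVlt; apply/orP; left; apply/eqP; ring.
  apply: ler_pM; [by nonneg|by nonneg| |].
    by rewrite ler_wpM2l.
  by rewrite (le_trans hc1)// ler_wpM2l.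
have h2 : `|df s (Y s) z - df s (U s) z'| <=
    B * (d * w s) * (k1 * q) + B * (zeta * w s * q).
  apply: blin_app_dist => //.
  by rewrite (le_trans hl1)// ler_wpM2l.
have h3 : `|(f s (Y s + z) - f s (Y s) - df s (Y s) z) -
    (f s (U s + z') - f s (U s) - df s (U s) z')| <=
    B * (k1 ^+ 2 * q * (d * w s) + (k1 + k1 ^+ 2 + k1) * (zeta * w s * q)).
  apply: (le_trans ht); apply: ler_wpM2l => //.
  have zk : `|z| ^+ 2 <= k1 ^+ 2 * q.
    apply: (@le_trans _ _ ((k1 * q) ^+ 2)).
      by rewrite lerXn2r ?nnegrE// mulr_ge0.
    by rewrite exprMn ler_wpM2l// exprn_ge0.
  have k1q : k1 * q <= k1 by rewrite ler_piMr.
  have k2q : k1 ^+ 2 * q <= k1 ^+ 2 by rewrite ler_piMr// exprn_ge0.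
  apply: lerD; first by apply: ler_pM.
  apply: ler_pM; [by nonneg|exact: normr_ge0| |exact: hdz].
  by rewrite !lerD// ?(le_trans hz)// ?(le_trans hz')// (le_trans zk).
rewrite -!blin_compBr (le_trans (blin_comp_norm _ _))//.
have -> : f t (Y t) - f s (Y s) - (f t (U t) - f s (U s)) =
  ((f t (Y t) - f s (Y t)) - (f t (U t) - f s (U t))) +
  (df s (Y s) z - df s (U s) z') +
  ((f s (Y s + z) - f s (Y s) - df s (Y s) z) -
    (f s (U s + z') - f s (U s) - df s (U s) z')).
  have -> : Y s + z = Y t by rewrite /z; zmodule.
  have -> : U s + z' = U t by rewrite /z'; zmodule.
  by zmodule.
have h4 := le_trans (ler_normD _ _) (lerD (le_trans (ler_normD _ _) (lerD h1 h2)) h3).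
apply: (le_trans (ler_pM (normr_ge0 _) (normr_ge0 _) hi2 h4)).
by rewrite le_eqVlt; apply/orP; left; apply/eqP; rewrite -/zeta; ring.
Qed.

(** The difference germ is sewn by itself, and [x0] cancels. The new derivative is a function of [Y]
    alone, so its distance is of the order of [d] with no small factor; smallness first appears in
    the values, where both integrals gain a power of [tau]. *)
Lemma picard_contraction (E K : R) : 1 <= E -> 0 <= K -> exists2 C : R, 0 <= C &
  forall tau w d dp dh Y Y' Z Cv Y1 U U' ZU CU U1, weight tau E w ->
    0 < tau -> tau <= 1 -> 0 <= d -> d <= dh -> 0 <= dp -> dp <= dh ->
    regular tau K Y Y' -> regular tau K U U' -> close tau w d dp dh Y Y' U U' ->
    picard Y Y' Z Cv Y1 -> picard U U' ZU CU U1 ->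
    close tau w (C * (tau `^ beta * dh)) (C * d) (C * (d + dp + tau `^ beta * dh))
      Y1 (noise Y) U1 (noise U).
Proof.
move=> E1 K0; have E0 := le_trans ler01 E1.
have [Cd Cd0 HCd] := germ_delta_close K0.
have [kp [kp0 kpE]] : exists kp, 0 <= kp /\ kp = 2 / (1 - 2 `^ (1 - 3 * beta)) * E.
  by eexists; split; last reflexivity; exact: mulr_ge0 sew_cst_ge0 E0.
have [c0 [c00 c0E]] : exists c0, 0 <= c0 /\
    c0 = B ^+ 2 + B ^+ 3 * K + B ^+ 3 + kp * Cd * E.
  by eexists; split; last reflexivity; nonneg.
have [k1 [k10 k1E]] : exists k1, 0 <= k1 /\ k1 = K * B + K.
  by eexists; split; last reflexivity; nonneg.
pose CA := B ^+ 3 + (2 * B ^+ 3 + 2 * B) * c0.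
pose CC := B ^+ 2 * (E + k1 + k1 ^+ 2) + B ^+ 2 * (1 + 2 * k1 + k1 ^+ 2) * B +
  B ^+ 2 * (1 + 2 * k1 + k1 ^+ 2).
pose CD := (2 * B ^+ 3 * E + B ^+ 4 * K) + B ^+ 4 +
  (4 * B ^+ 3 * E * c0 + B * kp * Cd * E).
have CA0 : 0 <= CA by rewrite /CA; nonneg.
have CC0 : 0 <= CC by rewrite /CC; nonneg.
have CD0 : 0 <= CD by rewrite /CD; nonneg.
have BB0 : 0 <= B ^+ 2 by nonneg.
exists (CA + B ^+ 2 + CC + CD); first by nonneg.
set C := CA + B ^+ 2 + CC + CD.
have [leA leB leC leD _] := le_sum5 CA0 BB0 CC0 CD0 (lexx 0).
rewrite /= addr0 -/C in leA leB leC leD.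
move=> tau w d dp dh Y Y' Z Cv Y1 U U' ZU CU U1 hw tau0 tau1 d0 ddh dp0 dpdh.
move=> rY rU cl [Z0 HZ ug HC HY1] [ZU0 HZU ugU HCU HU1].
have dh0 := le_trans d0 ddh.
have hD := HCd _ _ _ _ _ _ _ _ _ _ hw tau1 E1 d0 ddh dp0 dpdh rY rU cl.
have [c1 c2 c3 c4] := cl.
have [rY1 rY2 rY3] := rY; have [rU1 rU2 rU3] := rU.
have w1 t : 0 <= t -> 1 <= w t by exact: (weight_ge1 hw).
have w0 t : 0 <= t -> 0 <= w t by exact: (weight_ge0 hw).
pose Xi s t := Germ Y Y' s t - Germ U U' s t.
pose Zd t := Z t - ZU t.
have a0 : 0 <= Cd * (dh * E) by nonneg.
pose b := B ^+ 2 * d + B ^+ 3 * K * d + B ^+ 3 * dp.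
have b0 : 0 <= b by rewrite /b; nonneg.
have Zd0 : Zd 0 = 0 by rewrite /Zd Z0 ZU0 subrr.
have Xi0 u : 0 <= u <= T -> Xi u u = 0.
  by move=> /andP[u0 uT]; rewrite /Xi !(germ_diag _ _ _ beta0 hXX)// subrr.
have XiD s u t : 0 <= s -> s <= u -> u <= t -> t <= T -> t - s <= tau ->
    `|Xi s t - Xi s u - Xi u t| <= Cd * (dh * E) * w s * (t - s) `^ (3 * beta).
  move=> s0 su ut tT ts; have := hD s u t s0 su ut tT ts.
  by rewrite (_ : _ - _ = Xi s t - Xi s u - Xi u t)// /Xi; zmodule.
have hP s t : 0 <= s -> s <= t -> t <= T ->
    `|tlift VV (P Y Y' s - P U U' s) (XX s t)| <=
      (B ^+ 3 * K * d + B ^+ 3 * dp) * w s * (t - s) `^ beta ^+ 2.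
  move=> s0 st tT; have sT := le_trans st tT; have s0T := inT s0 sT.
  have hxx := hXX s0 st tT; rewrite powR_double in hxx.
  rewrite (le_trans (hl _ _))//.
  have h : `|P Y Y' s - P U U' s| <= B * (d * w s) * K + B * (dp * w s).
    apply: blin_comp_dist => //; [|exact: rY1|exact: (tb_df hf _ s0T)|exact: c2].
    by rewrite (le_trans (tb_df_lip hf _ _ s0T))// ler_wpM2l// c1.
  apply: (@le_trans _ _ (B * (B * (d * w s) * K + B * (dp * w s)) *
    (B * (t - s) `^ beta ^+ 2))).
    by apply: ler_pM => //; [rewrite mulr_ge0|rewrite ler_wpM2l].
  by rewrite le_eqVlt; apply/orP; left; apply/eqP; ring.
have XiE s t : Xi s t = (f s (Y s) - f s (U s)) (X t - X s) +
    tlift VV (P Y Y' s - P U U' s) (XX s t).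
  by rewrite /Xi /germ tliftB !blinB; zmodule.
have Xib s t : 0 <= s -> s <= t -> t <= T -> t - s <= tau ->
    `|Xi s t| <= b * w s * (t - s) `^ beta.
  move=> s0 st tT ts; have [q0 qt q1 qq] := window_powers tau1 st ts.
  have sT := le_trans st tT; have s0T := inT s0 sT.
  have h1 : `|(f s (Y s) - f s (U s)) (X t - X s)| <=
      B * (d * w s) * (B * (t - s) `^ beta).
    apply: blin_norm_le; last exact: hX.
    by rewrite (le_trans (tb_f_lip hf _ _ s0T))// ler_wpM2l// c1.
  have h2 := hP s t s0 st tT.
  rewrite XiE (le_trans (ler_normD _ _))// (le_trans (lerD h1 h2))//.
  set q := (t - s) `^ beta in q0 qt q1 qq h1 h2 *.
  have h3 : (B ^+ 3 * K * d + B ^+ 3 * dp) * w s * q ^+ 2 <=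
      (B ^+ 3 * K * d + B ^+ 3 * dp) * w s * q.
    apply: ler_wpM2l; last by rewrite expr2 ler_piMl.
    by apply: mulr_ge0; [nonneg | exact: w0].
  rewrite (le_trans (lerD (lexx _) h3))// le_eqVlt; apply/orP; left.
  by apply/eqP; rewrite /b; ring.
have XiZ s t : 0 <= s -> s <= t -> t <= T -> sews Xi s t (Zd t - Zd s).
  move=> s0 st tT; have -> : Zd t - Zd s = (Z t - Z s) - (ZU t - ZU s).
    by rewrite /Zd; zmodule.
  exact: sewsB (HZ s t s0 st tT) (HZU s t s0 st tT).
have [hZ1 _ hZ3] := sewn_bounds hw tau0 tau1 a0 b0 Zd0 Xi0 XiD Xib XiZ.
rewrite -kpE in hZ1 hZ3.
set c := b + _ in hZ3.
have cc0 : 0 <= c by apply: addr_ge0 => //; exact: mulr_ge0.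
have cdh : c <= c0 * dh.
  have -> : c0 * dh = B ^+ 2 * dh + B ^+ 3 * K * dh + B ^+ 3 * dh +
      kp * (Cd * (dh * E)) by rewrite c0E; ring.
  rewrite /c /b lerD2r; apply: lerD; last by apply: ler_wpM2l => //; nonneg.
  by apply: lerD; apply: ler_wpM2l => //; nonneg.
set tb := tau `^ beta; have tb0 : 0 <= tb by exact: powR_ge0.
have tb1 : tb <= 1 by apply: powR_le1 => //; exact: ltW.
have ttb : tau <= tb by exact: tau_le_powR.
pose g s := drift Y Z s - drift U ZU s.
pose m := B * d + 2 * B * c * tb.
have m0 : 0 <= m by rewrite /m; nonneg.
have hg t : 0 <= t -> t <= T -> `|g t| <= m * w t.
  by move=> t0 tT; exact: (drift_dist cl hZ3).
have cg : ucont 0 T g by exact: ucontB.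
have HCd' t : 0 <= t -> t <= T -> sews (conv_germ S g t) 0 t (Cv t - CU t).
  by move=> t0 tT; exact: conv_sub (HC t t0 tT) (HCU t t0 tT).
have conv1 t (t0 : 0 <= t) (tT : t <= T) := conv_bound hM hw tau0 m0 hg t0 tT (HCd' t t0 tT).
have tbdh0 : 0 <= tb * dh by exact: mulr_ge0.
split.
- move=> t t0 tT; rewrite HY1// HU1//.
  have -> : i1 (S t x0) + i1 (Cv t) + i2 (Z t) - (i1 (S t x0) + i1 (CU t) + i2 (ZU t))
    = i1 (Cv t - CU t) + i2 (Zd t) by rewrite /Zd !blinBr; zmodule.
  have h2 : `|i1 (Cv t - CU t)| <= B * (B * m * tau * w t).
    by apply: blin_norm_le => //; exact: conv1.
  have h3 : `|i2 (Zd t)| <= B * (2 * c * tb * w t).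
    by apply: blin_norm_le => //; exact: hZ3.
  rewrite (le_trans (ler_normD _ _))// (le_trans (lerD h2 h3))//.
  have h4 : m * tau <= (B * d + 2 * B * c) * tb.
    apply: ler_pM => //; first exact: ltW.
    by rewrite /m lerD2l ler_piMr//; nonneg.
  have h5 : (B * d + 2 * B * c) * tb <= (B * dh + 2 * B * (c0 * dh)) * tb.
    by rewrite ler_wpM2r// lerD// ler_wpM2l//; nonneg.
  have h6 : B * (B * m * tau * w t) <= B ^+ 2 * ((B * dh + 2 * B * (c0 * dh)) * tb) * w t.
    rewrite (_ : B * _ = B ^+ 2 * (m * tau) * w t); last by ring.
    by rewrite ler_wpM2r ?w0// ler_wpM2l//; exact: le_trans h5.
  have h7 : B * (2 * c * tb * w t) <= B * (2 * (c0 * dh) * tb * w t).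
    by rewrite ler_wpM2l// ler_wpM2r ?w0// ler_wpM2r// ler_wpM2l.
  apply: (le_trans (lerD h6 h7)).
  apply: (@le_trans _ _ (CA * (tb * dh) * w t)).
    by rewrite le_eqVlt; apply/orP; left; apply/eqP; rewrite /CA; ring.
  by rewrite ler_wpM2r ?w0// ler_wpM2r.
- move=> t t0 tT; rewrite -blin_compBr (le_trans (blin_comp_norm _ _))//.
  apply: (@le_trans _ _ (B * (B * (d * w t)))).
    apply: ler_pM => //; rewrite (le_trans (tb_f_lip hf _ _ (inT t0 tT)))//.
    by rewrite ler_wpM2l// c1.
  by rewrite !mulrA -expr2 ler_wpM2r ?w0// ler_wpM2r.
- move=> s t s0 st tT ts; have [q0 qt q1 qq] := window_powers tau1 st ts.
  apply: (le_trans (noise_incr_dist hw tau0 tau1 K0 d0 dp0 dh0 rY rU cl s0 st tT ts)).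
  rewrite ler_wpM2r// ler_wpM2r ?w0// -/tb -k1E.
  apply: (@le_trans _ _ (CC * (d + dp + tb * dh))); last first.
    by rewrite ler_wpM2r// !addr_ge0.
  have [l1 l2 l3 _ _] := le_sum5 d0 dp0 tbdh0 (lexx 0) (lexx 0).
  rewrite /= !addr0 in l1 l2 l3.
  rewrite (_ : _ + _ = B ^+ 2 * (E + k1 + k1 ^+ 2) * d +
    B ^+ 2 * (1 + 2 * k1 + k1 ^+ 2) * B * dp +
    B ^+ 2 * (1 + 2 * k1 + k1 ^+ 2) * (tb * dh)); last by ring.
  apply: absorbD l3 _; first by nonneg.
  by apply: absorbD l2 _; [nonneg | apply: ler_wpM2l l1; nonneg].
move=> s t s0 st tT ts; have [q0 qt q1 qq] := window_powers tau1 st ts.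
have t0 := le_trans s0 st; have sT := le_trans st tT.
have h2 := conv_incr hS hM hw tau0 m0 hg hi1 B0 hlip cg tau1 s0 st tT ts
  (HCd' s s0 sT) (HCd' t t0 tT).
have h3 : `|i2 (Zd t - Zd s - Xi s t)| <=
    B * (kp * (Cd * (dh * E)) * w s * (t - s) `^ beta ^+ 3).
  by apply: blin_norm_le => //; exact: hZ1.
have h4 : `|i2 (tlift VV (P Y Y' s - P U U' s) (XX s t))| <=
    B * ((B ^+ 3 * K * d + B ^+ 3 * dp) * w s * (t - s) `^ beta ^+ 2).
  by apply: blin_norm_le => //; exact: hP.
have -> : Rem Y1 (noise Y) s t - Rem U1 (noise U) s t =
   (i1 (Cv t - CU t) - i1 (Cv s - CU s)) + i2 (Zd t - Zd s - Xi s t) +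
   i2 (tlift VV (P Y Y' s - P U U' s) (XX s t)).
  rewrite /remainder XiE; move: (X t - X s) (tlift _ _ _) => x y.
  rewrite !HY1// !HU1// /Zd !blinB !blinBr blinDr blinBr -[noise Y s x]/(i2 (f s (Y s) x)).
  by zmodule.
set q := (t - s) `^ beta in q0 qt q1 qq h3 h4 *.
have q20 : 0 <= q ^+ 2 by rewrite sqr_ge0.
have ws0 := w0 s s0.
rewrite (le_trans (ler_normD _ _))//.
apply: (le_trans (lerD (le_trans (ler_normD _ _) (lerD h2 h3)) h4)).
have m' : m <= B * d + 2 * B * c0 * (tb * dh).
  rewrite /m lerD2l (_ : 2 * B * c0 * (tb * dh) = 2 * B * (c0 * dh) * tb); last by ring.
  by rewrite ler_wpM2r// ler_wpM2l//; nonneg.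
have h6 : 2 * B * B * m * E * w s * (t - s) <=
    2 * B ^+ 2 * (B * d + 2 * B * c0 * (tb * dh)) * E * (w s * q ^+ 2).
  rewrite (_ : 2 * B * B * m * E * w s * (t - s) = 2 * B ^+ 2 * m * E * (w s * (t - s)));
    last by ring.
  apply: ler_pM; [by nonneg|by rewrite mulr_ge0// subr_ge0| |exact: ler_wpM2l].
  by rewrite ler_wpM2r// ler_wpM2l//; nonneg.
have h7 : B * (kp * (Cd * (dh * E)) * w s * q ^+ 3) <=
    B * kp * Cd * E * (tb * dh) * (w s * q ^+ 2).
  rewrite (_ : B * _ = B * kp * Cd * E * dh * (w s * q ^+ 2) * q); last by ring.
  rewrite (_ : B * kp * Cd * E * (tb * dh) * (w s * q ^+ 2) =
    B * kp * Cd * E * dh * (w s * q ^+ 2) * tb); last by ring.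
  by apply: ler_wpM2l => //; nonneg.
apply: (le_trans (lerD (lerD h6 h7) (lexx _))).
have [l1 l2 l3 _ _] := le_sum5 d0 dp0 tbdh0 (lexx 0) (lexx 0).
rewrite /= !addr0 in l1 l2 l3.
rewrite -[leRHS]mulrA.
rewrite [leLHS](_ : _ = ((2 * B ^+ 3 * E + B ^+ 4 * K) * d + B ^+ 4 * dp +
  (4 * B ^+ 3 * E * c0 + B * kp * Cd * E) * (tb * dh)) * (w s * q ^+ 2)); last by ring.
rewrite ler_wpM2r ?mulr_ge0//.
apply: (@le_trans _ _ (CD * (d + dp + tb * dh))); last first.
  by rewrite ler_wpM2r// !addr_ge0.
apply: absorbD l3 _; first by nonneg.
by apply: absorbD l2 _; [nonneg | apply: ler_wpM2l l1; nonneg].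
Qed.

Lemma regular_le tau tau' K K' Y Y' : tau' <= tau -> K <= K' ->
  regular tau K Y Y' -> regular tau' K' Y Y'.
Proof.
move=> tt KK [r1 r2 r3]; split.
- by move=> t t0 tT; apply: le_trans KK; exact: r1.
- move=> s t s0 st tT ts; apply: (le_trans (r2 s t s0 st tT (le_trans ts tt))).
  by rewrite ler_wpM2r// powR_ge0.
- move=> s t s0 st tT ts; apply: (le_trans (r3 s t s0 st tT (le_trans ts tt))).
  by rewrite ler_wpM2r// exprn_ge0// powR_ge0.
Qed.

(** The contraction constant depends on unweighted sizes of the paths; the weight at [T] is absorbed
    here once and for all. *)
Lemma growth_regular tau E w M b K Y Y' : weight tau E w -> 0 <= M -> 0 <= K ->
  growth_bound tau w M b K Y Y' -> regular tau (M + K * w T) Y Y'.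
Proof.
move=> hw M0 K0 [g1 g2 g3 g4].
have wT0 : 0 <= w T by exact: (weight_ge0 hw).
have le s t : 0 <= s -> s <= t -> t <= T -> K * w s <= M + K * w T.
  move=> s0 st tT; apply: (@le_trans _ _ (K * w T)); last by rewrite lerDr.
  by rewrite ler_wpM2l// (weight_mono hw)// (le_trans st).
split.
- by move=> t t0 tT; rewrite (le_trans (g2 t t0 tT))// lerDl mulr_ge0.
- move=> s t s0 st tT ts; apply: (le_trans (g3 s t s0 st tT ts)).
  by rewrite ler_wpM2r ?powR_ge0// (le s t).
- move=> s t s0 st tT ts; apply: (le_trans (g4 s t s0 st tT ts)).
  by rewrite ler_wpM2r ?exprn_ge0 ?powR_ge0// (le s t).
Qed.

Lemma close_le tau E w d dp dh d' dp' dh' Y Y' U U' : weight tau E w ->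
  d <= d' -> dp <= dp' -> dh <= dh' ->
  close tau w d dp dh Y Y' U U' -> close tau w d' dp' dh' Y Y' U U'.
Proof.
move=> hw h1 h2 h3 [c1 c2 c3 c4].
have w0 t : 0 <= t -> 0 <= w t by exact: (weight_ge0 hw).
split.
- by move=> t t0 tT; rewrite (le_trans (c1 t t0 tT))// ler_wpM2r ?w0.
- by move=> t t0 tT; rewrite (le_trans (c2 t t0 tT))// ler_wpM2r ?w0.
- move=> s t s0 st tT ts; rewrite (le_trans (c3 s t s0 st tT ts))//.
  by rewrite ler_wpM2r ?powR_ge0// ler_wpM2r ?w0.
- move=> s t s0 st tT ts; rewrite (le_trans (c4 s t s0 st tT ts))//.
  by rewrite ler_wpM2r ?exprn_ge0 ?powR_ge0// ler_wpM2r ?w0.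
Qed.

Lemma close_trans tau w d dp dh e ep eh Y Y' U U' P P' :
  close tau w d dp dh Y Y' U U' -> close tau w e ep eh U U' P P' ->
  close tau w (d + e) (dp + ep) (dh + eh) Y Y' P P'.
Proof.
have tri (E : normedModType R) (x y z : E) (p q : R) :
    `|x - y| <= p -> `|y - z| <= q -> `|x - z| <= p + q.
  move=> xy yz; have -> : x - z = (x - y) + (y - z) by zmodule.
  by rewrite (le_trans (ler_normD _ _))// lerD.
move=> [c1 c2 c3 c4] [e1 e2 e3 e4]; split.
- by move=> t t0 tT; rewrite mulrDl; apply: tri (c1 t t0 tT) (e1 t t0 tT).
- by move=> t t0 tT; rewrite mulrDl; apply: tri (c2 t t0 tT) (e2 t t0 tT).
- move=> s t s0 st tT ts; rewrite !mulrDl.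
  by apply: tri (c3 s t s0 st tT ts) (e3 s t s0 st tT ts).
- move=> s t s0 st tT ts; rewrite !mulrDl.
  by apply: tri (c4 s t s0 st tT ts) (e4 s t s0 st tT ts).
Qed.

Definition closeL tau w L d Y Y' U U' := close tau w d (d * L) (d * L ^+ 2) Y Y' U U'.

(** Any two regular bounded pairs are at finite distance, since [w] and [L] are at least 1; this
    starts the repeated halving. *)
Lemma regular_close tau E w K b L Y Y' U U' : weight tau E w -> 0 <= K -> 0 <= b ->
  1 <= L -> regular tau K Y Y' -> regular tau K U U' ->
  (forall t, 0 <= t -> t <= T -> `|Y t| <= b) ->
  (forall t, 0 <= t -> t <= T -> `|U t| <= b) ->
  closeL tau w L (2 * (b + K)) Y Y' U U'.
Proof.
move=> hw K0 b0 L1 [r1 r2 r3] [u1 u2 u3] hY hU.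
have L0 := le_trans ler01 L1.
have w1 t : 0 <= t -> 1 <= w t by exact: (weight_ge1 hw).
pose d := 2 * (b + K); have d0 : 0 <= d by rewrite /d; nonneg.
have dK : 2 * K <= d by rewrite /d ler_wpM2l// lerDr.
have db : 2 * b <= d by rewrite /d ler_wpM2l// lerDl.
have dif (E' : normedModType R) (x y : E') (p : R) : `|x| <= p -> `|y| <= p ->
    `|x - y| <= 2 * p.
  by move=> hx hy; rewrite (le_trans (ler_normB _ _))// mulr2n mulrDl mul1r lerD.
have up (p c w' : R) : 0 <= p -> 2 * p <= d -> 1 <= c -> 1 <= w' -> 2 * p <= d * c * w'.
  move=> p0 pd c1 w1'; apply: (le_trans pd); rewrite -mulrA ler_peMr//.
  by rewrite -[1]mulr1 ler_pM.
have L2 : 1 <= L ^+ 2 by exact: exprn_ege1.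
split; rewrite -/d.
- move=> t t0 tT; apply: (le_trans (dif _ _ _ _ (hY t t0 tT) (hU t t0 tT))).
  by rewrite -[d]mulr1; apply: up => //; exact: w1.
- move=> t t0 tT; apply: (le_trans (dif _ _ _ _ (r1 t t0 tT) (u1 t t0 tT))).
  by apply: up => //; exact: w1.
- move=> s t s0 st tT ts.
  apply: (le_trans (dif _ _ _ _ (r2 s t s0 st tT ts) (u2 s t s0 st tT ts))).
  by rewrite mulrA ler_wpM2r ?powR_ge0//; apply: up => //; exact: w1.
- move=> s t s0 st tT ts.
  apply: (le_trans (dif _ _ _ _ (r3 s t s0 st tT ts) (u3 s t s0 st tT ts))).
  by rewrite mulrA ler_wpM2r ?exprn_ge0 ?powR_ge0//; apply: up => //; exact: w1.
Qed.

Lemma quarter_bound (c t x : R) : 0 <= t * x -> 4 * (c + 1) * x * t <= 1 ->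
  c * t * x <= 4^-1.
Proof. lra. Qed.

Lemma quarter_sum (p q x : R) : p <= x / 4 -> q <= 4^-1 -> 1 <= x -> p + q <= x / 2.
Proof. lra. Qed.

Lemma double_le (c : R) : 0 <= c -> 2 * c <= 1 + 8 * c.
Proof. lra. Qed.

(* The image of a pair at distance [d] in [Y] is at distance [O(d)] in [Y'] and
   [O(d L)] in the Hoelder seminorms, up to terms carrying the small factor
   [tau `^ beta]; weighting these parts by [L] and [L ^+ 2] yields a contraction. *)
Lemma picard_half (K taub : R) : 0 <= K -> 0 < taub -> exists tau w L,
  [/\ 0 < tau, tau <= taub, tau <= 1, weight tau (expR 1) w & 1 <= L] /\
  forall d Y Y' Z Cv Y1 U U' ZU CU U1, 0 <= d ->
    regular tau K Y Y' -> regular tau K U U' -> closeL tau w L d Y Y' U U' ->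
    picard Y Y' Z Cv Y1 -> picard U U' ZU CU U1 ->
    closeL tau w L (d / 2) Y1 (noise Y) U1 (noise U).
Proof.
move=> K0 tb0.
have E1 : 1 <= expR 1 :> R by have := expR_ge1Dx (1 : R); lra.
have [C C0 HC] := picard_contraction E1 K0.
(* This gives [2 * C <= L] and [4 * C * (1 + L) <= L ^+ 2], which settles the terms without a small
   factor; [tau] is then chosen so that [C] times its power times [L ^+ 2] is at most 1/4. *)
pose L := 1 + 8 * C; have L1 : 1 <= L by rewrite lerDl mulr_ge0.
have L0 := le_trans ler01 L1.
have L21 : 1 <= L ^+ 2 by exact: exprn_ege1.
have den : 0 < 4 * (C + 1) * L ^+ 2.
  apply: mulr_gt0; last exact: (lt_le_trans ltr01).
  by apply: mulr_gt0 => //; exact: ltr_wpDl.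
have [|tau3 [t30 t31 Ht3]] := @exists_small_powR _ beta (4 * (C + 1) * L ^+ 2)^-1 beta0.
  by rewrite invr_gt0.
pose tau := Num.min taub tau3.
have tau0 : 0 < tau by rewrite lt_min tb0.
have tau1 : tau <= 1 by rewrite ge_min t31 orbT.
have hw := exp_weight tau0.
exists tau, (fun t => expR (t / tau)), L; split.
  by split => //; rewrite ge_min lexx.
move=> d Y Y' Z Cv Y1 U U' ZU CU U1 d0 rY rU cl pY pU.
have d1 : d <= d * L ^+ 2 by rewrite ler_peMr.
have d2 : 0 <= d * L by rewrite mulr_ge0.
have d3 : d * L <= d * L ^+ 2 by rewrite ler_wpM2l// expr2 ler_peMl.
have := HC tau _ d (d * L) (d * L ^+ 2) _ _ _ _ _ _ _ _ _ _ hw tau0 tau1 d0 d1 d2 d3 rY rU cl pY pU.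
set tb := tau `^ beta.
have tb00 : 0 <= tb by exact: powR_ge0.
have htb : 4 * (C + 1) * L ^+ 2 * tb <= 1.
  rewrite mulrC -ler_pdivlMr// div1r (le_trans _ Ht3)//.
  by apply: powR_mono => //; [exact: ltW | rewrite ge_min lexx orbT].
have h1 : C * tb * L ^+ 2 <= 4^-1.
  by apply: quarter_bound => //; rewrite mulr_ge0// exprn_ge0.
apply: close_le hw _ _ _.
- rewrite (_ : C * _ = d * (C * tb * L ^+ 2)); last by ring.
  by rewrite ler_wpM2l// (le_trans h1)// lef_pV2 ?posrE// ler_nat.
- rewrite mulrC -mulrA ler_wpM2l// -ler_pdivrMl// invrK.
  by rewrite double_le.
rewrite (_ : C * _ = d * (C * (1 + L) + C * tb * L ^+ 2)); last by ring.
rewrite -[leRHS]mulrA ler_wpM2l// [2^-1 * _]mulrC; apply: quarter_sum => //.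
rewrite -subr_ge0 /L (_ : _ - _ = 4^-1 + 2 * C + 8 * C ^+ 2); last by field.
by rewrite !addr_ge0 ?mulr_ge0 ?exprn_ge0.
Qed.

Lemma small_pow2 (c e : R) : 0 <= c -> 0 < e -> exists N, forall n, (N <= n)%N ->
  c / 2 ^+ n <= e.
Proof.
move=> c0 e0; exists (Num.Def.truncn (c / e)) => n Nn.
rewrite ler_pdivrMr ?exprn_gt0// mulrC -ler_pdivrMr//.
rewrite (le_trans (ltW (truncnS_gt _)))// -natrX ler_nat.
by rewrite (leq_ltn_trans Nn)// ltn_expl.
Qed.

(** The pair of fixed points is its own image, so its finite distance can be halved indefinitely,
    once both are regular for a common constant on a common window. *)
Theorem picard_unique tau tau' K K' b b' Y Z C U ZU CU : 0 < tau -> 0 < tau' ->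
  regular tau K Y (noise Y) -> regular tau' K' U (noise U) ->
  (forall t, 0 <= t -> t <= T -> `|Y t| <= b) ->
  (forall t, 0 <= t -> t <= T -> `|U t| <= b') ->
  picard Y (noise Y) Z C Y -> picard U (noise U) ZU CU U ->
  forall t, 0 <= t -> t <= T -> Y t = U t.
Proof.
move=> tau0 tau'0 rY rU hY hU pY pU t t0 tT.
pose K2 := `|K| + `|K'|; have K20 : 0 <= K2 by rewrite addr_ge0.
have KK : K <= K2 by rewrite (le_trans (ler_norm _))// lerDl.
have KK' : K' <= K2 by rewrite (le_trans (ler_norm _))// lerDr.
have mt0 : 0 < Num.min tau tau' by rewrite lt_min tau0.
have [tau2 [w [L [[t20 t2m t21 hw L1] H]]]] := picard_half K20 mt0.
have rY2 : regular tau2 K2 Y (noise Y).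
  by apply: regular_le KK rY; rewrite (le_trans t2m)// ge_min lexx.
have rU2 : regular tau2 K2 U (noise U).
  by apply: regular_le KK' rU; rewrite (le_trans t2m)// ge_min lexx orbT.
pose bb := `|b| + `|b'|; have bb0 : 0 <= bb by rewrite addr_ge0.
have cl0 : closeL tau2 w L (2 * (bb + K2)) Y (noise Y) U (noise U).
  apply: (regular_close hw) => // s s0 sT.
    by rewrite (le_trans (hY s s0 sT))// (le_trans (ler_norm _))// lerDl.
  by rewrite (le_trans (hU s s0 sT))// (le_trans (ler_norm _))// lerDr.
set d := 2 * _ in cl0.
have d0 : 0 <= d by rewrite /d; nonneg.
have cln n : closeL tau2 w L (d / 2 ^+ n) Y (noise Y) U (noise U).
  elim: n => [|n IH]; first by rewrite expr0 divr1.
  rewrite exprSr invfM mulrA; apply: H rY2 rU2 IH pY pU.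
  by rewrite divr_ge0// exprn_ge0.
apply/eqP; rewrite -subr_eq0 -normr_le0; apply/ler_addgt0Pl => e e0; rewrite addr0.
have wt0 := weight_ge0 hw t0.
have [N HN] := small_pow2 (mulr_ge0 d0 wt0) e0.
have [c1 _ _ _] := cln N; rewrite (le_trans (c1 t t0 tT))//.
by rewrite mulrAC HN.
Qed.

(** * Existence of the fixed point *)

Lemma geometric_limit (E : completeNormedModType R) (u : nat -> E) (c : R) :
  0 <= c -> (forall n, `|u n - u n.+1| <= c / 2 ^+ n) ->
  exists l, forall e : R, 0 < e -> exists N, forall n, (N <= n)%N -> `|u n - l| <= e.
Proof.
move=> c0 H; apply: cauchy_eps_cvg.
have H2 m n : `|u n - u (n + m)%N| <= 2 * c / 2 ^+ n.
  elim: m n => [|m IH] n.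
    by rewrite addn0 subrr normr0 divr_ge0 ?mulr_ge0// exprn_ge0.
  have -> : u n - u (n + m.+1)%N = (u n - u n.+1) + (u n.+1 - u (n.+1 + m)%N).
    by rewrite addnS addSn; zmodule.
  rewrite (le_trans (ler_normD _ _))// (le_trans (lerD (H n) (IH n.+1)))//.
  have p0 : 2 ^+ n != 0 :> R by rewrite expf_neq0.
  rewrite exprS (_ : 2 * c / (2 * 2 ^+ n) = c / 2 ^+ n); last by field.
  by rewrite le_eqVlt; apply/orP; left; apply/eqP; ring.
move=> e e0; have [N HN] := small_pow2 (mulr_ge0 (ler0n R 2) c0) (divr_gt0 e0 (ltr0n R 2)).
exists N => m n Nm Nn.
have h1 := H2 (m - N)%N N; have h2 := H2 (n - N)%N N.
rewrite !subnKC// in h1 h2.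
have := HN N (leqnn N) => h3.
have -> : u m - u n = (u N - u n) - (u N - u m) by zmodule.
by rewrite (le_trans (ler_normB _ _))//; lra.
Qed.

Lemma norm_lim_le (E : normedModType R) (v : nat -> E) (x l : E) (c : R) N :
  v n @[n --> \oo] --> l -> (forall n, (N <= n)%N -> `|x - v n| <= c) ->
  `|x - l| <= c.
Proof.
move=> /cvgrPdist_le cv H; apply/ler_addgt0Pl => e e0.
have [n0 _ Hn0] := cv e e0.
have h1 := Hn0 (maxn n0 N) (leq_maxl _ _); have h2 := H (maxn n0 N) (leq_maxr _ _).
rewrite /= in h1.
have -> : x - l = - (l - v (maxn n0 N)) + (x - v (maxn n0 N)) by zmodule.
by rewrite (le_trans (ler_normD _ _))// normrN lerD.
Qed.

Lemma cvg_blin_app (E F : normedModType R) (L : nat -> blin E F) (L0 : blin E F) x :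
  L n @[n --> \oo] --> L0 -> L n x @[n --> \oo] --> L0 x.
Proof.
move=> /cvgrPdist_le cL; apply/cvgrPdist_le => e e0.
have x1 : 0 < `|x| + 1 by exact: ltr_wpDl.
have [n0 _ Hn0] := cL _ (divr_gt0 e0 x1); exists n0 => // n /= /Hn0 /= h.
rewrite -blinB (le_trans (blin_norm_le h (lexx _)))//.
by rewrite mulrAC ler_pdivrMr// ler_wpM2l ?ltW// ltrDl.
Qed.

(** Pointwise convergence suffices, as the inequalities in [growth_bound] and [close] pass to
    pointwise limits; no norm on the space of controlled paths has to be set up. *)
Definition tends (u : nat -> (R -> W) * (R -> blin V W)) Y Y' :=
  forall t, 0 <= t -> t <= T -> (u n).1 t @[n --> \oo] --> (Y t : W) /\
    (u n).2 t @[n --> \oo] --> (Y' t : blin V W).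

Lemma tends_remainder u Y Y' s t : tends u Y Y' -> 0 <= s -> s <= t -> t <= T ->
  Rem (u n).1 (u n).2 s t @[n --> \oo] --> Rem Y Y' s t.
Proof.
move=> H s0 st tT; have [cs cs'] := H s s0 (le_trans st tT).
have [ct _] := H t (le_trans s0 st) tT.
by apply: cvgB; [exact: cvgB | exact: cvg_blin_app].
Qed.

Lemma tends_growth u Y Y' tau w M b K : tends u Y Y' ->
  (forall n, growth_bound tau w M b K (u n).1 (u n).2) -> growth_bound tau w M b K Y Y'.
Proof.
move=> H G; have lim0 (E : normedModType R) (v : nat -> E) l c :
    v n @[n --> \oo] --> l -> (forall n, `|v n| <= c) -> `|l| <= c.
  move=> cv hv; rewrite -normrN -sub0r; apply: (norm_lim_le (N := 0) cv) => n _.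
  by rewrite sub0r normrN.
split.
- move=> t t0 tT; have [c1 c2] := H t t0 tT; apply: lim0 c1 _ => n.
  by have [g1 g2 g3 g4] := G n; exact: g1.
- move=> t t0 tT; have [c1 c2] := H t t0 tT; apply: lim0 c2 _ => n.
  by have [g1 g2 g3 g4] := G n; exact: g2.
- move=> s t s0 st tT ts; have [c1 c2] := H t (le_trans s0 st) tT.
  have [d1 d2] := H s s0 (le_trans st tT); apply: lim0 (cvgB c2 d2) _ => n.
  by have [g1 g2 g3 g4] := G n; exact: g3.
- move=> s t s0 st tT ts; apply: lim0 (tends_remainder H s0 st tT) _ => n.
  by have [g1 g2 g3 g4] := G n; exact: g4.
Qed.

Lemma tends_close u Y Y' U U' tau w d dp dh N : tends u Y Y' ->
  (forall n, (N <= n)%N -> close tau w d dp dh U U' (u n).1 (u n).2) ->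
  close tau w d dp dh U U' Y Y'.
Proof.
move=> H G; split.
- move=> t t0 tT; have [c1 c2] := H t t0 tT; apply: norm_lim_le c1 _ => n Nn.
  by have [g1 g2 g3 g4] := G n Nn; exact: g1.
- move=> t t0 tT; have [c1 c2] := H t t0 tT; apply: norm_lim_le c2 _ => n Nn.
  by have [g1 g2 g3 g4] := G n Nn; exact: g2.
- move=> s t s0 st tT ts; have [c1 c2] := H t (le_trans s0 st) tT.
  have [d1 d2] := H s s0 (le_trans st tT); apply: norm_lim_le (cvgB c2 d2) _ => n Nn.
  by have [g1 g2 g3 g4] := G n Nn; exact: g3.
- move=> s t s0 st tT ts; apply: norm_lim_le (tends_remainder H s0 st tT) _ => n Nn.
  by have [g1 g2 g3 g4] := G n Nn; exact: g4.
Qed.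

Lemma growth_absorb (C x b K p : R) : 0 <= C -> p * (1 + b + K) <= 1 ->
  0 <= p -> 0 <= b -> 0 <= K -> C * (1 + x + p * (1 + b + K)) <= C * (2 + x) /\
  C * (1 + x + b + p * (1 + K)) <= C * (2 + x + b).
Proof.
move=> C0 h p0 b0 K0; have pb : 0 <= p * b by exact: mulr_ge0.
have pK : p * (1 + b + K) = p + p * b + p * K by ring.
have pK' : p * (1 + K) = p + p * K by ring.
by split; apply: ler_wpM2l => //; lra.
Qed.

Lemma growth_bound_le tau w M b K b' K' Y Y' E : weight tau E w -> b <= b' -> K <= K' ->
  growth_bound tau w M b K Y Y' -> growth_bound tau w M b' K' Y Y'.
Proof.
move=> hw bb KK [g1 g2 g3 g4].
have w0 t : 0 <= t -> 0 <= w t by exact: (weight_ge0 hw).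
split => //.
- by move=> t t0 tT; rewrite (le_trans (g1 t t0 tT))// ler_wpM2r ?w0.
- move=> s t s0 st tT ts; rewrite (le_trans (g3 s t s0 st tT ts))//.
  by rewrite ler_wpM2r ?powR_ge0// ler_wpM2r ?w0.
- move=> s t s0 st tT ts; rewrite (le_trans (g4 s t s0 st tT ts))//.
  by rewrite ler_wpM2r ?exprn_ge0 ?powR_ge0// ler_wpM2r ?w0.
Qed.

Lemma growth_invariant : exists tau w b K,
  [/\ 0 < tau, tau <= 1, weight tau (expR 1) w, 0 <= b & 0 <= K] /\
  forall Y Y' Z C Y1, growth_bound tau w (B ^+ 2) b K Y Y' -> picard Y Y' Z C Y1 ->
    growth_bound tau w (B ^+ 2) b K Y1 (noise Y).
Proof.
have BB0 : 0 <= B ^+ 2 by exact: exprn_ge0.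
have [C C0 HC] := picard_growth (expR_ge0 1) BB0.
(* The summands carrying a power of [tau] in [picard_growth] will add at most 1, which turns
   [1 + |x0|] into [2 + |x0|]; [tau] is chosen last. *)
pose b := C * (2 + `|x0|); have b0 : 0 <= b by rewrite /b; nonneg.
pose K := C * (2 + `|x0| + b); have K0 : 0 <= K by rewrite /K; nonneg.
have s0 : 0 < 1 + b + K by rewrite -addrA ltr_wpDr ?addr_ge0.
have [|tau [t0 t1 Ht]] := @exists_small_powR _ beta (1 + b + K)^-1 beta0.
  by rewrite invr_gt0.
have hw := exp_weight t0.
exists tau, (fun t => expR (t / tau)), b, K; split; first by split.
move=> Y Y' Z Cv Y1 hY pY; have := HC _ _ _ _ _ _ _ _ _ hw t0 t1 b0 K0 hY pY.
have h : tau `^ beta * (1 + b + K) <= 1 by rewrite -ler_pdivlMr// div1r.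
have [h1 h2] := growth_absorb `|x0| C0 h (powR_ge0 _ _) b0 K0.
exact: growth_bound_le hw h1 h2.
Qed.

(** Two windows occur: [tg] belongs to the invariant set, which bounds every iterate by [K'] without
    weights, and the contraction holds on a window [tau] no longer than [tg] that depends on
    [K']. *)
Theorem picard_fixpoint : exists tau K b Y Z C,
  [/\ 0 < tau, tau <= 1, 0 <= K & 0 <= b] /\
  [/\ regular tau K Y (noise Y), forall t, 0 <= t -> t <= T -> `|Y t| <= b &
    picard Y (noise Y) Z C Y].
Proof.
have BB0 : 0 <= B ^+ 2 by exact: exprn_ge0.
have [tg [wg [b [K [[tg0 tg1 hwg b0 K0] Hinv]]]]] := growth_invariant.
pose G (u : (R -> W) * (R -> blin V W)) := growth_bound tg wg (B ^+ 2) b K u.1 u.2.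
have wg0 t : 0 <= t -> 0 <= wg t by exact: (weight_ge0 hwg).
have G0 : G (fun=> 0, fun=> 0).
  split => [t t0 tT|t t0 tT|s t s0 st tT ts|s t s0 st tT ts] /=.
  - by rewrite normr0 mulr_ge0// wg0.
  - by rewrite normr0.
  - by rewrite subrr normr0 !mulr_ge0 ?wg0 ?powR_ge0.
  - by rewrite /remainder subrr sub0r normrN normr0 !mulr_ge0 ?wg0 ?exprn_ge0 ?powR_ge0.
(* The invariant travels in a sigma type, so that choice yields a map that can be iterated. *)
have next (u : {u | G u}) : exists v : {u | G u}, exists Z C,
    picard (sval u).1 (sval u).2 Z C (sval v).1 /\ (sval v).2 = noise (sval u).1.
  case: u => [[Y Y'] hY] /=.
  have [Z [C [Y1 pY]]] := picard_exists hwg (expR_ge0 1) tg0 tg1 BB0 K0 hY.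
  have GY1 : G (Y1, noise Y) by exact: Hinv hY pY.
  by exists (exist _ _ GY1), Z, C.
have [F HF] := choice next.
pose u n := sval (iter n F (exist _ _ G0)).
have Gu n : G (u n) by exact: (svalP (iter n F _)).
have pu n : exists Z C, picard (u n).1 (u n).2 Z C (u n.+1).1.
  by have [Z [C [pc _]]] := HF (iter n F (exist _ _ G0)); exists Z, C.
have uS n : (u n.+1).2 = noise (u n).1.
  by have [Z [C [_ e]]] := HF (iter n F (exist _ _ G0)).
pose K' := B ^+ 2 + K * wg T.
have K'0 : 0 <= K' by rewrite addr_ge0// mulr_ge0// wg0.
have [tau [w [L [[t0 ttg t1 hw L1] H]]]] := picard_half K'0 tg0.
have w0 t : 0 <= t -> 0 <= w t by exact: (weight_ge0 hw).
have reg Y Y' : growth_bound tg wg (B ^+ 2) b K Y Y' -> regular tau K' Y Y'.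
  by move=> hY; apply: regular_le ttg (lexx _) _; exact: growth_regular hwg BB0 K0 hY.
pose bb := b * wg T; have bb0 : 0 <= bb by rewrite mulr_ge0// wg0.
have bnd Y Y' : growth_bound tg wg (B ^+ 2) b K Y Y' ->
    forall t, 0 <= t -> t <= T -> `|Y t| <= bb.
  move=> [g1 _ _ _] t t_ge0 tT; rewrite (le_trans (g1 t t_ge0 tT))// ler_wpM2l//.
  exact: (weight_mono hwg).
pose d := 2 * (bb + K').
have d0 : 0 <= d by rewrite mulr_ge0// addr_ge0.
have dn0 n : 0 <= d / 2 ^+ n by rewrite divr_ge0// exprn_ge0.
have cl n : closeL tau w L (d / 2 ^+ n) (u n).1 (u n).2 (u n.+1).1 (u n.+1).2.
  elim: n => [|n IH].
    rewrite expr0 divr1; apply: (regular_close hw) => //; [exact/reg/Gu|exact/reg/Gu| |].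
      exact: bnd (Gu 0).
    exact: bnd (Gu 1).
  have [Z [C p1]] := pu n; have [Z2 [C2 p2]] := pu n.+1.
  rewrite exprSr invfM mulrA.
  have := H _ _ _ _ _ _ _ _ _ _ _ (dn0 n) (reg _ _ (Gu n)) (reg _ _ (Gu n.+1)) IH p1 p2.
  by rewrite -!uS.
have cl2 m n : closeL tau w L (2 * d / 2 ^+ n) (u n).1 (u n).2 (u (n + m)%N).1 (u (n + m)%N).2.
  elim: m n => [|m IH] n.
    rewrite addn0; have z : 0 <= 2 * d / 2 ^+ n by rewrite -mulrA mulr_ge0.
    have L0 := le_trans ler01 L1.
    by split => [t /w0 wt0 _|t /w0 wt0 _|s t /w0 ws0 _ _ _|s t /w0 ws0 _ _ _];
      rewrite subrr normr0; nonneg.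
  have -> : 2 * d / 2 ^+ n = d / 2 ^+ n + 2 * d / 2 ^+ n.+1.
    by rewrite exprS; field; rewrite expf_neq0.
  have := close_trans (cl n) (IH n.+1); rewrite addSnnS -!mulrDl.
  by [].
have YE t : exists l, 0 <= t -> t <= T -> (u n).1 t @[n --> \oo] --> (l : W).
  have [/andP[t_ge0 tT]|nt] := boolP (0 <= t <= T); last first.
    by exists 0 => h1 h2; rewrite h1 h2 in nt.
  have c0 : 0 <= d * w t by rewrite mulr_ge0// w0.
  have [n|l Hl] := geometric_limit (u := fun n => (u n).1 t) c0.
    by have [c1 _ _ _] := cl n; rewrite mulrAC; exact: c1.
  exists l => _ _; apply/cvgrPdist_le => e e0.
  by have [N HN] := Hl e e0; exists N => // n /= Nn; rewrite distrC HN.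
have [Y HY] := choice YE.
have ten : tends u Y (noise Y).
  move=> t t_ge0 tT; split; first exact: HY.
  (* Each derivative after the initial one is [noise] of the preceding path, hence the shift; its
     convergence follows from that of the paths by the Lipschitz bound on [f]. *)
  rewrite -cvg_shiftS; apply/cvgrPdist_le => e e0.
  have B2 : 0 < B ^+ 2 by rewrite exprn_gt0// (lt_le_trans ltr01).
  have /cvgrPdist_le/(_ _ (divr_gt0 e0 B2)) [N _ HN] := HY t t_ge0 tT.
  exists N => // n /= Nn; have {HN} := HN n Nn; rewrite /= => hn.
  rewrite uS -blin_compBr (le_trans (blin_comp_norm _ _))//.
  have h := le_trans (tb_f_lip hf (Y t) ((u n).1 t) (inT t_ge0 tT)) (ler_wpM2l B0 hn).
  apply: (le_trans (ler_pM (normr_ge0 _) (normr_ge0 _) hi2 h)).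
  by rewrite mulrA -expr2 mulrC divfK// gt_eqF.
have GY : growth_bound tg wg (B ^+ 2) b K Y (noise Y) by exact: tends_growth ten Gu.
have clY n : closeL tau w L (2 * d / 2 ^+ n) (u n).1 (u n).2 Y (noise Y).
  apply: (tends_close (N := n) ten) => m nm.
  by have := cl2 (m - n)%N n; rewrite subnKC.
have [Z [C [Y1 pY]]] := picard_exists hwg (expR_ge0 1) tg0 tg1 BB0 K0 GY.
(* The limit [Y] and its image [Y1] are both within a multiple of [2 ^- N] of the iterate of index
   [N + 1], so they coincide. *)
have Y1E t : 0 <= t -> t <= T -> Y1 t = Y t.
  move=> t_ge0 tT; apply/eqP; rewrite -subr_eq0 -normr_le0.
  apply/ler_addgt0Pl => e e0; rewrite addr0.
  have [|N HN] := @small_pow2 (2 * d * w t) e _ e0.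
    by apply: mulr_ge0; [exact: mulr_ge0 | exact: w0].
  have [Z2 [C2 p2]] := pu N.
  have z : 0 <= 2 * d / 2 ^+ N by rewrite -mulrA mulr_ge0.
  have [c1 _ _ _] := H _ _ _ _ _ _ _ _ _ _ _ z (reg _ _ (Gu N)) (reg _ _ GY) (clY N) p2 pY.
  have [c2 _ _ _] := clY N.+1.
  have -> : Y1 t - Y t = ((u N.+1).1 t - Y t) - ((u N.+1).1 t - Y1 t) by zmodule.
  rewrite (le_trans (ler_normB _ _))// (le_trans (lerD (c2 t t_ge0 tT) (c1 t t_ge0 tT)))//.
  apply: le_trans (HN N (leqnn N)); rewrite le_eqVlt; apply/orP; left; apply/eqP.
  by rewrite exprS; field; rewrite expf_neq0.
exists tau, K', bb, Y, Z, C; split; first by split.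
split; first exact: reg.
  exact: bnd GY.
case: pY => p1 p2 p3 p4 p5; split => // t t_ge0 tT.
by rewrite -Y1E// p5.
Qed.

(** * Regular pairs and controlled paths *)

Lemma regular_incr tau K Y Y' s t : tau <= 1 -> 0 <= K -> regular tau K Y Y' ->
  0 <= s -> s <= t -> t <= T -> t - s <= tau ->
  `|Y t - Y s| <= (K * B + K) * (t - s) `^ beta.
Proof.
move=> tau1 K0 [r1 _ r3] s0 st tT ts; have [q0 _ q1 _] := window_powers tau1 st ts.
have -> : Y t - Y s = Y' s (X t - X s) + Rem Y Y' s t by rewrite /remainder; zmodule.
have h1 := blin_norm_le (r1 s s0 (le_trans st tT)) (hX s0 st tT).
rewrite (le_trans (ler_normD _ _))// (le_trans (lerD h1 (r3 s t s0 st tT ts)))//.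
rewrite mulrA mulrDl lerD2l; apply: ler_wpM2l => //.
by rewrite expr2 ler_piMl.
Qed.

Lemma regular_ucont tau K Y Y' : 0 < tau -> tau <= 1 -> 0 <= K -> regular tau K Y Y' ->
  ucont 0 T Y.
Proof.
move=> tau0 tau1 K0 rY; apply: (holder_ucont tau0 (c := K * B + K)); first by nonneg.
by move=> s t s0 st tT ts; exact: regular_incr rY s0 st tT ts.
Qed.

Lemma regular_growth tau E w K b Y Y' : weight tau E w -> 0 <= K -> 0 <= b ->
  regular tau K Y Y' -> (forall t, 0 <= t -> t <= T -> `|Y t| <= b) ->
  growth_bound tau w K b K Y Y'.
Proof.
move=> hw K0 b0 [r1 r2 r3] hb.
have w1 t : 0 <= t -> 1 <= w t by exact: (weight_ge1 hw).
split => //.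
- by move=> t t0 tT; rewrite (le_trans (hb t t0 tT))// ler_peMr// w1.
- move=> s t s0 st tT ts; rewrite (le_trans (r2 s t s0 st tT ts))//.
  by rewrite ler_wpM2r ?powR_ge0// ler_peMr// w1.
- move=> s t s0 st tT ts; rewrite (le_trans (r3 s t s0 st tT ts))//.
  by rewrite ler_wpM2r ?exprn_ge0 ?powR_ge0// ler_peMr// w1.
Qed.

Lemma holder2_sym (E : normedModType R) gam (c : R) (Xi : R -> R -> E) :
  (forall s t, 0 <= s -> s <= t -> t <= T -> `|Xi s t| <= c * (t - s) `^ gam) ->
  (forall s t, 0 <= s -> s <= t -> t <= T -> `|Xi t s| <= c * (t - s) `^ gam) ->
  holder2 T gam Xi.
Proof.
move=> h1 h2; exists c => s t /andP[s0 sT] /andP[t0 tT] _.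
have [st|/ltW ts] := leP s t; first by rewrite ger0_norm ?subr_ge0//; exact: h1.
by rewrite distrC ger0_norm ?subr_ge0//; exact: h2.
Qed.

Lemma regular_controlled tau K b Y Y' : 0 < tau -> tau <= 1 -> 0 <= K -> 0 <= b ->
  regular tau K Y Y' -> (forall t, 0 <= t -> t <= T -> `|Y t| <= b) ->
  controlled T beta X Y Y'.
Proof.
move=> tau0 tau1 K0 b0 rY hb; have [r1 r2 r3] := rY.
have beta0' := ltW beta0.
have beta20 : 0 <= 2 * beta by rewrite mulr_ge0.
have hYw s t := @regular_incr tau K Y Y' s t tau1 K0 rY.
have KB0 : 0 <= K * B + K by nonneg.
have dif (E' : normedModType R) (x y : E') (p : R) : `|x| <= p -> `|y| <= p ->
    `|x - y| <= 2 * p.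
  by move=> hx hy; rewrite (le_trans (ler_normB _ _))// mulr2n mulrDl mul1r lerD.
have b20 : 0 <= 2 * b by nonneg.
have K20 : 0 <= 2 * K by nonneg.
have hYb s t : 0 <= s -> s <= t -> t <= T -> `|Y t - Y s| <= 2 * b.
  by move=> s0 st tT; apply: dif; apply: hb => //; [exact: le_trans st|exact: le_trans tT].
have hY'b s t : 0 <= s -> s <= t -> t <= T -> `|Y' t - Y' s| <= 2 * K.
  by move=> s0 st tT; apply: dif; apply: r1 => //; [exact: le_trans st|exact: le_trans tT].
have HY := window_holder tau0 beta0' KB0 b20 hYb hYw.
have HY' := window_holder tau0 beta0' K0 K20 hY'b r2.
have hXb s t : 0 <= s -> s <= t -> t <= T -> `|X t - X s| <= B * T `^ beta.
  move=> s0 st tT; rewrite (le_trans (hX s0 st tT))// ler_wpM2l//.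
  apply: powR_mono => //; first by rewrite subr_ge0.
  by rewrite lerBlDr (le_trans tT)// lerDl.
have hRb s t : 0 <= s -> s <= t -> t <= T ->
    `|Rem Y Y' s t| <= 2 * b + K * (B * T `^ beta).
  move=> s0 st tT; rewrite (le_trans (ler_normB _ _))// lerD ?hYb//.
  by apply: blin_norm_le; [apply: r1 => //; exact: le_trans tT|exact: hXb].
have Rb0 : 0 <= 2 * b + K * (B * T `^ beta) by nonneg.
have hRw s t : 0 <= s -> s <= t -> t <= T -> t - s <= tau ->
    `|Rem Y Y' s t| <= K * (t - s) `^ (2 * beta).
  by move=> s0 st tT ts; rewrite powR_double; exact: r3.
have HR := window_holder tau0 beta20 K0 Rb0 hRb hRw.
set c1 := _ + _ / _ in HY; set c2 := _ + _ / _ in HY'; set c3 := _ + _ / _ in HR.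
split.
- by apply: (holder2_sym HY) => s t s0 st tT; rewrite distrC; exact: HY.
- by apply: (holder2_sym HY') => s t s0 st tT; rewrite distrC; exact: HY'.
have c20 : 0 <= c2 by rewrite /c2 addr_ge0// divr_ge0// powR_ge0.
apply: (@holder2_sym _ _ (c3 + c2 * B)) => s t s0 st tT.
  rewrite (le_trans (HR s t s0 st tT))// ler_wpM2r ?powR_ge0// lerDl.
  exact: mulr_ge0.
(* The remainder is not symmetric in its two times; exchanging them costs a product of increments of
   [Y'] and [X], again of order [2 * beta]. *)
have -> : Y s - Y t - Y' t (X s - X t) =
    (Y' t - Y' s) (X t - X s) - Rem Y Y' s t.
  by rewrite /remainder -[X s - X t]opprB blinB linearN; zmodule.
rewrite (le_trans (ler_normB _ _))// mulrDl addrC lerD//; first exact: HR.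
apply: (le_trans (blin_norm_le (HY' s t s0 st tT) (hX s0 st tT))).
by rewrite powR_double le_eqVlt; apply/orP; left; apply/eqP; ring.
Qed.

(** [holder2] is silent at [s = t] and allows a constant of any sign, whence the condition on the
    diagonal and the absolute value. *)
Lemma holder2_le (E : normedModType R) gam (Xi : R -> R -> E) :
  (forall s, 0 <= s <= T -> Xi s s = 0) -> holder2 T gam Xi ->
  exists2 c : R, 0 <= c & forall s t, 0 <= s -> s <= t -> t <= T ->
    `|Xi s t| <= c * (t - s) `^ gam.
Proof.
move=> Xi0 [c Hc]; exists `|c| => // s t s0 st tT.
have [<-|ne] := eqVneq s t.
  by rewrite Xi0 ?s0 ?(le_trans st)// normr0 mulr_ge0 ?powR_ge0.
have := Hc s t (inT s0 (le_trans st tT)) (inT (le_trans s0 st) tT) ne.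
rewrite [in X in _ <= X -> _]ger0_norm ?subr_ge0// => /le_trans; apply.
by rewrite ler_wpM2r ?powR_ge0// ler_norm.
Qed.

Lemma holder_bounded (E : normedModType R) (Y : R -> E) : holder T beta Y ->
  exists2 b, 0 <= b & forall t, 0 <= t -> t <= T -> `|Y t| <= b.
Proof.
move=> /holder2_le[s _|c c0 Hc]; first by rewrite subrr.
exists (`|Y 0| + c * T `^ beta); first by nonneg.
move=> t t0 tT; have -> : Y t = Y 0 + (Y t - Y 0) by zmodule.
rewrite (le_trans (ler_normD _ _))// lerD2l (le_trans (Hc 0 t (lexx _) t0 tT))//.
by rewrite subr0 ler_wpM2l// powR_mono.
Qed.

Lemma controlled_regular Y Y' : controlled T beta X Y Y' -> exists K b,
  [/\ 0 <= K, 0 <= b, regular 1 K Y Y' & forall t, 0 <= t -> t <= T -> `|Y t| <= b].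
Proof.
move=> [hY hY' hR]; have [b b0 hb] := holder_bounded hY.
have [m m0 hm] := holder_bounded hY'.
have [s _|c2 c20 H2] := holder2_le _ hY'; first by rewrite subrr.
have [s _|c3 c30 H3] := holder2_le _ hR; first by rewrite !subrr linear0 subrr.
have [l1 l2 l3 _ _] := le_sum5 m0 c20 c30 (lexx 0) (lexx 0).
rewrite /= !addr0 in l1 l2 l3.
exists (m + c2 + c3), b; split => //; first by nonneg.
split.
- by move=> t t0 tT; rewrite (le_trans (hm t t0 tT)).
- move=> s t s0 st tT _; rewrite (le_trans (H2 s t s0 st tT))//.
  by rewrite ler_wpM2r ?powR_ge0.
- move=> s t s0 st tT _; rewrite (le_trans (H3 s t s0 st tT))//.
  by rewrite powR_double ler_wpM2r ?exprn_ge0 ?powR_ge0.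
Qed.

(** * Mild and strong solutions *)

Section solutions.
Context (G : R -> blin W W) (hG : C0_semigroup G).
Context (hGM : forall t, 0 <= t -> t <= T -> `|G t| <= B).
Context (hGS : forall t y, 0 <= t -> i1 (S t y) = G t (i1 y)).
Context (hAG : forall y, i1 (A y) = generator G (i2 y)).
Context (dom1 : forall y, gendom G (i1 y)) (dom2 : forall y, gendom G (i2 y)).
Context (A1 : blin D1 W) (hA1 : forall y, A1 y = generator G (i1 y)).

Lemma sews_diag (E : normedModType R) (Xi : R -> R -> E) a I : sews Xi a a I -> I = 0.
Proof.
move=> HI; apply/eqP; rewrite -normr_le0 -[I]subr0.
apply: (sews_close (lexx a) ltr01 HI) => p /gap_path_lt pp /(path_lt_last_nil pp) ->.
by rewrite subrr normr0.
Qed.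

Lemma duhamel_estimate (h e B' x1 x2 x3 : R) : 0 <= B' -> 0 <= e -> 0 <= h ->
  x1 <= B' * (3 * (e / (3 * B' + 1 + B' ^+ 2)) * h) ->
  x2 <= e / (3 * B' + 1 + B' ^+ 2) * h ->
  x3 <= B' * (B' * (e / (3 * B' + 1 + B' ^+ 2) * h)) ->
  x1 + x2 + x3 <= e * h.
Proof.
move=> B'0 e0 h0 h1 h2 h3; have d0 : 3 * B' + 1 + B' ^+ 2 != 0.
  by rewrite gt_eqF// ltr_pwDl// ?exprn_ge0// ltr_wpDl// mulr_ge0.
apply: (le_trans (lerD (lerD h1 h2) h3)).
rewrite le_eqVlt; apply/orP; left; apply/eqP; by field.
Qed.

(* Integration by parts: the map [v |-> G (t - v) (Z v) + \int_0^v G (t - s) (A (Z s)) ds]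
   has the increments [G (t - u) (Xi u v)] up to [o(v - u)]. *)
Lemma duhamel_noise (Xi : R -> R -> D2) (Z : R -> D2) t CA : 0 <= t -> t <= T ->
  Z 0 = 0 -> ucont 0 T (fun s => A (Z s)) ->
  (forall e : R, 0 < e -> exists2 d : R, 0 < d & forall u v, 0 <= u -> u <= v ->
    v <= T -> v - u < d -> `|Z v - Z u - Xi u v| <= e * (v - u)) ->
  sews (conv_germ S (fun s => A (Z s)) t) 0 t CA ->
  sews (fun u v => G (t - u) (i2 (Xi u v))) 0 t (i2 (Z t) + i1 CA).
Proof.
move=> t0 tT Z0 uAZ hXi HCA.
pose a s := i1 (A (Z s)); have ua : ucont 0 T a by exact: ucont_blin.
pose g s := G (t - s) (a s).
have ug : ucont 0 t g by exact: (convolution_ucont hG t0 tT ua).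
have [Q Q0 HQ] := coherent_path t0 (riem_coherent ug).
have QE : Q t = i1 CA.
  have := HQ 0 t (lexx _) t0 (lexx _); rewrite Q0 subr0 => /(sews_uniq t0); apply.
  apply: sews_eq (sews_blin i1 HCA) => u v u0 uv vt.
  by rewrite /conv_germ /riem blinZr hGS// subr_ge0 (le_trans uv).
pose phi v := G (t - v) (i2 (Z v)) + Q v.
have -> : i2 (Z t) + i1 CA = phi t - phi 0.
  by rewrite /phi subrr (semi0 hG) Z0 !linear0 Q0 addr0 subr0 QE.
apply: sews_path => e e0; pose e1 := e / (3 * B + 1 + B ^+ 2).
have e10 : 0 < e1.
  by rewrite divr_gt0// ltr_pwDl// ?exprn_ge0// ltr_wpDl// mulr_ge0.
have [d1 d10 H1] := semi_unif hG T0 ua e10; have [d2 d20 H2] := ua _ e10.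
have [d3 d30 H3] := coherent_increment (riem_coherent ug) e10.
have [d4 d40 H4] := hXi _ e10.
exists (Num.min (Num.min d1 d2) (Num.min d3 d4)); first by rewrite !lt_min d10 d20 d30.
move=> u v u0 uv vt; rewrite !lt_min => /andP[/andP[vd1 vd2] /andP[vd3 vd4]].
have vT := le_trans vt tT; have v0 := le_trans u0 uv; have uT := le_trans uv vT.
have h0 : 0 <= v - u by rewrite subr_ge0.
have tv0 : 0 <= t - v by rewrite subr_ge0.
have tvT : t - v <= T by rewrite lerBlDr (le_trans tT)// lerDl.
have tuT : t - u <= T by rewrite lerBlDr (le_trans tT)// lerDl.
have tu0 : 0 <= t - u by rewrite subr_ge0 (le_trans uv).
have GD x : G (t - u) x = G (t - v) (G (v - u) x).
  by rewrite -(semiD hG)//; congr (G _ _); ring.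
(* With [h = v - u] and [z = i2 (Z v)], [T1] equals [G h z - z - h *: G h (a u)]: the motion of the
   semigroup against the integral meant to compensate it. It is written as the first-order expansion
   of the orbit of [z], the variation of [a], and that of the orbit of [a u]. *)
pose T1 := G (v - u) (i2 (Z v)) - i2 (Z v) - (v - u) *: a v +
  (v - u) *: (a v - a u) - (v - u) *: (G (v - u) (a u) - a u).
have hT1 : `|T1| <= 3 * e1 * (v - u).
  have p1 : `|G (v - u) (i2 (Z v)) - i2 (Z v) - (v - u) *: a v| <= e1 * (v - u).
    rewrite /a hAG; apply: (orbit_increment hG) => // r r0 rh.
    by rewrite -hAG; apply: H1 => //; [exact: le_lt_trans vd1|exact/inT].
  have p2 : `|(v - u) *: (a v - a u)| <= (v - u) * e1.
    by rewrite normrZ ger0_norm// ler_wpM2l// H2.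
  have p3 : `|(v - u) *: (G (v - u) (a u) - a u)| <= (v - u) * e1.
    by rewrite normrZ ger0_norm// ler_wpM2l// H1// inT.
  rewrite (le_trans (ler_normB _ _))//.
  apply: (le_trans (lerD (le_trans (ler_normD _ _) (lerD p1 p2)) p3)).
  by rewrite le_eqVlt; apply/orP; left; apply/eqP; ring.
have hT1' := blin_norm_le (hGM tv0 tvT) hT1.
have hT2 := H3 u v _ u0 uv vt vd3 (HQ u v u0 uv vt).
have hT3 := blin_norm_le (hGM tu0 tuT) (blin_norm_le hi2 (H4 u v u0 uv vT vd4)).
have -> : phi v - phi u - G (t - u) (i2 (Xi u v)) =
    - G (t - v) T1 + (Q v - Q u - riem g u v) +
    G (t - u) (i2 (Z v - Z u - Xi u v)).
  rewrite /phi /riem /g /T1 !GD.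
  move: (Z v) (Z u) (Xi u v) (a u) (a v) (v - u) => z z' xi b b' h.
  by rewrite !(blinDr, blinNr, blinZr, scalerDr, scalerN); zmodule.
rewrite (le_trans (ler_normD _ _))// (le_trans (lerD (ler_normD _ _) (lexx _)))//.
by rewrite normrN; apply: (duhamel_estimate B0 (ltW e0) h0 hT1' hT2 hT3).
Qed.

Section drift_part.
Context (g : R -> D1) (ug : ucont 0 T g) (C : R -> D1).
Context (HC : forall t, 0 <= t -> t <= T -> sews (conv_germ S g t) 0 t (C t)).

Let U t := S t x0 + C t.

Lemma drift_step s t : 0 <= s -> s <= t -> t <= T ->
  exists2 J, sews (conv_germ S g t) s t J & U t = S (t - s) (U s) + J.
Proof.
move=> s0 st tT; have sT := le_trans st tT; have t0 := le_trans s0 st.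
have [J HJ JE] := conv_split hS ug s0 st tT (HC s0 sT) (HC t0 tT).
exists J => //; rewrite /U JE blinDr -(semiD hS)// ?subr_ge0// subrK; zmodule.
Qed.

(** Continuity holds in the norm of [D1], so that [A1 (U s)] is an admissible continuous
    integrand. *)
Lemma drift_ucont : ucont 0 T U.
Proof.
move=> e e0; have [m m0 hm] := ucont_bounded T0 ug.
pose e1 := e / (B + B * T + B * m + 1).
have den : 0 < B + B * T + B * m + 1 by apply: ltr_wpDl => //; nonneg.
have e10 : 0 < e1 by rewrite divr_gt0.
have [d1 d10 H1] := semi_right hS x0 e10.
have [d2 d20 H2] := semi_unif hS T0 ug e10.
exists (Num.min (Num.min d1 d2) e1); first by rewrite !lt_min d10 d20.
move=> s t s0 st tT; rewrite !lt_min => /andP[/andP[td1 td2] te].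
have sT := le_trans st tT; have t0 := le_trans s0 st.
have h0 : 0 <= t - s by rewrite subr_ge0.
have [J HJ UE] := drift_step s0 st tT.
have hJ : `|J| <= B * m * e1.
  apply: (@le_trans _ _ (B * m * t - B * m * s)).
    apply: (sews_norm (Phi := fun r => B * m * r) st ltr01 HJ).
    move=> u v su uv vt _; rewrite /conv_germ /riem normrZ ger0_norm ?subr_ge0//.
    rewrite -mulrBr mulrC ler_wpM2r ?subr_ge0//; apply: blin_norm_le.
      apply: hM; first by rewrite subr_ge0 (le_trans uv).
      by rewrite lerBlDr (le_trans tT)// lerDl (le_trans s0).
    by apply: hm; rewrite (le_trans s0 su) (le_trans uv)// (le_trans vt).
  by rewrite -mulrBr ler_wpM2l ?(ltW te)//; nonneg.
have hx : `|S (t - s) (S s x0) - S s x0| <= B * e1.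
  have -> : S (t - s) (S s x0) - S s x0 = S s (S (t - s) x0 - x0).
    by rewrite blinBr -!(semiD hS)// [t - s + s]addrC.
  by apply: blin_norm_le; [exact: hM|exact: H1].
have hC : `|S (t - s) (C s) - C s| <= B * e1 * T.
  have HCS := HC s0 sT.
  apply: (@le_trans _ _ (B * e1 * s - B * e1 * 0)); last first.
    by rewrite mulr0 subr0; apply: ler_wpM2l => //; exact: mulr_ge0 B0 (ltW e10).
  apply: (sews_norm (Phi := fun r => B * e1 * r) s0 ltr01
    (sewsB (sews_blin (S (t - s)) HCS) HCS)) => u v u0 uv vs _.
  rewrite /conv_germ /riem blinZr -scalerBr normrZ ger0_norm ?subr_ge0//.
  rewrite -mulrBr mulrC ler_wpM2r ?subr_ge0//.
  have su0 : 0 <= s - u by rewrite subr_ge0 (le_trans uv).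
  have -> : S (t - s) (S (s - u) (g u)) - S (s - u) (g u) =
      S (s - u) (S (t - s) (g u) - g u).
    by rewrite blinBr -!(semiD hS)// [t - s + _]addrC.
  apply: blin_norm_le; first by apply: hM => //; rewrite lerBlDr (le_trans sT)// lerDl.
  by apply: H2 => //; rewrite u0 (le_trans uv)// (le_trans vs).
have -> : U t - U s = (S (t - s) (S s x0) - S s x0) + (S (t - s) (C s) - C s) + J.
  by rewrite UE /U blinDr; zmodule.
rewrite (le_trans (ler_normD _ _))//.
apply: (le_trans (lerD (le_trans (ler_normD _ _) (lerD hx hC)) hJ)).
rewrite (_ : _ + _ = e1 * (B + B * T + B * m)); last by ring.
by rewrite /e1 mulrAC ler_pdivrMr// ler_wpM2l ?(ltW e0)// lerDl.
Qed.

(** By [drift_step] the increment of [U] over [[u, v]] is one semigroup step from [U u], with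
    derivative [A1 (U u)], plus a short convolution, with derivative [g u]. Both errors are
    uniformly negligible against [v - u], as [sews_path] requires. *)
Lemma drift_strong t : 0 <= t -> t <= T ->
  sews (riem (fun s => A1 (U s) + i1 (g s))) 0 t (i1 (U t) - i1 x0).
Proof.
move=> t0 tT; have C0 := sews_diag (HC (lexx 0) T0).
have -> : i1 (U t) - i1 x0 = i1 (U t) - i1 (U 0) by rewrite /U (semi0 hS) C0 addr0.
apply: (sews_path (phi := fun s => i1 (U s))) => e e0.
have den : 0 < 1 + 2 * B by rewrite ltr_pwDl// mulr_ge0.
pose e1 := e / (1 + 2 * B); have e10 : 0 < e1 by rewrite divr_gt0.
have uA : ucont 0 T (fun s => A1 (U s)) by exact/ucont_blin/drift_ucont.
have [d1 d10 H1] := semi_unif hG T0 uA e10.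
have [d2 d20 H2] := semi_unif hS T0 ug e10; have [d3 d30 H3] := ug e10.
exists (Num.min d1 (Num.min d2 d3)); first by rewrite !lt_min d10 d20.
move=> u v u0 uv vt; rewrite !lt_min => /andP[vd1 /andP[vd2 vd3]].
have vT := le_trans vt tT; have v0 := le_trans u0 uv; have uT := le_trans uv vT.
have h0 : 0 <= v - u by rewrite subr_ge0.
have [J HJ UE] := drift_step u0 uv vT.
have p1 : `|G (v - u) (i1 (U u)) - i1 (U u) - (v - u) *: A1 (U u)| <= e1 * (v - u).
  rewrite hA1; apply: (orbit_increment hG) => // r r0 rh.
  by rewrite -hA1; apply: H1 => //; [exact: le_lt_trans vd1|exact/inT].
have p2 : `|J - (v - u) *: g u| <= (e1 + e1) * (v - u).
  apply: (riem_near uv HJ) => r ur rv.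
  have -> : S (v - r) (g r) - g u = (S (v - r) (g r) - g r) + (g r - g u) by zmodule.
  rewrite (le_trans (ler_normD _ _))// lerD//.
    apply: H2; [by rewrite subr_ge0| |by rewrite (le_trans u0 ur) (le_trans rv)].
    by apply: le_lt_trans vd2; rewrite lerB.
  by apply: H3 => //; [exact: le_trans rv vT|apply: le_lt_trans vd3; rewrite lerB].
have p3 := blin_norm_le hi1 p2.
have -> : i1 (U v) - i1 (U u) - riem (fun s => A1 (U s) + i1 (g s)) u v =
    (G (v - u) (i1 (U u)) - i1 (U u) - (v - u) *: A1 (U u)) + i1 (J - (v - u) *: g u).
  by rewrite UE blinDr hGS// /riem scalerDr blinBr blinZr; zmodule.
rewrite (le_trans (ler_normD _ _))// (le_trans (lerD p1 p3))//.
rewrite [leLHS](_ : _ = e1 * (1 + 2 * B) * (v - u)); last by ring.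
by rewrite /e1 divfK// gt_eqF.
Qed.

End drift_part.

(** The convolution splits along [drift]: the part of [k] is the time integral of the mild equation,
    and the part of [A Z] joins [Z] to form the rough convolution. *)
Lemma picard_duhamel Y Y' Z C Y1 : ucont 0 T Y -> coherent (Germ Y Y') 0 T ->
  picard Y Y' Z C Y1 -> forall t, 0 <= t -> t <= T -> exists I J,
    [/\ sews (riem (fun s => G (t - s) (i1 (k s (Y s))))) 0 t I,
        sews (fun u v => G (t - u) (i2 (Germ Y Y' u v))) 0 t J &
        Y1 t = G t (i1 x0) + I + J].
Proof.
move=> uY coh [Z0 HZ ug HC HY] t t0 tT.
have uk := hkc uY.
have uAZ : ucont 0 T (fun s => A (Z s)).
  have -> : (fun s => A (Z s)) = (fun s => drift Y Z s - k s (Y s)).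
    by apply/funext => s; rewrite /drift; zmodule.
  exact: ucontB.
have [C0 HC0] := conv_exists hS T0 uk; have [CA HCA] := conv_exists hS T0 uAZ.
have CE : C t = C0 t + CA t.
  apply: (sews_uniq t0 (HC t t0 tT)).
  apply: sews_eq (sewsD (HC0 t t0 tT) (HCA t t0 tT)) => u v _ _ _.
  by rewrite /conv_germ /riem blinDr scalerDr.
exists (i1 (C0 t)), (i2 (Z t) + i1 (CA t)); split.
- apply: sews_eq (sews_blin i1 (HC0 t t0 tT)) => u v u0 uv vt.
  by rewrite /conv_germ /riem blinZr hGS// subr_ge0 (le_trans uv).
- apply: (duhamel_noise t0 tT Z0 uAZ) (HCA t t0 tT) => e e0.
  have [d d0 Hd] := coherent_increment coh e0; exists d => // u v u0 uv vT vd.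
  by apply: Hd => //; exact: HZ.
- by rewrite HY// CE blinDr hGS//; zmodule.
Qed.

Lemma regular_coherent tau K b Y Y' : 0 < tau -> tau <= 1 -> 0 <= K -> 0 <= b ->
  regular tau K Y Y' -> (forall t, 0 <= t -> t <= T -> `|Y t| <= b) ->
  coherent (Germ Y Y') 0 T.
Proof.
move=> tau0 tau1 K0 b0 rY hb; have hw := exp_weight tau0.
exact: (germ_coherent hw tau0 tau1 K0 K0 (regular_growth hw K0 b0 rY hb)).
Qed.

Lemma regular_picard tau K b Y Y' : 0 < tau -> tau <= 1 -> 0 <= K -> 0 <= b ->
  regular tau K Y Y' -> (forall t, 0 <= t -> t <= T -> `|Y t| <= b) ->
  exists Z C Y1, picard Y Y' Z C Y1.
Proof.
move=> tau0 tau1 K0 b0 rY hb; have hw := exp_weight tau0.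
exact: (picard_exists hw (expR_ge0 1) tau0 tau1 K0 K0 (regular_growth hw K0 b0 rY hb)).
Qed.

Definition i2f (t : R) (y : W) : blin V W := blin_comp i2 (f t y).

Context (hdf : forall t y, 0 <= t <= T ->
  Fderiv (i2f t) y = blin_comp (postcomp V i2) (df t y)).

Lemma comp_deriv_germ Y Y' t z : 0 <= t <= T ->
  tlift VV (comp_deriv i2f Y Y' t) z = i2 (tlift VV (P Y Y' t) z).
Proof.
move=> t0T; rewrite -tlift_comp; congr (tlift VV _ z).
by apply: blin_eqP => v; rewrite /comp_deriv hdf.
Qed.

Lemma mild_rough_sews Y Y' t J : 0 <= t -> t <= T ->
  (forall s, 0 <= s <= T -> Y' s = noise Y s) ->
  is_rough_integral t X XX (fun s => blin_comp (G (t - s)) (i2f s (Y s)))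
    (fun s => blin_comp (postcomp V (G (t - s))) (comp_deriv i2f Y Y' s)) J <->
  sews (fun u v => G (t - u) (i2 (Germ Y (noise Y) u v))) 0 t J.
Proof.
move=> t0 tT HY'; apply: rough_integral_sews => u v u0 uv vt.
have u0T : 0 <= u <= T by rewrite u0 (le_trans uv)// (le_trans vt).
by rewrite tlift_comp comp_deriv_germ// /germ !blinDr /gderiv HY'.
Qed.

Lemma strong_rough_sews Y t J : 0 <= t -> t <= T ->
  is_rough_integral t X XX (fun s => i2f s (Y s)) (comp_deriv i2f Y (noise Y)) J <->
  sews (fun u v => i2 (Germ Y (noise Y) u v)) 0 t J.
Proof.
move=> t0 tT; apply: rough_integral_sews => u v u0 uv vt.
have u0T : 0 <= u <= T by rewrite u0 (le_trans uv)// (le_trans vt).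
by rewrite comp_deriv_germ// /germ blinDr.
Qed.

Lemma mild_ucont Y t : ucont 0 T Y -> 0 <= t -> t <= T ->
  ucont 0 t (fun s => G (t - s) (i1 (k s (Y s)))).
Proof.
move=> uY t0 tT; apply: (convolution_ucont hG t0 tT).
by apply: ucont_blin; exact: hkc.
Qed.

Lemma mild_of_picard tau K b Y Z C : 0 < tau -> tau <= 1 -> 0 <= K -> 0 <= b ->
  regular tau K Y (noise Y) -> (forall t, 0 <= t -> t <= T -> `|Y t| <= b) ->
  picard Y (noise Y) Z C Y ->
  mild_solution G T beta X XX (fun t y => i1 (k t y)) i2f (i1 x0) Y (noise Y).
Proof.
move=> tau0 tau1 K0 b0 rY hb pY; split => //.
  exact: regular_controlled rY hb.
move=> t /andP[t0 tT]; have uY := regular_ucont tau0 tau1 K0 rY.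
have coh := regular_coherent tau0 tau1 K0 b0 rY hb.
have [I [J [HI HJ E]]] := picard_duhamel uY coh pY t0 tT.
exists I, J; split => //; last exact/mild_rough_sews.
by apply: bochner_of_riem => //; exact: mild_ucont.
Qed.

(** The image [Y1] of a mild solution exists by its regularity and satisfies a mild formula with the
    same integrands; uniqueness of the Bochner and of the rough integral gives [Y1 = Y] on
    [[0, T]]. *)
Lemma picard_of_mild Y Y' :
  mild_solution G T beta X XX (fun t y => i1 (k t y)) i2f (i1 x0) Y Y' ->
  exists K b Z C, regular 1 K Y (noise Y) /\
    (forall t, 0 <= t -> t <= T -> `|Y t| <= b) /\ picard Y (noise Y) Z C Y.
Proof.
move=> [cY HY' HY]; have [K [b [K0 b0 [r1 r2 r3] hb]]] := controlled_regular cY.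
have rY : regular 1 K Y (noise Y).
  split.
  - by move=> t t0 tT; rewrite -[noise Y t]HY' ?inT//; exact: r1.
  - move=> s t s0 st tT ts; rewrite -[noise Y t]HY' ?inT ?(le_trans s0)//.
    by rewrite -[noise Y s]HY' ?s0 ?(le_trans st)//; exact: r2.
  - move=> s t s0 st tT ts; rewrite /remainder -[noise Y s]HY' ?s0 ?(le_trans st)//.
    exact: r3.
have [Z [C [Y1 pY]]] := regular_picard ltr01 (lexx 1) K0 b0 rY hb.
exists K, b, Z, C; split => //; split => //.
have uY := regular_ucont ltr01 (lexx 1) K0 rY.
have coh := regular_coherent ltr01 (lexx 1) K0 b0 rY hb.
have Y1E t : 0 <= t -> t <= T -> Y1 t = Y t.
  move=> t0 tT; have [I [J [HI HJ ->]]] := picard_duhamel uY coh pY t0 tT.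
  have [I' [J' [HI' HJ' ->]]] := HY t (inT t0 tT).
  have ug := mild_ucont uY t0 tT.
  rewrite (bochner_unique ug (bochner_of_riem t0 ug HI) HI').
  have [h _] := mild_rough_sews J' t0 tT HY'.
  by rewrite (sews_uniq t0 HJ (h HJ')).
case: pY => p1 p2 p3 p4 p5; split => // t t0 tT.
by rewrite -Y1E// p5.
Qed.

Lemma strong_of_picard tau K b Y Z C : 0 < tau -> tau <= 1 -> 0 <= K -> 0 <= b ->
  regular tau K Y (noise Y) -> (forall t, 0 <= t -> t <= T -> `|Y t| <= b) ->
  picard Y (noise Y) Z C Y ->
  strong_solution G T beta X XX (fun t y => i1 (k t y)) i2f (i1 x0) Y (noise Y).
Proof.
move=> tau0 tau1 K0 b0 rY hb [Z0 HZ ug HC HY].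
have uY := regular_ucont tau0 tau1 K0 rY.
pose U t := S t x0 + C t.
have YE t : 0 <= t -> t <= T -> Y t = i1 (U t) + i2 (Z t).
  by move=> t0 tT; rewrite HY// blinDr.
have YG t : 0 <= t -> t <= T -> gendom G (Y t) /\
    generator G (Y t) = A1 (U t) + i1 (A (Z t)).
  move=> t0 tT; rewrite YE// hA1 hAG.
  have [] := gendomP 1 (@dom1 (U t)) (@dom2 (Z t)).
  by rewrite !scale1r.
have uA : ucont 0 T (fun t => A1 (U t) + i1 (drift Y Z t)).
  apply: ucontD; last exact: ucont_blin.
  by apply: ucont_blin; exact: drift_ucont ug _ HC.
(* The summand [A Z] of [drift] is the contribution of the rough integral to [A Y], so the integrand
   of the strong equation is the one of [drift_strong]. *)
have AE t : 0 <= t -> t <= T ->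
    generator G (Y t) + i1 (k t (Y t)) = A1 (U t) + i1 (drift Y Z t).
  by move=> t0 tT; rewrite (YG t t0 tT).2 /drift [i1 (k _ _ + _)]blinDr; zmodule.
split => //.
- exact: regular_controlled rY hb.
- by move=> t /andP[t0 tT]; exact: (YG t t0 tT).1.
- have [c c0 Hc] := ucont_bounded T0 uA.
  have [c' c'0 Hc'] := ucont_bounded T0 (ucont_blin i1 (hkc uY)).
  exists (c + c') => t tT; have /andP[t0 tT'] := tT.
  have -> : generator G (Y t) = (generator G (Y t) + i1 (k t (Y t))) - i1 (k t (Y t)).
    by zmodule.
  by rewrite AE// (le_trans (ler_normB _ _))// lerD ?Hc ?Hc'.
(* The increment of [U] is the time integral of the strong equation, and [Z] is its rough
   integral. *)
- move=> t /andP[t0 tT]; exists (i1 (U t) - i1 x0), (i2 (Z t)); split.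
  + apply: bochner_of_riem => //.
      move=> e e0; have [d d0 Hd] := uA e e0; exists d => // u v u0 uv vt vd.
      by rewrite !AE ?(le_trans uv) ?(le_trans vt) ?(le_trans u0)//; apply: Hd => //;
        exact: le_trans tT.
    apply: sews_eq (drift_strong ug HC t0 tT) => u v u0 uv vt.
    by rewrite /riem AE// (le_trans uv)// (le_trans vt).
  + apply/strong_rough_sews => //.
    by have := HZ 0 t (lexx _) t0 tT; rewrite Z0 subr0; exact: sews_blin.
  + by rewrite YE//; zmodule.
Qed.

Theorem mild_and_strong : exists Y : R -> W,
  [/\ mild_solution G T beta X XX (fun t y => i1 (k t y)) i2f (i1 x0) Y (noise Y),
      (forall Y2 Y2', mild_solution G T beta X XX (fun t y => i1 (k t y)) i2f
         (i1 x0) Y2 Y2' -> forall t, 0 <= t <= T -> Y2 t = Y t /\ Y2' t = noise Y t) &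
      strong_solution G T beta X XX (fun t y => i1 (k t y)) i2f (i1 x0) Y (noise Y)].
Proof.
have [tau [K [b [Y [Z [C [[tau0 tau1 K0 b0] [rY hb pY]]]]]]]] := picard_fixpoint.
exists Y; split.
- exact: mild_of_picard rY hb pY.
- move=> Y2 Y2' mY2; have [K2 [b2 [Z2 [C2 [rY2 [hb2 pY2]]]]]] := picard_of_mild mY2.
  have E t : 0 <= t <= T -> Y2 t = Y t.
    by move=> /andP[t0 tT]; exact: (picard_unique ltr01 tau0 rY2 rY hb2 hb pY2 pY).
  by move=> t tT; case: mY2 => _ /(_ t tT) -> _; rewrite /noise /i2f E.
- exact: strong_of_picard rY hb pY.
Qed.

End solutions.

End picard.

(** * From the hypotheses on the coefficients to the abstract setting *)

Section compactness.
Context {R : realType}.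

(** The Heine-Cantor argument, with the radius as a parameter tending to 0 from the right:
    near-covering compactness of the segment turns local radii into a common one. *)
Lemma local_ucont (E : normedModType R) (T : R) (g : R -> E) :
  (forall s e : R, 0 <= s <= T -> 0 < e -> exists2 d : R, 0 < d &
     forall t, 0 <= t <= T -> `|t - s| < d -> `|g t - g s| <= e) -> ucont 0 T g.
Proof.
move=> H e e0; have /compact_near_coveringP cK := @segment_compact R 0 T.
pose P (d x : R) := 0 <= x <= T -> forall t, 0 <= t <= T -> `|t - x| < d ->
  `|g t - g x| <= e.
have [|d /= d0 Hd] := cK R (0^'+) P _.
  move=> x /=; rewrite in_itv /= => xT.
  have [d d0 Hd] := H x (e / 2) xT (divr_gt0 e0 (ltr0n R 2)).
  have d20 : 0 < d / 2 by rewrite divr_gt0.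
  exists (ball x (d / 2), [set r | r < d / 2]) => /=.
    by split; [exact: nbhsx_ballx|exact: nbhs_right_lt].
  move=> [y r] [/= xy rd] yT t tT ty.
  rewrite -ball_normE /= distrC in xy.
  have -> : g t - g y = (g t - g x) - (g y - g x) by zmodule.
  rewrite (le_trans (ler_normB _ _))// [e]splitr lerD ?Hd//; last first.
    by rewrite (lt_trans xy)// ltr_pdivrMr// ltr_pMr// ltr1n.
  have -> : t - x = (t - y) + (y - x) by ring.
  by rewrite (le_lt_trans (ler_normD _ _))// [d]splitr ltrD// (lt_trans ty).
exists (d / 2); first by rewrite divr_gt0.
move=> s t s0 st tT ts; apply: (Hd (d / 2)) => //=.
- by rewrite sub0r normrN gtr0_norm ?divr_gt0// ltr_pdivrMr// ltr_pMr// ltr1n.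
- by rewrite divr_gt0.
- by rewrite in_itv /= s0 (le_trans st).
- by rewrite s0 (le_trans st).
- by rewrite tT (le_trans s0).
- by rewrite ger0_norm ?subr_ge0.
Qed.

Lemma Lip_ucont (E F : normedModType R) (T : R) (f0 : R -> E -> F) (Y : R -> E) :
  Lip T f0 -> ucont 0 T Y -> ucont 0 T (fun t => f0 t (Y t)).
Proof.
move=> [cf _] uY; apply: local_ucont => s e sT e0.
have /subspace_continuousP/(_ (s, Y s) sT)/cvgrPdist_le/(_ e e0) := cf.
rewrite /prop_near1 /within /= => /nbhs_ballP[d /= d0 Hd].
have d20 : 0 < d / 2 by rewrite divr_gt0.
have [d' d'0 Hd'] := uY (d / 2) d20.
exists (Num.min d d'); first by rewrite lt_min d0.
move=> t tT; rewrite lt_min => /andP[td td'].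
rewrite distrC; apply: (Hd (t, Y t)) => //; split => /=.
  by rewrite -ball_normE /= distrC.
rewrite -ball_normE /= (@le_lt_trans _ _ (d / 2))//; last first.
  by rewrite ltr_pdivrMr// ltr_pMr// ltr1n.
have /andP[s0 sT'] := sT; have /andP[t0 tT'] := tT.
have [st|/ltW ts] := leP s t.
  by rewrite distrC Hd'// -(ger0_norm (x := t - s))// subr_ge0.
by rewrite Hd'// -(ger0_norm (x := s - t)) 1?distrC// subr_ge0.
Qed.

End compactness.

Lemma Taylor_bounds_le {R : realType} (W E : normedModType R) (T gam C C' : R)
    (f : R -> W -> E) (df : R -> W -> blin W E) : C <= C' ->
  Taylor_bounds T gam C f df -> Taylor_bounds T gam C' f df.
Proof.
move=> CC [h0 h1 h2 h3 h4 h5 h6 h7 h8 h9 h10 h11].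
have up (x y : R) : 0 <= y -> x <= C * y -> x <= C' * y.
  by move=> y0 xy; rewrite (le_trans xy)// ler_wpM2r.
split=> [|t y tT|t y tT|t y z tT|t y z tT|s t y s0 st tT|s t y s0 st tT|
  s t y z s0 st tT|s t y z s0 st tT|t y z tT|t y z y' z' tT|t y z y' z' tT].
- exact: le_trans CC.
- exact: le_trans (h1 t y tT) CC.
- exact: le_trans (h2 t y tT) CC.
- by apply: up (h3 t y z tT).
- by apply: up (h4 t y z tT).
- by apply: up (h5 s t y s0 st tT); exact: powR_ge0.
- by apply: up (h6 s t y s0 st tT); exact: powR_ge0.
- by rewrite -mulrA; apply: up; [rewrite mulr_ge0 ?powR_ge0|rewrite mulrA; exact: h7].
- by rewrite -mulrA; apply: up; [rewrite mulr_ge0 ?powR_ge0|rewrite mulrA; exact: h8].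
- by apply: up (h9 t y z tT); exact: exprn_ge0.
- by apply: up (h10 t y z y' z' tT); nonneg.
- by apply: up (h11 t y z y' z' tT); nonneg.
Qed.

Lemma seq_bound {R : realType} (s : seq R) :
  exists2 B : R, 1 <= B & forall c, c \in s -> c <= B.
Proof.
elim: s => [|x s [B B1 HB]]; first by exists 1.
exists (Num.max x B); first by rewrite le_max B1 orbT.
move=> c; rewrite inE => /predU1P[->|/HB cB]; first by rewrite le_max lexx.
by rewrite le_max cB orbT.
Qed.

Lemma rough_path_bounds {R : realType} {V : completeNormedModType R} (VV : tensor V)
    (T beta : R) (X : R -> V) (XX : R -> R -> VV) : rough_path T beta X XX ->
  exists c, [/\ forall s t, 0 <= s -> s <= t -> t <= T -> `|X t - X s| <= c * (t - s) `^ beta,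
    forall s t, 0 <= s -> s <= t -> t <= T -> `|XX s t| <= c * (t - s) `^ (2 * beta) &
    forall s u t, 0 <= s -> s <= u -> u <= t -> t <= T ->
      XX s t - XX s u - XX u t = tmul VV (X u - X s) (X t - X u)].
Proof.
move=> [hX hXX chen].
(* Chen's relation at three equal times forces the diagonal of [XX] to vanish. *)
have XX0 s : 0 <= s <= T -> XX s s = 0.
  move=> sT; have t0 : tmul VV 0 0 = 0.
    by apply/eqP; rewrite -normr_le0 (le_trans (tmul_norm VV 0 0))// normr0 mul0r.
  by have := chen s s s sT sT sT; rewrite !subrr sub0r t0 => /eqP; rewrite oppr_eq0 => /eqP.
have [s _|c c0 Hc] := holder2_le _ hX; first by rewrite subrr.
have [c' c'0 Hc'] := holder2_le XX0 hXX.
exists (c + c'); split.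
- move=> s t s0 st tT; rewrite (le_trans (Hc s t s0 st tT))//.
  by rewrite ler_wpM2r ?powR_ge0// lerDl.
- move=> s t s0 st tT; rewrite (le_trans (Hc' s t s0 st tT))//.
  by rewrite ler_wpM2r ?powR_ge0// lerDr.
- move=> s u t s0 su ut tT; have uT := le_trans ut tT; have u0 := le_trans s0 su.
  by apply: chen; rewrite ?s0 ?u0 ?(le_trans su) ?(le_trans u0).
Qed.

Theorem theorem9p16 (R : realType) (V W : completeNormedModType R)
    (VV : tensor V) (S : R -> blin W W) (T beta : R)
    (X : R -> V) (XX : R -> R -> VV)
    (f0 : R -> W -> dom S 1) (f : R -> W -> blin V (dom S 2))
    (hS : C0_semigroup S)
    (hT : 0 <= T)
    (hbeta : 3^-1 < beta <= 2^-1)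
    (hX : rough_path T beta X XX)
    (hf0 : Lip T f0)
    (hf : Cb_holder T (2 * beta) 3 f)
    (hf0A : exists2 g0 : R -> dom S 1 -> dom S 2,
      (forall (t : R) y, 0 <= t <= T ->
         dom_val (g0 t y) = dom_val (f0 t (dom_val y))) &
      Lip T g0)
    (hfA : exists2 g : R -> dom S 1 -> blin V (dom S 3),
      (forall (t : R) y v, 0 <= t <= T ->
         dom_val (g t y v) = dom_val (f t (dom_val y) v)) &
      Cb_holder T (2 * beta) 3 g)
    (xi : W) (hxi : domn S 2 xi) :
  let F0 := fun t y => dom_val (f0 t y) in
  let F := fun t y => blin_comp (dom_incl S 2) (f t y) in
  exists (Y : R -> W) (Y' : R -> blin V W),
    [/\ mild_solution S T beta X XX F0 F xi Y Y',
        (forall (Z : R -> W) (Z' : R -> blin V W),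
           mild_solution S T beta X XX F0 F xi Z Z' ->
           forall t : R, 0 <= t <= T -> Z t = Y t /\ Z' t = Y' t) &
        strong_solution S T beta X XX F0 F xi Y Y'].
Proof.
move=> F0 F.
have beta3 : 1 < 3 * beta by move: hbeta => /andP[h _]; rewrite mulrC -ltr_pdivrMr// div1r.
have beta2 : 2 * beta <= 1 by move: hbeta => /andP[_ h]; rewrite mulrC -ler_pdivlMr// div1r.
have [cX [HX HXX chen]] := rough_path_bounds hX.
have [Cf Hf] := Cb_holder_Taylor_bounds hf.
have [Cl Cl0 Hl] := tlift_bound VV (domC hS 2).
have [L L0 HL] := hf0.2.
have cst_ucont : ucont 0 T (fun=> 0 : W).
  by move=> e e0; exists 1 => // s t _ _ _ _; rewrite subrr normr0 ltW.
have [c0 c00 Hc0] := ucont_bounded hT (Lip_ucont hf0 cst_ucont).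
have [S1 HS1] := dom_semi hS 1; have hS1 : C0_semigroup S1 := dom_semi_C0 hS HS1.
have [MW MW1 HMW] := semi_bounded hS hT.
have [M1 M11 HM1] := @semi_bounded _ (domC hS 1) S1 hS1 T hT.
(* [A] acts from D(A^2) to D(A). [dom S 0] is [W] with its norm written as a graph norm, and
   composing with its inclusion gives [A1] from D(A) to [W]. *)
have [A HA] := dom_gen S 1; have [A0 HA0] := dom_gen S 0.
pose A1 := blin_comp (dom_incl S 0) A0.
(* A single upper bound for all constants, taken over a list so that each comparison becomes a
   membership test. *)
have [B B1 HB] := seq_bound [:: cX; Cf; Cl; L; c0; MW; M1; `|dom_incl S 1|;
  `|dom_incl S 2|; `|A|].
have up (c x : R) : c \in [:: cX; Cf; Cl; L; c0; MW; M1; `|dom_incl S 1|;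
    `|dom_incl S 2|; `|A|] -> 0 <= x -> c * x <= B * x.
  by move=> cs x0; apply: ler_wpM2r => //; exact: HB.
have xi1 : xi \in (domn S 1 : set W) by exact: mem_set hxi.1.
have hdf t y : 0 <= t <= T -> Fderiv (F t) y =
    blin_comp (postcomp V (dom_incl S 2)) (Fderiv (f t) y).
  move=> tT; have [/(_ t tT)[df _ _] _ _] := hf.
  exact: (Fderiv_blin_comp (postcomp V (dom_incl S 2)) (df 0%N y isT)).
have hl (P : blin V (blin V (domC hS 2))) z : `|tlift VV P z| <= B * `|P| * `|z|.
  by rewrite (le_trans (Hl P z))// ler_wpM2r//; apply: up; rewrite // !inE eqxx ?orbT.
have hlip h (y : domC hS 1) : 0 <= h -> h <= T ->
    `|dom_incl S 1 (S1 h y) - dom_incl S 1 y| <= h * (B * `|y|).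
  move=> h0 hhT; have gy : gendom S (dom_val y).
    have := dom_valP y; rewrite inE => hy; exact: (domn_gendom (j := 0) hy).
  have := semi_lip hS HMW h0 hhT gy; rewrite -(HS1 h y h0) => /le_trans; apply.
  apply: ler_wpM2l => //; apply: ler_pM => //; first exact: le_trans MW1.
    by apply: HB; rewrite !inE eqxx ?orbT.
  exact: (iter_gen_le_graph (j := 1) y).
have hk t y z : 0 <= t <= T -> `|f0 t y - f0 t z| <= B * `|y - z|.
  by move=> tT; rewrite (le_trans (HL t y z tT))//; apply: up; rewrite // !inE eqxx ?orbT.
have hb c : c \in [:: cX; Cf; Cl; L; c0; MW; M1; `|dom_incl S 1|;
    `|dom_incl S 2|; `|A|] -> forall x : R, x <= c -> x <= B.
  by move=> /HB cB x /le_trans; apply.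
have gen_dom n j (y : dom S n) : (j < n)%N -> gendom S (iter j (generator S) (dom_val y)).
  by move=> jn; have := dom_valP y; rewrite inE => hy; exact: domn_gendom hy jn.
have bf : Taylor_bounds T (2 * beta) B f (fun t => Fderiv (f t)).
  by apply: (Taylor_bounds_le _ Hf); apply: HB; rewrite !inE eqxx ?orbT.
have b1 : `|dom_incl S 1| <= B by apply: HB; rewrite !inE eqxx ?orbT.
have b2 : `|dom_incl S 2| <= B by apply: HB; rewrite !inE eqxx ?orbT.
have b3 : `|A| <= B by apply: HB; rewrite !inE eqxx ?orbT.
have b4 t : 0 <= t -> t <= T -> `|S1 t| <= B.
  by move=> t0 tT; apply: (hb M1 _ _ (HM1 t t0 tT)); rewrite !inE eqxx ?orbT.
have b5 t : 0 <= t -> t <= T -> `|S t| <= B.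
  by move=> t0 tT; apply: (hb MW _ _ (HMW t t0 tT)); rewrite !inE eqxx ?orbT.
have b6 t : 0 <= t <= T -> `|f0 t 0| <= B.
  by move=> tT; apply: (hb c0 _ _ (Hc0 t tT)); rewrite !inE eqxx ?orbT.
have [Y [h1 h2 h3]] := @mild_and_strong R V W (domC hS 1) (domC hS 2) VV T beta X XX
  f (fun t => Fderiv (f t)) f0 S1 (dom_incl S 1) (dom_incl S 2) A (Dom xi1) B B1 hT
  beta3 beta2
  (fun s t s0 st tT => le_trans (HX s t s0 st tT) (up _ _ (mem_head _ _) (powR_ge0 _ _)))
  (fun s t s0 st tT => le_trans (HXX s t s0 st tT) (up _ _ (mem_head _ _) (powR_ge0 _ _)))
  chen hl bf b1 b2 b3 hS1 b4 hlip hk b6 (fun Y => Lip_ucont hf0) S hS b5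
  (fun t y t0 => HS1 t y t0) HA (fun y => gen_dom 1%N 0%N y isT)
  (fun y => gen_dom 2%N 0%N y isT) A1 HA0 hdf.
by exists Y, (noise (D2 := domC hS 2) f (dom_incl S 2) Y).
Qed.
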